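(* Let $n\ge 1$, let $k\ge 0$ be a constant, and let $e\in L^2(\Omega)$ be orthogonal in $L^2(\Omega)$ to $\varphi_1,\dots,\varphi_n$. Let $g\in C^1(\mathbb R)$ be of the form $g(u)=\gamma u+b(u)$ with $\gamma$ a real constant and $b$ bounded on $\mathbb R$, and suppose that $g'(u)=\gamma+b'(u)\le M$ for all $u\in\mathbb R$, where $M>0$ is a constant. Consider the problem $$\Delta u+kg(u)=\mu_1\varphi_1+\cdots+\mu_n\varphi_n+e(x)\ \text{ in }\Omega,\qquad u=0\ \text{ on }\partial\Omega,\qquad( * )$$ and assume $$kM<\lambda_{n+1}.$$ Then given any $\xi=(\xi_1,\dots,\xi_n)\in\mathbb R^n$, one can find a unique $\mu=(\mu_1,\dots,\mu_n)\in\mathbb R^n$ for which $( * )$ has a solution $u\in H^2(\Omega)\cap H^1_0(\Omega)$ of $n$-signature $\xi$. This solution is unique. Moreover, there is a continuous curve of solutions $(u(k),\mu(k))$ of $( * )$, parametrized by $k$ (with $e$ and $\xi$ fixed), such that $u(k)$ has the fixed $n$-signature $\xi$ for all $0\le k\le 1$.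
   Context: $\Omega\subset\mathbb R^m$ is a smooth bounded domain. $0<\lambda_1<\lambda_2\le\lambda_3\le\dots\to\infty$ are the eigenvalues of $-\Delta$ on $\Omega$ with zero Dirichlet boundary condition, repeated according to multiplicity, and $\varphi_1,\varphi_2,\dots$ are corresponding eigenfunctions forming an orthonormal basis of $L^2(\Omega)$. The $n$-signature of $u\in L^2(\Omega)$ is the vector $(\xi_1,\dots,\xi_n)$ with $\xi_j=\int_\Omega u\varphi_j\,dx$.
   Formalization: The continuous curve is asserted for those k in [0,1] with kM < λ_{n+1} (all of [0,1] when M < λ_{n+1}); for one fixed k, the literal claim for all 0 ≤ k ≤ 1 fails at resonance, e.g. g(u)=λ_{n+1}u, e=φ_{n+1}, k=1. *)

(* Defs.v *)
From HB Require Import structures.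
From mathcomp Require Import all_boot all_order all_algebra.
From mathcomp Require Import all_classical all_reals all_analysis.

Set Implicit Arguments.
Unset Strict Implicit.
Unset Printing Implicit Defensive.

Import Order.TTheory GRing.Theory Num.Theory.
Import numFieldNormedType.Exports.

Local Open Scope classical_set_scope.
Local Open Scope ring_scope.

(* R^n is 'rV[R]_n. Its sigma-algebra is generated by the coordinate maps (as
   the library does for n.-tuple); it is the Borel sigma-algebra, so functions
   in L^2 below are Borel representatives of their a.e. classes. *)
Section measurable_rV.
Context {R : realType} (n : nat).

Let coord (i : 'I_n) (x : 'rV[R]_n) : R := x ord0 i.

Let rV_set0 : g_sigma_preimage coord set0.
Proof. exact: sigma_algebra0. Qed.

Let rV_setC A : g_sigma_preimage coord A -> g_sigma_preimage coord (~` A).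
Proof. exact: sigma_algebraC. Qed.

Let rV_bigcup (F : (set 'rV[R]_n)^nat) : (forall i, g_sigma_preimage coord (F i)) ->
  g_sigma_preimage coord (\bigcup_i (F i)).
Proof. exact: sigma_algebra_bigcup. Qed.

HB.instance Definition _ := @isMeasurable.Build default_measure_display
  'rV[R]_n (g_sigma_preimage coord) rV_set0 rV_setC rV_bigcup.

Lemma measurable_coord (i : 'I_n) :
  measurable_fun [set: 'rV[R]_n] (fun x : 'rV[R]_n => x ord0 i).
Proof.
move=> _ Y mY; rewrite setTI; apply: sub_sigma_algebra => /=.
rewrite -bigcup_seq/=; exists i => /=; first by rewrite mem_index_enum.
by exists Y => //; rewrite setTI.
Qed.

Lemma measurable_fun_rVP d (T : measurableType d) (f : T -> 'rV[R]_n) :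
  (forall i, measurable_fun [set: T] (fun t => f t ord0 i)) ->
  measurable_fun [set: T] f.
Proof.
move=> mf; suff H : g_sigma_preimage (fun i => coord i \o f) `<=` measurable.
  rewrite g_sigma_preimage_comp in H.
  by move=> _ A mA; apply: H; exists A.
apply: smallest_sub; first exact: sigma_algebra_measurable.
rewrite -bigcup_seq; apply: bigcup_sub => i _ A [B mB <-].
exact: mf.
Qed.

End measurable_rV.

Section lebesgue_rV.
Context {R : realType}.

Definition rcons_rV n (xt : 'rV[R]_n * R) : 'rV[R]_n.+1 :=
  \row_i (if unlift ord_max i is Some j then xt.1 ord0 j else xt.2).

Lemma measurable_rcons_rV n :
  measurable_fun [set: ('rV[R]_n * R)%type] (@rcons_rV n).
Proof.
apply: measurable_fun_rVP => i.
under eq_fun do rewrite mxE.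
case: (unlift _ _) => [j|]; last exact: measurable_snd.
exact: (measurableT_comp (measurable_coord j) measurable_fst).
Qed.

Section step.
Variables (n : nat) (m : {measure set 'rV[R]_n -> \bar R}).

Definition lebesgue_step (A : set 'rV[R]_n.+1) : \bar R :=
  pushforward (m \x (@lebesgue_measure R))%E (@rcons_rV n) A.

Let step0 : lebesgue_step set0 = 0%E.
Proof. by rewrite /lebesgue_step /pushforward preimage_set0 measure0. Qed.

Let step_ge0 A : (0 <= lebesgue_step A)%E.
Proof. by rewrite /lebesgue_step /pushforward; exact: measure_ge0. Qed.

Let step_sigma_additive : semi_sigma_additive lebesgue_step.
Proof.
move=> F mF tF mUF.
have mc (B : set 'rV[R]_n.+1) :
    measurable B -> measurable ((@rcons_rV n) @^-1` B).
  by move=> mB; rewrite -[X in measurable X]setTI; exact: measurable_rcons_rV.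
rewrite /lebesgue_step /pushforward preimage_bigcup.
apply: measure_semi_sigma_additive.
- by move=> i; exact: mc.
- apply/trivIsetP => /= i j _ _ ij; rewrite -preimage_setI.
  by move/trivIsetP : tF => /(_ _ _ _ _ ij) ->//; rewrite preimage_set0.
- by rewrite -preimage_bigcup; exact: mc.
Qed.

HB.instance Definition _ := isMeasure.Build _ _ _
  lebesgue_step step0 step_ge0 step_sigma_additive.

End step.

Fixpoint lebesgue_rV n : {measure set 'rV[R]_n -> \bar R} :=
  match n with
  | 0 => dirac (0 : 'rV[R]_0)
  | n.+1 => lebesgue_step (lebesgue_rV n)
  end.

End lebesgue_rV.

Section smooth.
Context {R : realType} {n : nat}.
Implicit Types f : 'rV[R]_n -> R.

Definition pderiv (i : 'I_n) f : 'rV[R]_n -> R :=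
  fun x => 'D_(delta_mx ord0 i) f x.

(* pderivs [:: i1; ..; ik] f = d_i1 (.. (d_ik f)) *)
Definition pderivs (s : seq 'I_n) f : 'rV[R]_n -> R := foldr pderiv f s.

Definition smooth f : Prop := forall s : seq 'I_n,
  continuous (pderivs s f) /\
  forall i x, derivable (pderivs s f) x (delta_mx ord0 i).

Definition test_function (Om : set 'rV[R]_n) f : Prop :=
  [/\ smooth f, compact (closure [set x | f x != 0]) &
      closure [set x | f x != 0] `<=` Om].

End smooth.

(* Near each boundary point, after relabelling and reorienting the axes, Om
   lies on one side of the graph of a C^oo function of the d other coordinates:
   col' i x is x with its i-th coordinate removed. *)
Definition smooth_boundary {R : realType} {d : nat} (Om : set 'rV[R]_d.+1) :=
  forall p, (closure Om `\` Om) p ->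
  exists (r : R) (i : 'I_d.+1) (s : bool) (h : 'rV[R]_d -> R),
    [/\ 0 < r, smooth h &
        forall x, ball p r x ->
          (Om x <-> 0 < (-1) ^+ s * (x ord0 i - h (col' i x)))].

Definition smooth_bounded_domain {R : realType} {d : nat}
    (Om : set 'rV[R]_d.+1) : Prop :=
  [/\ Om !=set0, open Om, connected Om, bounded_set Om & smooth_boundary Om].

Section sobolev.
Context {R : realType} {n : nat}.
Variable Om : set 'rV[R]_n.
Implicit Types u v : 'rV[R]_n -> R.

Local Notation leb := (@lebesgue_rV R n).

(* L^2(Om), through extension by zero outside Om. *)
Definition L2 : set ('rV[R]_n -> R) := [set u | u \_ Om \in Lfun leb 2%:E].

Definition L2norm u : R := fine ('N[leb]_2%:E[EFin \o (u \_ Om)])%E.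

Definition inner u v : R := \int[leb]_(x in Om) (u x * v x).

Definition weak_derivative (s : seq 'I_n) u v : Prop :=
  forall psi, test_function Om psi ->
    inner u (pderivs s psi) = (-1) ^+ size s * inner v psi.

Definition sobolev (k : nat) : set ('rV[R]_n -> R) := [set u | L2 u /\
  forall s : seq 'I_n, (size s <= k)%N ->
    exists v, L2 v /\ weak_derivative s u v].

(* A chosen representative of the weak derivative, which is unique a.e. in Om;
   0 if there is none in L^2(Om). *)
Definition wderiv (s : seq 'I_n) u : 'rV[R]_n -> R :=
  xget (fun=> 0) [set v | L2 v /\ weak_derivative s u v].

(* The H^k(Om) norm, with one term for each ordered list of at most k
   directions; it is equivalent to the norm indexed by multi-indices. *)
Definition sobolev_norm (k : nat) u : R := Num.sqrt
  (\sum_(j < k.+1) \sum_(s : j.-tuple 'I_n) L2norm (wderiv s u) ^+ 2).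

(* H^1_0(Om): the closure in H^1(Om) of the test functions. *)
Definition sobolev10 : set ('rV[R]_n -> R) := [set u | sobolev 1 u /\
  forall eps : R, 0 < eps ->
    exists psi, test_function Om psi /\ sobolev_norm 1 (u \- psi) < eps].

Definition laplacian u : 'rV[R]_n -> R :=
  fun x => \sum_(i < n) wderiv [:: i; i] u x.

(* Indices start at 0: lam 0 is the principal eigenvalue. Since phi is an
   orthonormal basis of L^2(Om), lam lists all the Dirichlet eigenvalues, with
   multiplicity. *)
Definition dirichlet_spectrum (lam : nat -> R) (phi : nat -> 'rV[R]_n -> R) :=
  [/\ [/\ 0 < lam 0%N, lam 0%N < lam 1%N,
          {homo lam : i j / (i <= j)%N >-> i <= j} & lam @ \oo --> +oo],
      (forall j, [/\ sobolev 2 (phi j), sobolev10 (phi j) &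
         (fun x => - laplacian (phi j) x) = (fun x => lam j * phi j x)
           %[ae leb in Om]]),
      (forall i j, inner (phi i) (phi j) = (i == j)%:R) &
      (forall f, L2 f ->
         (fun N : nat => L2norm (fun x => f x -
            \sum_(j < N) inner f (phi j) * phi j x)) @ \oo --> (0 : R))].

Definition signature (phi : nat -> 'rV[R]_n -> R) (N : nat) u : 'rV[R]_N :=
  \row_(j < N) inner u (phi j).

(* u in H^2(Om) /\ H^1_0(Om) solves
     Delta u + k g(u) = mu_1 phi_1 + .. + mu_N phi_N + e   a.e. in Om. *)
Definition solution (phi : nat -> 'rV[R]_n -> R) (N : nat) (k : R)
    (g : R -> R) (e : 'rV[R]_n -> R) (mu : 'rV[R]_N) u : Prop :=
  [/\ sobolev 2 u, sobolev10 u &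
      (fun x => laplacian u x + k * g (u x)) =
      (fun x => \sum_(j < N) mu ord0 j * phi j x + e x) %[ae leb in Om]].

End sobolev.

(* Main.v *)
(** The signature of [u] fixes its projection on [phi_1, ..., phi_n].  Testing the equation with these
    eigenfunctions determines [mu], and testing it with the others gives a semilinear problem in which
    [-Delta >= lam_(n+1) > k g'].  Hence the difference [w] of two solutions satisfies
    [(lam_(n+1) - k M) |w|^2 <= (r, w)], where [r] is the difference of the right-hand sides at the
    same function; this gives uniqueness and continuity in [k].  For existence, [b] is composed with
    the truncation to [[-j, j]]: it becomes Lipschitz, so the solutions [u_j] are fixed points of a
    contraction of L^2, and [u_j] converges because truncating changes [b u] by at most a multiple of
    [|u| / j].

    That L^2 solutions are in H^2 follows from eigenfunction expansions and the a priori estimate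
    [|D^2 u| <= C (|Delta u| + |u|)].  For a vector field [X] tangent to the boundary, a Rellich
    identity bounds [(X u, Delta v)] by [C (|Delta u| + |grad u|) |grad v|] for all [v] in H^2 and
    H^1_0.  Taking for [v] the projections of [X u] on spans of eigenfunctions shows that [X u] is in
    H^1; this replaces difference quotients at the boundary.  The remaining second derivative, in the
    normal direction, is read off from [Delta u]. *)

Require Import Defs.
From HB Require Import structures.
From mathcomp Require Import all_boot all_order all_algebra.
From mathcomp Require Import all_classical all_reals all_analysis.
From mathcomp Require Import measurable_realfun ring lra.

Set Implicit Arguments.
Unset Strict Implicit.
Unset Printing Implicit Defensive.

Import Order.TTheory GRing.Theory Num.Theory.
Import numFieldNormedType.Exports.

Local Open Scope classical_set_scope.
Local Open Scope ring_scope.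

(** * Borel sets and Lebesgue measure on row vectors *)

Section row_vectors.
Context {R : realType} {n : nat}.
Implicit Types (x y v c : 'rV[R]_n) (U A : set 'rV[R]_n).

(** Only test functions are used to define weak derivatives and H^1_0, so the argument avoids
    traces, mollification and flattening of the boundary: the geometry enters through integral
    identities. A field counts as tangential when integrating by parts along it leaves no boundary
    term. Near a boundary point this is proved with cutoffs that are functions of a defining
    function [rho] of the domain, which a field with [X rho = 0] does not differentiate. The product
    rule for a square of an L^2 function with a weak derivative comes from translation invariance of
    Lebesgue measure, and the density of test functions in L^2 from the completeness of the
    eigenfunctions, each of which is an H^1-limit of test functions.

    The H^2 estimate is only applied to functions already known to be in H^2. It makes the partial
    sums of an eigenfunction expansion Cauchy in H^2, so regularity reduces to completeness of L^2.

    Truncation is needed because [b] is only locally Lipschitz, while the contraction argument uses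
    a global Lipschitz constant. It keeps the one-sided slope bound because boundedness of [b]
    forces [gamma <= M]. *)

Lemma ball_rV x y (r : R) :
  ball x r y <-> 0 < r /\ forall i, `|x ord0 i - y ord0 i| < r.
Proof.
split=> -[r0 H]; split=> //.
- by move=> i; exact: (H ord0 i).
- by move=> i j; rewrite (ord1 i); exact: H.
Qed.

Lemma rat_dense_rV x (r : R) : 0 < r ->
  exists q : 'rV[rat]_n, ball (map_mx (ratr : rat -> R) q) r x.
Proof.
move=> r0.
have /choice[q qP] : forall i, exists q : rat, `|ratr q - x ord0 i| < r.
  move=> i; have /rat_in_itvoo[q] : x ord0 i - r < x ord0 i + r by lra.
  by rewrite in_itv/= => /andP[? ?]; exists q; rewrite ltr_norml; apply/andP; split; lra.
by exists (\row_i q i); apply/ball_rV; split=> // i; rewrite !mxE.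
Qed.

(** The balls have rational centres and radii [1/(k+1)]. Requiring the doubled ball to lie in [U]
    leaves room for a bump function on each ball with compact support in [U]. *)
Lemma open_bigcup_ball U : open U ->
  exists (D : set nat) (c : nat -> 'rV[R]_n) (r : nat -> R),
    [/\ forall j, 0 < r j, forall j, D j -> ball (c j) (2 * r j) `<=` U &
        U = \bigcup_(j in D) ball (c j) (r j)].
Proof.
move=> oU.
(* One natural number codes both the centre and the radius. Codes of nothing get a default pair,
   which the index set filters like any other. *)
pose qk (j : nat) : 'rV[rat]_n * nat := odflt (0, 0%N) (unpickle j).
pose c j : 'rV[R]_n := map_mx ratr (qk j).1.
pose r j : R := ((qk j).2.+1%:R)^-1.
have r0 j : 0 < r j by rewrite invr_gt0.
exists [set j | ball (c j) (2 * r j) `<=` U], c, r; split=> //.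
apply/seteqP; split=> [x Ux|x [j Dj xj]]; last first.
  by apply: Dj; apply: le_ball xj; have := r0 j; lra.
have /nbhs_ballP[e /= e0 xeU] := open_nbhs_nbhs (conj oU Ux).
(* The centre is within one radius of [x] and the doubled ball adds two more, hence the factor 3. *)
have [k ke] : exists k : nat, 3 * (k.+1%:R : R)^-1 < e.
  have e30 : 0 < e / 3 by lra.
  have := near_infty_natSinv_lt (PosNum e30) => -[k _ /(_ _ (leqnn k))/= H].
  by exists k; move: H; rewrite /=; set z := _^-1; lra.
have k0 : 0 < (k.+1%:R : R)^-1 by rewrite invr_gt0.
have [q xq] := rat_dense_rV x k0.
have E : qk (pickle (q, k)) = (q, k) by rewrite /qk pickleK.
exists (pickle (q, k)); rewrite /= /r /c E//= => y qy.
apply: xeU; apply: (@le_ball _ _ _ ((k.+1%:R)^-1 + 2 * (k.+1%:R)^-1)).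
  by move: ke; set z := _^-1; lra.
by apply: ball_triangle qy; exact: ball_sym.
Qed.

Lemma measurable_ball_rV c (r : R) : measurable (ball c r).
Proof.
have [r0|r0] := ltP 0 r; last first.
  rewrite (_ : ball c r = set0)//; apply/seteqP; split=> // y /ball_rV[].
  by rewrite ltNge r0.
have -> : ball c r =
    \bigcap_(i in [set: 'I_n]) ((fun x : 'rV[R]_n => x ord0 i) @^-1` ball (c ord0 i) r).
  apply/seteqP; split=> [y /ball_rV[_ yc] i _|y yc]; first exact: yc.
  by apply/ball_rV; split=> // i; exact: yc.
apply: fin_bigcap_measurable => // i _.
by rewrite -[X in measurable X]setTI; apply: measurable_coord => //; exact: measurable_ball.
Qed.

Lemma open_measurable_rV U : open U -> measurable U.
Proof.
move=> /open_bigcup_ball[D [c [r [_ _ ->]]]].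
by apply: bigcup_measurable => j _; exact: measurable_ball_rV.
Qed.

Lemma closed_measurable_rV A : closed A -> measurable A.
Proof.
move=> cA; rewrite -(setCK A); apply: measurableC.
by apply: open_measurable_rV; exact: closed_openC.
Qed.

Lemma continuous_measurable_rV (f : 'rV[R]_n -> R) :
  continuous f -> measurable_fun setT f.
Proof.
move=> /continuousP cf; apply: (measurability _ (RGenOpens.measurableE R)).
move=> _ [_ [a [b ->] <-]]; rewrite setTI.
by apply: open_measurable_rV; apply: cf; exact: interval_open.
Qed.

(** Lets the Dynkin argument of [density0] start from open sets, although the sigma-algebra is
    defined by coordinates. *)
Lemma measurable_rV_open : measurable = <<s (@open 'rV[R]_n) >>.
Proof.
apply/seteqP; split; last first.
  apply: smallest_sub; first exact: sigma_algebra_measurable.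
  exact: open_measurable_rV.
apply: smallest_sub; first exact: smallest_sigma_algebra.
rewrite -bigcup_seq => A [i _ [B mB <-]].
rewrite setTI; have : (@ocitv R).-sigma.-measurable B := mB.
rewrite RGenOpens.measurableE.
move: B {mB}; apply: smallest_sub.
  split; rewrite /= ?preimage_set0.
  - exact: sigma_algebra0.
  - by move=> B; rewrite setTD preimage_setC => /sigma_algebraC.
  - by move=> F mF; rewrite preimage_bigcup; exact: sigma_algebra_bigcup.
move=> _ [a [b ->]]; apply: sub_sigma_algebra; apply: open_comp => //.
  by move=> x _; exact: coord_continuous.
Qed.

Lemma measurable_translate v : measurable_fun setT (fun x : 'rV[R]_n => x + v).
Proof.
apply: measurable_fun_rVP => i; under eq_fun do rewrite mxE.
by apply: measurable_funD => //; exact: measurable_coord.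
Qed.

End row_vectors.

(** * Translation invariance of Lebesgue measure and finiteness on bounded sets *)

Section lebesgue_rV_theory.
Context {R : realType}.

Lemma lebesgue_measure_translation (t : R) (A : set R) : measurable A ->
  lebesgue_measure [set s | A (s + t)] = lebesgue_measure A.
Proof.
move=> mA; apply/esym.
have mt : @measurable_fun _ _ (measurableTypeR R) (measurableTypeR R) setT (fun s => s + t).
  exact: (@measurable_funD _ R).
rewrite [RHS](_ : _ = pushforward (@lebesgue_measure R) (fun s => s + t) A)//.
have := @lebesgue_measure_unique R
  (measure_function_pushforward__canonical__measure_function_Measure (@lebesgue_measure R) mt).
move=> /(_ _ A mA); apply.
move=> _ [[a b] _ <-].
rewrite /pushforward [X in _ = lebesgue_measure X](_ : _ = `]a - t, b - t]%classic).
  rewrite /= !lebesgue_measure_itv/= !lte_fin ltrBlDr subrK.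
  by case: ifP => // _; congr (_%:E); ring.
by apply/seteqP; split=> s /=; rewrite !in_itv/= => /andP[? ?]; apply/andP; split; lra.
Qed.

(** Induction on the dimension: the last coordinate is translated inside each section, the others by
    a change of variables in the outer integral, justified by the induction hypothesis. *)
Lemma lebesgue_rV_translation n (v : 'rV[R]_n) (A : set 'rV[R]_n) : measurable A ->
  lebesgue_rV n [set x | A (x + v)] = lebesgue_rV n A.
Proof.
elim: n v A => [|n IH] v A mA /=.
  rewrite !diracE; congr (_%:R%:E); congr (nat_of_bool _); apply/asboolP/asboolP => /=;
    by rewrite (_ : 0 + v = 0)//; apply/rowP; case.
rewrite /lebesgue_step /pushforward /= /product_measure1.
pose w : 'rV[R]_n := \row_i v ord0 (lift ord_max i).
pose t := v ord0 ord_max.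
have E (x : 'rV[R]_n) (s : R) : rcons_rV (x, s) + v = rcons_rV (x + w, s + t).
  apply/rowP => i; rewrite !mxE/=.
  by case: unliftP => [j|] ->; rewrite ?mxE.
set B := (@rcons_rV R n) @^-1` A.
have mB : measurable B.
  by rewrite -[X in measurable X]setTI; exact: measurable_rcons_rV.
pose F (x : 'rV[R]_n) := lebesgue_measure (xsection B x).
transitivity (\int[lebesgue_rV n]_x F (x + w)%R)%E.
  apply: eq_integral => x _; rewrite /F /=.
  rewrite -(@lebesgue_measure_translation t (xsection B (x + w))); last exact: measurable_xsection.
  by congr (lebesgue_measure _); apply/seteqP; split=> s /=; rewrite !xsectionE/= /B/= E.
have mF : measurable_fun setT F by exact: measurable_fun_xsection.
transitivity (\int[pushforward (lebesgue_rV n) (fun x => x + w)%R]_x F x)%E.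
  by rewrite (ge0_integral_pushforward (measurable_translate w)).
have pE D : measurable D -> D `<=` setT ->
    pushforward (lebesgue_rV n) (fun x => x + w) D = lebesgue_rV n D.
  by move=> mD _; exact: IH.
have := @eq_measure_integral _ 'rV[R]_n R setT (lebesgue_rV n)
  (measure_function_pushforward__canonical__measure_function_Measure (lebesgue_rV n) (measurable_translate w)) F.
by move=> /(_ pE).
Qed.

Lemma lebesgue_rV_box n (r : R) :
  (lebesgue_rV n [set x : 'rV[R]_n | forall i, (`|x ord0 i| <= r)%R] < +oo)%E.
Proof.
elim: n => [|n IH] /=; first by rewrite diracE ltry.
rewrite /lebesgue_step /pushforward.
have -> : (@rcons_rV R n) @^-1` [set x | forall i, `|x ord0 i| <= r] =
    [set x : 'rV[R]_n | forall i, `|x ord0 i| <= r] `*` `[-r, r]%classic.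
  apply/seteqP; split=> [[x s] /= H|[x s] [/= H1 H2] i].
    split=> /=.
      by move=> i; have := H (lift ord_max i); rewrite mxE liftK.
    by have := H ord_max; rewrite mxE unlift_none /= in_itv/= ler_norml.
  rewrite mxE; case: unliftP => [j|] _ //=.
  by move: H2; rewrite /= in_itv/= ler_norml.
rewrite product_measure1E//.
  by rewrite lte_mul_pinfty// ?ge0_fin_numE//= lebesgue_measure_itv/=; case: ifP => _; rewrite ?ltry.
have -> : [set x : 'rV[R]_n | forall i, `|x ord0 i| <= r] =
   \bigcap_(i in [set: 'I_n]) ((fun x : 'rV[R]_n => x ord0 i) @^-1` `[-r, r]%classic).
  apply/seteqP; split=> [y yc i _|y yc i]; first by rewrite /= in_itv/= -ler_norml.
  by have := yc i I; rewrite /= in_itv/= -ler_norml.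
apply: fin_bigcap_measurable => // i _.
by rewrite -[X in measurable X]setTI; exact: measurable_coord.
Qed.

Lemma bounded_set_rV n (A : set 'rV[R]_n) : bounded_set A ->
  exists2 r : R, 0 < r & forall x, A x -> forall i, `|x ord0 i| <= r.
Proof.
move=> [M0 [M0r H]]; exists (`|M0| + 1); first by rewrite ltr_wpDl.
move=> x Ax i; have /(_ _ x Ax) /= := H (`|M0| + 1).
have -> : M0 < `|M0| + 1 by rewrite (le_lt_trans (ler_norm _))// ltrDl.
move=> /(_ isT) xM; apply: le_trans xM; rewrite /Num.norm/= mx_normrE.
by apply/bigmax_geP; right; exists (ord0, i).
Qed.

Lemma lebesgue_rV_bounded n (A : set 'rV[R]_n) : measurable A -> bounded_set A ->
  (lebesgue_rV n A < +oo)%E.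
Proof.
move=> mA /bounded_set_rV[r r0 Ar].
apply: le_lt_trans (lebesgue_rV_box n r); apply: le_measure; rewrite ?inE//.
apply: closed_measurable_rV.
have -> : [set x : 'rV[R]_n | forall i, `|x ord0 i| <= r] =
   \bigcap_(i in [set: 'I_n]) ((fun x : 'rV[R]_n => x ord0 i) @^-1` `[-r, r]%classic).
  apply/seteqP; split=> [y yc i _|y yc i]; first by rewrite /= in_itv/= -ler_norml.
  by have := yc i I; rewrite /= in_itv/= -ler_norml.
apply: closed_bigI => i _; apply: closed_comp => //; last exact: interval_closed.
by move=> x _; exact: coord_continuous.
Qed.

End lebesgue_rV_theory.

(** * The Hilbert space L^2 *)

Section L2_theory.
Context {R : realType} {n : nat}.
Variable Om : set 'rV[R]_n.
Hypothesis mOm : measurable Om.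
Implicit Types (u v w a : 'rV[R]_n -> R) (c : R).

Local Notation leb := (@lebesgue_rV R n).
Local Notation L2 := (L2 Om).
Local Notation inner := (inner Om).
Local Notation L2norm := (L2norm Om).

Lemma L2P u : L2 u <-> measurable_fun Om u /\
  leb.-integrable Om (EFin \o (fun x => u x ^+ 2)).
Proof.
have E : (fun x => (u \_ Om) x ^+ 2) = (fun x => u x ^+ 2) \_ Om.
  by apply/funext => x; rewrite /patch; case: ifP => // _; rewrite expr0n.
have E' : EFin \o (fun x => u x ^+ 2) \_ Om = (EFin \o (fun x => u x ^+ 2)) \_ Om.
  by apply/funext => x; rewrite /patch /=; case: ifP.
split=> [uL|[mu iu]].
  split; last first.
    have := Lfun2_integrable_sqr uL; rewrite E E'.
    by move/(integrable_mkcond _ mOm).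
  by move: uL; rewrite /Defs.L2 /= inE => /andP[/[!inE] + _]; move/(measurable_restrictT _ mOm).
rewrite /Defs.L2 /= inE; apply/andP; split; rewrite inE.
  exact/(measurable_restrictT _ mOm).
rewrite /= /finite_norm unlock /Lnorm.body; apply: poweR_lty.
move/(integrable_mkcond _ mOm) : iu; rewrite -E' -E => /integrableP[_].
apply: le_lt_trans; apply: ge0_le_integral => //=.
- apply/measurable_EFinP; apply: (measurableT_comp (measurable_powR _)) => //.
  by apply: measurableT_comp => //; exact/(measurable_restrictT _ mOm).
- apply/measurable_EFinP; apply: measurableT_comp => //; apply: measurable_funX.
  exact/(measurable_restrictT _ mOm).
- by move=> x _; rewrite lee_fin powR_mulrn// normrX.
Qed.

Lemma L2_measurable u : L2 u -> measurable_fun Om u.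
Proof. by case/L2P. Qed.

Lemma L2_sqr_integrable u : L2 u -> leb.-integrable Om (EFin \o (fun x => u x ^+ 2)).
Proof. by case/L2P. Qed.

Lemma L2_mul_integrable u v : L2 u -> L2 v -> leb.-integrable Om (EFin \o (u \* v)).
Proof.
move=> /L2P[mu iu] /L2P[mv iv].
apply: le_integrable (integrableD mOm iu iv) => //.
  by apply/measurable_EFinP; exact: measurable_funM.
move=> x _ /=; rewrite lee_fin normrM [leRHS]ger0_norm ?addr_ge0 ?sqr_ge0//.
rewrite -[u x ^+ 2]real_normK ?num_real// -[v x ^+ 2]real_normK ?num_real//.
by have := sqr_ge0 (`|u x| - `|v x|); have := normr_ge0 (u x); have := normr_ge0 (v x); nra.
Qed.

Lemma L2norm2 u : L2 u -> L2norm u ^+ 2 = inner u u.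
Proof.
move=> uL; rewrite /Defs.L2norm unlock /Lnorm.body /Defs.inner.
rewrite Rintegral_mkcond /Rintegral.
have -> : (\int[leb]_x (`|(EFin \o u \_ Om) x| `^ 2))%E =
   (\int[leb]_x ((fun x => u x * u x) \_ Om x)%:E)%E.
  apply: eq_integral => x _ /=; rewrite powR_mulrn//; congr _%:E.
  by rewrite /patch; case: ifP => _; rewrite ?normr0 ?expr0n// real_normK ?num_real.
set I := (\int[leb]_x _)%E.
have I0 : (0 <= I)%E.
  apply: integral_ge0 => x _; rewrite lee_fin /patch; case: ifP => // _.
  by rewrite -expr2 sqr_ge0.
have If : I \is a fin_num.
  apply: integrable_fin_num => //.
  have := L2_mul_integrable uL uL => /(integrable_mkcond _ mOm).
  congr (_.-integrable _ _); apply/funext => x; rewrite /patch /=; by case: ifP.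
rewrite -(fineK If) poweR_EFin /= -powR_mulrn ?powR_ge0// -powRrM mulVf// powRr1//.
exact: fine_ge0.
Qed.

Lemma L2norm_ge0 u : 0 <= L2norm u.
Proof. by apply: fine_ge0; exact: Lnorm_ge0. Qed.

Lemma L2normE u : L2 u -> L2norm u = Num.sqrt (inner u u).
Proof. by move=> uL; rewrite -L2norm2// sqrtr_sqr ger0_norm// L2norm_ge0. Qed.

Lemma L2_eq u v : {in Om, u =1 v} -> L2 u -> L2 v.
Proof.
move=> uv; suff uE : u \_ Om = v \_ Om by rewrite /Defs.L2 /= uE.
by apply/funext => x; rewrite /patch; case: ifPn => // /uv.
Qed.

Lemma inner_eq u v u' v' : {in Om, u =1 u'} -> {in Om, v =1 v'} ->
  inner u v = inner u' v'.
Proof. by move=> uu vv; apply: eq_Rintegral => x xO; rewrite uu// vv. Qed.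

Lemma L2norm_eq u v : {in Om, u =1 v} -> L2norm u = L2norm v.
Proof.
move=> uv; rewrite /Defs.L2norm; congr (fine (Lnorm _ _ (EFin \o _))).
by apply/funext => x; rewrite /patch; case: ifPn => // /uv.
Qed.

Lemma L2D u v : L2 u -> L2 v -> L2 (u \+ v).
Proof.
move=> uL vL; apply/L2P; split; first by apply: measurable_funD; exact: L2_measurable.
have := integrableD mOm (L2_sqr_integrable uL) (integrableD mOm (L2_sqr_integrable vL)
  (integrableZl mOm 2 (L2_mul_integrable uL vL))).
congr (_.-integrable _ _); apply/funext => x /=; rewrite -EFinM -!EFinD; congr _%:E; ring.
Qed.

Lemma L2_bddM a u c : measurable_fun Om a -> (forall x, Om x -> `|a x| <= c) ->
  L2 u -> L2 (a \* u).
Proof.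
move=> ma ac uL; apply/L2P; split; first by apply: measurable_funM => //; exact: L2_measurable.
apply: le_integrable (integrableZl mOm (c ^+ 2) (L2_sqr_integrable uL)) => //.
  by apply/measurable_EFinP; apply: measurable_funX; apply: measurable_funM => //; exact: L2_measurable.
move=> x Ox /=; rewrite lee_fin exprMn !normrM ler_wpM2r ?normr_ge0//.
by apply: ler_pM => //; exact: le_trans (ac _ Ox) (ler_norm _).
Qed.

Lemma L2Z c u : L2 u -> L2 (c \*o u).
Proof.
by move=> uL; apply: (@L2_bddM (cst c) u `|c|) => //; exact: measurable_cst.
Qed.

Lemma L2N u : L2 u -> L2 (\- u).
Proof. by move=> /(L2Z (-1)); apply: L2_eq => x _ /=; rewrite mulN1r. Qed.

Lemma L2B u v : L2 u -> L2 v -> L2 (u \- v).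
Proof. by move=> uL /L2N vL; exact: L2D. Qed.

Lemma L2_0 : L2 (fun=> 0).
Proof.
apply/L2P; split; first exact: measurable_cst.
apply: eq_integrable (integrable0 _ Om) => // x _ /=; by rewrite expr0n.
Qed.

Lemma L2_sum I (s : seq I) (P : pred I) (F : I -> 'rV[R]_n -> R) :
  (forall i, L2 (F i)) -> L2 (fun x => \sum_(i <- s | P i) F i x).
Proof.
move=> FL; elim: s => [|i s IH].
  by apply: L2_eq L2_0 => x _; rewrite big_nil.
have [Pi|Pi] := boolP (P i).
  by apply: L2_eq (L2D (FL i) IH) => x _; rewrite big_cons Pi.
by apply: L2_eq IH => x _; rewrite big_cons (negbTE Pi).
Qed.

Lemma innerC u v : inner u v = inner v u.
Proof. by apply: eq_Rintegral => x _; rewrite mulrC. Qed.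

Lemma inner_mulA a u v : inner (a \* u) v = inner u (a \* v).
Proof. by apply: eq_Rintegral => x _ /=; ring. Qed.

Lemma innerDl u v w : L2 u -> L2 v -> L2 w -> inner (u \+ v) w = inner u w + inner v w.
Proof.
move=> uL vL wL; rewrite /Defs.inner -RintegralD//; try exact: L2_mul_integrable.
by apply: eq_Rintegral => x _ /=; rewrite mulrDl.
Qed.

Lemma innerDr u v w : L2 u -> L2 v -> L2 w -> inner w (u \+ v) = inner w u + inner w v.
Proof. by move=> *; rewrite innerC innerDl// !(innerC w). Qed.

Lemma innerZl c u v : L2 u -> L2 v -> inner (c \*o u) v = c * inner u v.
Proof.
move=> uL vL; rewrite /Defs.inner -RintegralZl//; last exact: L2_mul_integrable.
by apply: eq_Rintegral => x _ /=; rewrite mulrA.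
Qed.

Lemma innerZr c u v : L2 u -> L2 v -> inner v (c \*o u) = c * inner v u.
Proof. by move=> *; rewrite innerC innerZl// innerC. Qed.

Lemma innerNl u v : L2 u -> L2 v -> inner (\- u) v = - inner u v.
Proof.
move=> uL vL; rewrite -mulN1r -innerZl//; apply: inner_eq => // x _ /=; by rewrite mulN1r.
Qed.

Lemma innerBl u v w : L2 u -> L2 v -> L2 w -> inner (u \- v) w = inner u w - inner v w.
Proof. by move=> uL vL wL; rewrite -innerNl// -innerDl//; exact: L2N. Qed.

Lemma innerBr u v w : L2 u -> L2 v -> L2 w -> inner w (u \- v) = inner w u - inner w v.
Proof. by move=> *; rewrite innerC innerBl// !(innerC w). Qed.

Lemma inner0l v : inner (fun=> 0) v = 0.
Proof. by rewrite /Defs.inner; under eq_Rintegral do rewrite mul0r; rewrite /Rintegral integral0. Qed.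

Lemma inner0r v : inner v (fun=> 0) = 0.
Proof. by rewrite innerC inner0l. Qed.

Lemma inner_suml I (s : seq I) (P : pred I) (F : I -> 'rV[R]_n -> R) v :
  (forall i, L2 (F i)) -> L2 v ->
  inner (fun x => \sum_(i <- s | P i) F i x) v = \sum_(i <- s | P i) inner (F i) v.
Proof.
move=> FL vL; elim: s => [|i s IH].
  by rewrite big_nil -[RHS](inner0l v); apply: inner_eq => // x _; rewrite big_nil.
rewrite big_cons -IH; have [Pi|Pi] := boolP (P i); last first.
  by apply: inner_eq => // x _; rewrite big_cons (negbTE Pi).
rewrite -innerDl//; last exact: L2_sum.
by apply: inner_eq => // x _; rewrite big_cons Pi.
Qed.

Lemma inner_sumr I (s : seq I) (P : pred I) (F : I -> 'rV[R]_n -> R) v :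
  (forall i, L2 (F i)) -> L2 v ->
  inner v (fun x => \sum_(i <- s | P i) F i x) = \sum_(i <- s | P i) inner v (F i).
Proof. by move=> FL vL; rewrite innerC inner_suml//; apply: eq_bigr => i _; exact: innerC. Qed.

Lemma L2norm2D u v : L2 u -> L2 v ->
  L2norm (u \+ v) ^+ 2 = L2norm u ^+ 2 + 2 * inner u v + L2norm v ^+ 2.
Proof.
move=> uL vL; have uvL := L2D uL vL.
by rewrite !L2norm2// innerDl// !innerDr// (innerC v u); ring.
Qed.

Lemma L2normZ c u : L2 u -> L2norm (c \*o u) = `|c| * L2norm u.
Proof.
move=> uL; have cuL := L2Z c uL.
rewrite !L2normE// innerZl// innerZr// mulrA -expr2 sqrtrM ?sqr_ge0// sqrtr_sqr//.
Qed.

Lemma L2normN u : L2 u -> L2norm (\- u) = L2norm u.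
Proof.
move=> uL; rewrite -[RHS]mul1r -(normrN1 R) -L2normZ//.
by apply: L2norm_eq => x _ /=; rewrite mulN1r.
Qed.

Lemma L2normBC u v : L2 u -> L2 v -> L2norm (u \- v) = L2norm (v \- u).
Proof.
move=> uL vL; rewrite -L2normN; last exact: L2B.
by apply: L2norm_eq => x _ /=; rewrite opprB.
Qed.

Lemma inner_CS u v : L2 u -> L2 v -> `|inner u v| <= L2norm u * L2norm v.
Proof.
move=> uL vL; set p := inner u v.
have A c : 0 <= L2norm u ^+ 2 + 2 * c * p + c ^+ 2 * L2norm v ^+ 2.
  have := sqr_ge0 (L2norm (u \+ (c \*o v))); rewrite L2norm2D//; last exact: L2Z.
  by rewrite innerZr// L2normZ// exprMn real_normK ?num_real// -/p; nra.
have u0 := L2norm_ge0 u; have v0 := L2norm_ge0 v.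
rewrite -(@ler_pXn2r _ 2)// ?nnegrE ?mulr_ge0// real_normK ?num_real//.
have [vE|vN] := eqVneq (L2norm v) 0.
  rewrite vE mulr0 expr0n /=; have [->|p0] := eqVneq p 0; first by rewrite expr0n.
  (* When [v] has norm 0 the quadratic form is affine in [c]; this value of [c] makes it equal to
     -1. *)
  have := A (- (L2norm u ^+ 2 + 1) / (2 * p)); rewrite vE.
  rewrite (_ : _ + _ + _ = -1); last by field.
  by rewrite ler0N1.
have vp : 0 < L2norm v ^+ 2 by rewrite exprn_gt0// lt_neqAle eq_sym vN.
have := A (- p / L2norm v ^+ 2); move=> /(mulr_ge0 (ltW vp)).
by rewrite exprMn -subr_ge0; congr (_ <= _); field.
Qed.

Lemma L2normD_le u v : L2 u -> L2 v -> L2norm (u \+ v) <= L2norm u + L2norm v.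
Proof.
move=> uL vL; rewrite -(@ler_pXn2r _ 2)// ?nnegrE ?addr_ge0 ?L2norm_ge0//.
rewrite L2norm2D//; have := le_trans (ler_norm _) (inner_CS uL vL).
by move: (inner u v) (L2norm u) (L2norm v) => p a b; nra.
Qed.

Lemma L2normB_le u v : L2 u -> L2 v -> L2norm (u \- v) <= L2norm u + L2norm v.
Proof. by move=> uL vL; rewrite -(L2normN vL); apply: L2normD_le => //; exact: L2N. Qed.

Lemma L2norm_tri u v w : L2 u -> L2 v -> L2 w ->
  L2norm (u \- w) <= L2norm (u \- v) + L2norm (v \- w).
Proof.
move=> uL vL wL; rewrite (@L2norm_eq _ ((u \- v) \+ (v \- w))); last first.
  by move=> x _ /=; ring.
by apply: L2normD_le; exact: L2B.
Qed.

Lemma L2norm_distB u v : L2 u -> L2 v -> `|L2norm u - L2norm v| <= L2norm (u \- v).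
Proof.
move=> uL vL; have := L2normD_le (L2B uL vL) vL; have := L2normD_le (L2B vL uL) uL.
rewrite (L2normBC vL uL) (@L2norm_eq ((v \- u) \+ u) v); last by move=> x _ /=; ring.
rewrite (@L2norm_eq ((u \- v) \+ v) u); last by move=> x _ /=; ring.
by move=> A B; rewrite ler_norml; apply/andP; split; lra.
Qed.

Lemma L2norm0 : L2norm (fun=> 0) = 0.
Proof. by rewrite L2normE ?inner0l ?sqrtr0//; exact: L2_0. Qed.

Lemma L2norm_sum I (s : seq I) (P : pred I) (F : I -> 'rV[R]_n -> R) :
  (forall i, L2 (F i)) ->
  L2norm (fun x => \sum_(i <- s | P i) F i x) <= \sum_(i <- s | P i) L2norm (F i).
Proof.
move=> FL; elim: s => [|i s IH].
  by rewrite big_nil (@L2norm_eq _ (fun=> 0)) ?L2norm0// => x _; rewrite big_nil.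
rewrite big_cons; have [Pi|Pi] := boolP (P i); last first.
  by rewrite (@L2norm_eq _ (fun x => \sum_(i <- s | P i) F i x))// => x _; rewrite big_cons (negbTE Pi).
rewrite (@L2norm_eq _ (F i \+ (fun x => \sum_(i <- s | P i) F i x))); last first.
  by move=> x _; rewrite big_cons Pi.
by apply: le_trans (L2normD_le (FL i) (L2_sum _ _ FL)) _; rewrite lerD2l.
Qed.

Lemma L2_bddM_le a u c : measurable_fun Om a -> (forall x, Om x -> `|a x| <= c) ->
  L2 u -> L2norm (a \* u) <= c * L2norm u.
Proof.
move=> ma ac uL; have auL := L2_bddM ma ac uL.
have [[x Ox]|OE] := pselect (Om !=set0); last first.
  have E v : L2norm v = 0.
    rewrite -L2norm0; apply: L2norm_eq => y; rewrite inE => Oy.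
    by exfalso; apply: OE; exists y.
  by rewrite !E mulr0.
have c0 : 0 <= c by apply: le_trans (ac x Ox); exact: normr_ge0.
rewrite -(@ler_pXn2r _ 2)// ?nnegrE ?mulr_ge0 ?L2norm_ge0//.
rewrite exprMn !L2norm2// /Defs.inner -RintegralZl//; last exact: L2_mul_integrable.
apply: le_Rintegral => //=; first exact: L2_mul_integrable.
  exact: (integrableZl mOm (c ^+ 2) (L2_mul_integrable uL uL)).
move=> y Oy; have := ac _ Oy; rewrite ler_norml => /andP[A B].
have : a y ^+ 2 <= c ^+ 2 by nra.
by have := sqr_ge0 (u y); nra.
Qed.

Lemma inner_ae_eq u v u' v' : L2 u -> L2 v -> L2 u' -> L2 v' ->
  u = u' %[ae leb in Om] -> v = v' %[ae leb in Om] -> inner u v = inner u' v'.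
Proof.
move=> /L2_measurable ? /L2_measurable ? /L2_measurable ? /L2_measurable ? uu vv.
rewrite /Defs.inner /Rintegral; congr fine; apply: ae_eq_integral => //.
- by apply/measurable_EFinP; exact: measurable_funM.
- by apply/measurable_EFinP; exact: measurable_funM.
- by apply: filterS2 uu vv => x /[swap] H /[swap] Ox /(_ Ox) <-; rewrite H.
Qed.

Lemma L2norm0_ae u : L2 u -> L2norm u = 0 -> u = (fun=> 0) %[ae leb in Om].
Proof.
move=> uL u0; have /L2P[mu iu] := uL.
have : (\int[leb]_(x in Om) `|(EFin \o (fun x => u x ^+ 2)%R) x|)%E = 0%E.
  have fi : (\int[leb]_(x in Om) (u x * u x)%:E)%E \is a fin_num.
    by apply: integrable_fin_num => //; exact: L2_mul_integrable uL uL.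
  have := L2norm2 uL; rewrite u0 expr0n /= /Defs.inner /Rintegral => /esym I0.
  transitivity ((fine (\int[leb]_(x in Om) (u x * u x)%:E))%:E)%E; last by rewrite I0.
  rewrite fineK//.
  by apply: eq_integral => x _ /=; rewrite ger0_norm ?sqr_ge0// expr2.
move/ae_eq_integral_abs => /(_ mOm).
have mf : measurable_fun Om (EFin \o (fun x => u x ^+ 2)) by apply/measurable_EFinP; exact: measurable_funX.
move=> /(_ mf); apply: filterS => x H Ox; have := H Ox => /= -[] /eqP.
by rewrite sqrf_eq0 => /eqP.
Qed.

Lemma ae_L2normB0 u v : L2 u -> L2 v -> L2norm (u \- v) = 0 -> u = v %[ae leb in Om].
Proof.
move=> uL vL /(L2norm0_ae (L2B uL vL)); apply: filterS => x H Ox.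
by have /eqP := H Ox; rewrite subr_eq0 => /eqP.
Qed.

Lemma L2norm_ae_eq u v : L2 u -> L2 v -> u = v %[ae leb in Om] -> L2norm u = L2norm v.
Proof. by move=> uL vL uv; rewrite !L2normE//; congr Num.sqrt; exact: inner_ae_eq. Qed.

Lemma inner_cvgl (u_ : nat -> 'rV[R]_n -> R) u v : (forall m, L2 (u_ m)) -> L2 u -> L2 v ->
  L2norm (u_ m \- u) @[m --> \oo] --> (0 : R) -> inner (u_ m) v @[m --> \oo] --> inner u v.
Proof.
move=> u_L uL vL H; apply/cvgrPdist_le => /= e e0.
have vp : 0 < L2norm v + 1 by rewrite ltr_wpDl// L2norm_ge0.
have e'0 : 0 < e / (L2norm v + 1) by rewrite divr_gt0.
move/cvgrPdist_le : H => /(_ _ e'0); apply: filterS => m.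
rewrite sub0r normrN ger0_norm ?L2norm_ge0// ler_pdivlMr// => H.
rewrite distrC -innerBl//; apply: le_trans (inner_CS (L2B (u_L m) uL) vL) _.
by have := L2norm_ge0 (u_ m \- u); nra.
Qed.

Lemma inner_dominated (f_ : nat -> 'rV[R]_n -> R) f c v w :
  (forall m, measurable_fun Om (f_ m)) -> measurable_fun Om (f : _ -> R) ->
  (forall m x, Om x -> `|f_ m x| <= c) ->
  (forall x, Om x -> f_ m x @[m --> \oo] --> f x) -> L2 v -> L2 w ->
  inner (f_ m \* v) w @[m --> \oo] --> inner (f \* v) w.
Proof.
move=> mf_ mf fc ff vL wL.
have vwi := L2_mul_integrable vL wL.
have mvw : measurable_fun Om (v \* w).
  by apply: measurable_funM; exact: L2_measurable.
have := @dominated_convergence _ _ _ leb Om mOm (fun m x => (f_ m x * (v x * w x))%:E)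
  (fun x => (f x * (v x * w x))%:E) (fun x => (`|c|%:E * `|(v x * w x)%:E|)%E).
case.
- by move=> m; apply/measurable_EFinP; exact: measurable_funM.
- by apply/measurable_EFinP; exact: measurable_funM.
- apply: aeW => x Ox; apply: cvg_EFin; first exact: nearW.
  by apply: cvgMr_tmp; exact: ff.
- exact: (integrableZl mOm `|c| (integrable_abse vwi)).
- apply: aeW => x m Ox; rewrite /= lee_fin normrM ler_wpM2r//.
  exact: le_trans (fc _ _ Ox) (ler_norm _).
move=> fi _ H.
have E g : inner (g \* v) w = fine (\int[leb]_(x in Om) (g x * (v x * w x))%:E)%E.
  by rewrite /Defs.inner /Rintegral; congr fine; apply: eq_integral => x _; rewrite /= mulrA.
rewrite E; under eq_fun do rewrite E.
by apply: fine_cvg; rewrite fineK//; exact: integrable_fin_num.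
Qed.

(** Fatou's lemma for the squares gives membership of the limit and the norm bound at once;
    completeness uses both. *)
Lemma L2_fatou (f_ : nat -> 'rV[R]_n -> R) f c : (forall m, L2 (f_ m)) ->
  measurable_fun Om (f : _ -> R) -> {ae leb, forall x, Om x -> f_ m x @[m --> \oo] --> f x} ->
  0 <= c -> (forall m, L2norm (f_ m) <= c) -> L2 f /\ L2norm f <= c.
Proof.
move=> fL mf ff c0 fc.
have intE u : L2 u -> (\int[leb]_(x in Om) (u x ^+ 2)%:E)%E = (L2norm u ^+ 2)%:E.
  move=> uL; rewrite L2norm2// /Defs.inner /Rintegral fineK; last first.
    by apply: integrable_fin_num => //; exact: (L2_mul_integrable uL uL).
  by apply: eq_integral => x _; rewrite expr2.
have H : (\int[leb]_(x in Om) (f x ^+ 2)%:E <= (c ^+ 2)%:E)%E.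
  rewrite (ae_eq_integral (fun x => limn_einf (fun m => (f_ m x ^+ 2)%:E)))//.
  - apply: le_trans (fatou _ mOm _ _) _.
    + by move=> m; apply/measurable_EFinP; apply: measurable_funX; exact: L2_measurable.
    + by move=> m x _; rewrite lee_fin sqr_ge0.
    + apply: le_trans (limn_einf_sup _) _; apply: le_trans.
        by apply: ereal_inf_lbound; exists setT => //; exact: filterT.
      apply: ub_ereal_sup => _ [m _ <-]; rewrite intE// lee_fin.
      by rewrite lerXn2r ?nnegrE// L2norm_ge0.
  - by apply/measurable_EFinP; exact: measurable_funX.
  - rewrite /limn_einf; apply: measurableT_comp => //; apply: measurable_fun_limn_esup => m.
    apply: measurableT_comp => //.
    by apply/measurable_EFinP; apply: measurable_funX; exact: L2_measurable.
  - apply: filterS ff => x H Ox; apply/esym; apply: (cvg_limn_einf_sup _).1.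
    apply: cvg_EFin; first exact: nearW.
    by apply: cvgM; exact: H.
have fLL : L2 f.
  apply/L2P; split=> //; apply/integrableP; split.
    by apply/measurable_EFinP; exact: measurable_funX.
  apply: le_lt_trans (ltry (c ^+ 2)); apply: le_trans H.
  by rewrite le_eqVlt; apply/orP; left; apply/eqP; apply: eq_integral => x _ /=; rewrite ger0_norm ?sqr_ge0.
split=> //; move: H; rewrite intE// lee_fin => H.
by rewrite -(@ler_pXn2r _ 2)// ?nnegrE ?L2norm_ge0.
Qed.

(** Riesz-Fischer. A subsequence with increments below [2^-k] converges almost everywhere, and
    [L2_fatou] applied to [u_ m - v k] as [k] grows turns this into convergence of the whole
    sequence in norm. *)
Lemma L2_complete (u_ : nat -> 'rV[R]_n -> R) : (forall m, L2 (u_ m)) ->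
  (forall e, 0 < e -> exists N, forall m k, (N <= m)%N -> (N <= k)%N ->
     L2norm (u_ m \- u_ k) <= e) ->
  exists2 u, L2 u & L2norm (u_ m \- u) @[m --> \oo] --> (0 : R).
Proof.
move=> uL uC.
have /choice[N0 N0P] : forall k : nat, exists N, forall m j, (N <= m)%N -> (N <= j)%N ->
    L2norm (u_ m \- u_ j) <= (2^-1) ^+ k by move=> k; apply: uC; exact: exprn_gt0.
(* Summing the thresholds yields indices that increase, dominate [N0 k] and dominate [k], with no
   recursive choice. *)
pose N (k : nat) := (\sum_(i < k.+1) (N0 i).+1)%N.
have N0N k : (N0 k <= N k)%N by rewrite /N big_ord_recr/=; apply: leq_trans (leqnSn _) (leq_addl _ _).
have NS k : (N k <= N k.+1)%N by rewrite /N [leqRHS]big_ord_recr/= leq_addr.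
have Nk k : (k <= N k)%N.
  by elim: k => // k IH; rewrite /N big_ord_recr/= -addSnnS; apply: leq_trans (leq_addr _ _).
have Nhomo : {homo N : i j / (i <= j)%N} by apply: homo_leq => //; exact: leq_trans.
pose v k := u_ (N k).
have vL k : L2 (v k) by exact: uL.
have vd k : L2norm (v k.+1 \- v k) <= (2^-1) ^+ k.
  by apply: N0P => //; apply: leq_trans (NS k).
have absL w : L2 w -> L2 (fun x => `|w x|).
  move=> /L2P[mw iw]; apply/L2P; split; first exact: measurableT_comp.
  by apply: eq_integrable iw => // x _ /=; rewrite real_normK ?num_real.
have normabs w : L2 w -> L2norm (fun x => `|w x|) = L2norm w.
  move=> wL; rewrite !L2normE//; last exact: absL.
  by congr Num.sqrt; apply: eq_Rintegral => x _ /=; rewrite -!expr2 real_normK ?num_real.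
pose h m x : R := \sum_(k < m) `|v k.+1 x - v k x|.
have hL m : L2 (h m) by apply: L2_sum => k; apply: absL; exact: L2B.
have h2 m : L2norm (h m) <= 2.
  apply: le_trans (L2norm_sum _ _ _) _; first by move=> k; apply: absL; exact: L2B.
  apply: (@le_trans _ _ (\sum_(k < m) (2^-1) ^+ k)).
    by apply: ler_sum => k _; rewrite (normabs (v k.+1 \- v k))//; exact: L2B.
  rewrite -(big_mkord xpredT (fun k => (2^-1 : R) ^+ k)).
  have -> : \sum_(0 <= k < m) (2^-1 : R) ^+ k = 2 - 2 * (2^-1) ^+ m.
    elim: m => [|m IH]; first by rewrite big_geq// expr0; lra.
    by rewrite big_nat_recr//= IH exprS; lra.
  have : 0 <= (2^-1 : R) ^+ m by rewrite exprn_ge0// invr_ge0.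
  lra.
pose g m x := (h m x ^+ 2)%:E.
have mg m : measurable_fun Om (g m).
  by apply/measurable_EFinP; apply: measurable_funX; exact: L2_measurable.
have h0 m x : 0 <= h m x by apply: sumr_ge0.
have hhomo x : {homo (h^~ x) : i j / (i <= j)%N >-> i <= j}.
  by apply/nondecreasing_seqP => i; rewrite /h big_ord_recr/= lerDl.
have ghomo x : Om x -> {homo (g^~ x) : i j / (i <= j)%N >-> (i <= j)%E}.
  by move=> _ i j ij; rewrite lee_fin lerXn2r ?nnegrE//; exact: hhomo.
(* The norms of [h m] are at most 2, so by monotone convergence the limit of the squares has
   integral at most 4 and is finite almost everywhere. *)
have G : {ae leb, forall x, Om x -> limn (g^~ x) \is a fin_num}.
  have lim_g : (\int[leb]_(x in Om) limn (g^~ x) <= 4%:E)%E.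
    rewrite monotone_convergence//; last by move=> m x _; rewrite lee_fin sqr_ge0.
    apply: lime_le.
      apply: ereal_nondecreasing_is_cvgn => i j ij; apply: ge0_le_integral => //.
      - by move=> x _; rewrite lee_fin sqr_ge0.
      - by move=> x Ox; exact: ghomo.
    apply: nearW => m.
    have -> : (\int[leb]_(x in Om) g m x)%E = (L2norm (h m) ^+ 2)%:E.
      rewrite L2norm2// /Defs.inner /Rintegral fineK; last first.
        by apply: integrable_fin_num => //; exact: L2_mul_integrable (hL m) (hL m).
      by apply: eq_integral => x _; rewrite /g expr2.
    rewrite lee_fin; have := h2 m; have := L2norm_ge0 (h m); nra.
  apply: (@integrable_ae _ _ _ leb Om mOm (fun x => limn (g^~ x))).
  apply/integrableP; split.
    apply: (emeasurable_fun_cvg g) => // x Ox; apply: ereal_nondecreasing_is_cvgn.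
    exact: ghomo.
  apply: le_lt_trans (ltry 4); apply: le_trans lim_g.
  rewrite le_eqVlt; apply/orP; left; apply/eqP; apply: eq_integral => x xO.
  rewrite gee0_abs//; apply: lime_ge.
    by apply: ereal_nondecreasing_is_cvgn; apply: ghomo; rewrite inE in xO.
  by apply: nearW => m; rewrite lee_fin sqr_ge0.
(* The upper limit is defined and measurable everywhere and agrees with the limit wherever the
   latter exists. *)
pose u x := fine (limn_esup (fun k => (v k x)%:E)).
have mu : measurable_fun Om u.
  apply: measurableT_comp => //; apply: measurable_fun_limn_esup => k.
  by apply/measurable_EFinP; exact: L2_measurable.
have vu : {ae leb, forall x, Om x -> v k x @[k --> \oo] --> u x}.
  apply: filterS G => x H Ox; have {}H := H Ox.
  have hb m : h m x <= 1 + fine (limn (g^~ x)).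
    have : (g m x <= limn (g^~ x))%E.
      rewrite (cvg_lim _ (ereal_nondecreasing_cvgn (ghomo x Ox)))//.
      by apply: ereal_sup_ubound; exists m.
    rewrite -(fineK H) lee_fin; have := h0 m x; nra.
  have cv : cvgn (fun k => v k x).
    have : cvgn [series `|v k.+1 x - v k x|]_k.
      apply: nondecreasing_is_cvgn.
        by apply/nondecreasing_seqP => i; rewrite /series/= big_nat_recr//= lerDl.
      exists (1 + fine (limn (g^~ x))) => _ [m _ <-]; rewrite /series/= big_mkord; exact: hb.
    move=> /normed_cvg c2.
    have E : (fun k => v k x) = (fun k => v 0%N x + [series v k.+1 x - v k x]_k k).
      by apply/funext => k; rewrite /series/= telescope_sumr//; ring.
    by rewrite E; apply: is_cvgD => //; exact: is_cvg_cst.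
  have E : (EFin \o v^~ x) k @[k --> \oo] --> (limn (fun k => v k x))%:E.
    by apply: cvg_EFin => //; exact: nearW.
  by rewrite /u (cvg_limn_einf_sup E).2.
have main e : 0 < e -> exists N, forall m, (N <= m)%N -> L2 (u_ m \- u) /\ L2norm (u_ m \- u) <= e.
  move=> e0; have [N1 N1P] := uC e e0; exists N1 => m N1m.
  apply: (L2_fatou (f_ := fun k => u_ m \- v (k + N1)%N)).
  - by move=> k; exact: L2B.
  - by apply: measurable_funB => //; exact: L2_measurable.
  - apply: filterS vu => x H Ox; apply: cvgB; first exact: cvg_cst.
    by have := H Ox; rewrite -(cvg_shiftn N1).
  - exact: ltW.
  - by move=> k; apply: N1P => //; apply: leq_trans (Nk _); rewrite leq_addl.
have uL' : L2 u.
  have [N1 /(_ _ (leqnn _))[H _]] := main 1 ltr01.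
  by apply: L2_eq (L2B (uL N1) H) => x _ /=; ring.
exists u => //; apply/cvgrPdist_le => e e0; have [N1 N1P] := main e e0.
exists N1 => // m /= N1m; rewrite sub0r normrN ger0_norm ?L2norm_ge0//.
by have [] := N1P m N1m.
Qed.

End L2_theory.

(** * Smooth functions *)

Section smooth1.
Context {R : realType}.
Implicit Types F : R -> R.

Definition smooth1 F : Prop := forall k t, derivable (derive1n k F) t 1.

Lemma smooth1_derivable F : smooth1 F -> forall t, derivable F t 1.
Proof. by move=> sF t; exact: (sF 0%N). Qed.

Arguments smooth1_derivable {F}.

Lemma smooth1_derive1 F : smooth1 F -> smooth1 (derive1 F).
Proof. by move=> sF k t; rewrite -derive1Sn; exact: sF. Qed.

Lemma derivable1_continuous F : (forall t, derivable F t 1) -> continuous F.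
Proof. by move=> dF t; apply: differentiable_continuous; exact/derivable1_diffP. Qed.

Lemma smooth1_continuous F : smooth1 F -> continuous F.
Proof. by move/smooth1_derivable/derivable1_continuous. Qed.

Lemma is_derive_derive1 F (F' : R -> R) :
  (forall t : R, is_derive t 1 F (F' t)) -> derive1 F = F'.
Proof. by move=> H; apply/funext => t; rewrite derive1E; case: (H t). Qed.

(** Coinduction principle: exhibiting a class closed under derivation replaces the computation of
    iterated derivatives. *)
Lemma smooth1_ind (P : (R -> R) -> Prop) :
  (forall F, P F -> exists2 F', (forall t : R, is_derive t 1 F (F' t)) & P F') ->
  forall F, P F -> smooth1 F.
Proof.
move=> H F PF k; elim: k F PF => [|k IH] F PF t.
  by have [F' dF _] := H _ PF; case: (dF t).
rewrite derive1Sn; have [F' dF PF'] := H _ PF.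
by rewrite (is_derive_derive1 dF); exact: IH.
Qed.

(** The functions [t^-k * exp (-1/t)], extended by 0, span a space closed under derivation; the flat
    function [exp (-1/t)] is the case [k = 0]. *)
Definition expinvX (k : nat) (t : R) : R := if 0 < t then t^-1 ^+ k * expR (- t^-1) else 0.

Definition expinv : R -> R := expinvX 0.

(** From [exp y >= y^(k+2) / (k+2)!] at [y = 1/t]. The quadratic bound is what makes the derivative
    at 0 vanish. *)
Lemma expinvX_le k t : 0 < t -> expinvX k t <= (k.+2)`!%:R * t ^+ 2.
Proof.
move=> t0; rewrite /expinvX t0.
have y0 : 0 < t^-1 by rewrite invr_gt0.
have := expR_ge1Dxn k.+1 (ltW y0).
have -> : t ^+ 2 = t^-1 ^- 2 by rewrite exprVn invrK.
rewrite expRN; set y := t^-1 in y0 *; set e := expR y => H.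
have e0 : 0 < e by exact: expR_gt0.
have f0 : 0 < (k.+2)`!%:R :> R by rewrite ltr0n fact_gt0.
rewrite ler_pdivrMr// mulrAC ler_pdivlMr ?exprn_gt0// -exprD addn2.
have : y ^+ k.+2 / k.+2`!%:R <= e by lra.
by rewrite ler_pdivrMr// mulrC.
Qed.

Lemma expinvX_ge0 k t : 0 <= expinvX k t.
Proof.
rewrite /expinvX; case: ifP => // t0; rewrite mulr_ge0 ?expR_ge0// exprn_ge0// invr_ge0.
exact: ltW.
Qed.

(** A quadratic remainder bound is the form in which derivatives are obtained both for the flat
    function at 0 and for integrals of translates. *)
Lemma is_derive_le (V : normedModType R) (f : V -> R) (x v : V) (D C : R) :
  (\forall h \near 0, `|f (h *: v + x) - f x - h * D| <= C * h ^+ 2) ->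
  is_derive x v f D.
Proof.
move=> H.
suff L : h^-1 *: ((f \o shift x) (h *: v) - f x) @[h --> 0^'] --> D.
  by split; [exact: cvgP L|exact: cvg_lim L].
apply/cvgrPdist_le => /= e e0.
have C0 : 0 < `|C| + 1 by rewrite ltr_wpDl.
have ee : 0 < e / (`|C| + 1) by rewrite divr_gt0.
near=> h.
have hN0 : h != 0 by near: h; exact: nbhs_dnbhs_neq.
have Hh : `|f (h *: v + x) - f x - h * D| <= C * h ^+ 2.
  by near: h; exact: nbhs_dnbhs.
have he : `|h| <= e / (`|C| + 1).
  by near: h; apply: nbhs_dnbhs; apply: (cvgr0_norm_le (F := nbhs (0 : R))) => //; exact: cvg_id.
rewrite (_ : D - _ = - (h^-1 * (f (h *: v + x) - f x - h * D))); last first.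
  by rewrite /= /GRing.scale/=; field.
rewrite normrN normrM normfV ler_pdivrMl ?normr_gt0//.
apply: le_trans Hh _; rewrite -[h ^+ 2]real_normK ?num_real// expr2 mulrCA ler_wpM2l//.
apply: (@le_trans _ _ ((`|C| + 1) * `|h|)).
  by rewrite ler_wpM2r// (le_trans (ler_norm _))// lerDl.
by rewrite mulrC -ler_pdivlMr.
Unshelve. all: by end_near. Qed.

Lemma is_derive_leT (V : normedModType R) (f : V -> R) (x v : V) (D C : R) :
  (forall h, `|f (h *: v + x) - f x - h * D| <= C * h ^+ 2) -> is_derive x v f D.
Proof. by move=> H; apply: (@is_derive_le _ _ _ _ _ C); apply: (@nearW _ (nbhs (0 : R))). Qed.

Lemma is_derive_expinvX k (t : R) : is_derive t 1 (expinvX k)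
  (expinvX k.+2 t - k%:R * expinvX k.+1 t).
Proof.
have [t0|t0|->] := ltgtP t 0.
- have E : \near t, (cst 0 : R -> R) t = expinvX k t.
    near=> s; rewrite /expinvX ifF//; apply/negbTE; rewrite -leNgt ltW//.
    by near: s; exact: lt_nbhsl.
  apply: near_eq_is_derive E _.
  rewrite /expinvX !ifF; try by apply/negbTE; rewrite -leNgt ltW.
  by rewrite mulr0 subr0; exact: is_derive_cst.
- have E : \near t, (fun s : R => s^-1 ^+ k * expR (- s^-1)) t = expinvX k t.
    near=> s; rewrite /expinvX ifT//.
    by near: s; exact: lt_nbhsr.
  apply: near_eq_is_derive E _.
  have tN0 : t != 0 by rewrite gt_eqF.
  have Di : is_derive t 1 (fun s : R => s^-1) (- t ^- 2).
    by apply: is_derive_eq; [apply: is_deriveV|rewrite /GRing.scale/= mulr1].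
  have De : is_derive t 1 (fun s : R => expR (- s^-1)) (expR (- t^-1) * t ^- 2).
    apply: (@is_derive1_comp R expR (fun s : R => - s^-1)).
    by have := is_deriveN Di; rewrite opprK.
  have Dk := is_deriveX k Di.
  have Ek : (fun s : R => s^-1 ^+ k * expR (- s^-1)) =
      (fun s : R => s^-1) ^+ k * (fun s : R => expR (- s^-1)).
    by apply/funext => s; rewrite mulrfctE exprfctE.
  rewrite Ek.
  have D := is_deriveM Dk De; apply: (is_derive_eq D).
  rewrite /expinvX t0 /GRing.scale/= exprfctE {Dk Ek D}.
  case: k => [|k] /=; first by rewrite mul0r; field.
  by rewrite !exprS; set z := t^-1 ^+ k; set e := expR _; field.
- apply: (@is_derive_leT _ _ _ _ _ ((k.+2)`!%:R)) => h.
  rewrite /expinvX !ltxx !(mulr0, subr0, addr0) -/(expinvX k (h *: 1)) /GRing.scale/= mulr1.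
  have [h0|h0] := ltP 0 h.
    by rewrite ger0_norm ?expinvX_ge0//; exact: expinvX_le.
  rewrite /expinvX ltNge h0 /= normr0 mulr_ge0 ?sqr_ge0//.
Unshelve. all: by end_near. Qed.

(** The class closed under derivation is that of finite linear combinations of the [expinvX k]: a
    term of exponent [k] yields terms of exponents [k + 2] and [k + 1]. *)
Lemma smooth1_expinv : smooth1 expinv.
Proof.
pose P (F : R -> R) := exists m (c : 'I_m -> R) (k : 'I_m -> nat),
  F = fun t => \sum_(i < m) c i * expinvX (k i) t.
apply: (@smooth1_ind P); last first.
  by exists 1%N, (fun=> 1), (fun=> 0%N); apply/funext => t; rewrite big_ord1 mul1r.
move=> F [m [c [k ->]]].
exists (fun t => \sum_(i < m) c i * (expinvX (k i).+2 t - (k i)%:R * expinvX (k i).+1 t)).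
  move=> t.
  have := @is_derive_sum R _ _ m (fun i => c i \*: expinvX (k i)) t 1
    (fun i => c i *: (expinvX (k i).+2 t - (k i)%:R * expinvX (k i).+1 t)).
  move=> /(_ (fun i => is_deriveZ (c i) (is_derive_expinvX (k i) t))).
  congr (is_derive _ _ _ _); apply/funext => s; by rewrite fct_sumE.
pose c' (j : 'I_(m + m)) := match fintype.split j with inl i => c i | inr i => - c i * (k i)%:R end.
pose k' (j : 'I_(m + m)) := match fintype.split j with inl i => (k i).+2 | inr i => (k i).+1 end.
exists (m + m)%N, c', k'; apply/funext => t; rewrite big_split_ord/= -big_split/=.
apply: eq_bigr => i _; rewrite /c' /k'.
have -> : fintype.split (lshift m i) = inl i by rewrite (unsplitK (inl i : 'I_m + 'I_m)).
have -> : fintype.split (rshift m i) = inr i by rewrite (unsplitK (inr i : 'I_m + 'I_m)).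
by ring.
Qed.

Lemma expinv_gt0 t : 0 < t -> 0 < expinv t.
Proof. by move=> t0; rewrite /expinv /expinvX t0 expr0 mul1r expR_gt0. Qed.

Lemma expinv_eq0 t : t <= 0 -> expinv t = 0.
Proof. by move=> t0; rewrite /expinv /expinvX ltNge t0. Qed.

Lemma expinv_ge0 t : 0 <= expinv t.
Proof. exact: expinvX_ge0. Qed.

Lemma expinv_le1 t : expinv t <= 1.
Proof.
rewrite /expinv /expinvX expr0 mul1r; case: ifP => // t0.
by rewrite expR_le1 oppr_le0 invr_ge0 ltW.
Qed.

Lemma le_expinv s t : s <= t -> expinv s <= expinv t.
Proof.
move=> st; have [s0|s0] := leP s 0; first by rewrite expinv_eq0// expinv_ge0.
have t0 := lt_le_trans s0 st.
by rewrite /expinv /expinvX s0 t0 !expr0 !mul1r ler_expR lerN2 lef_pV2.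
Qed.

Lemma expinv_cvg1 (u_ : nat -> R) : u_ m @[m --> \oo] --> +oo ->
  expinv (u_ m) @[m --> \oo] --> (1 : R).
Proof.
move=> uoo.
have E : \forall m \near \oo, expR (- (u_ m)^-1) = expinv (u_ m).
  have : \forall m \near \oo, 0 < u_ m by move/cvgryPgt : uoo; exact.
  by apply: filterS => m um; rewrite /expinv /expinvX um expr0 mul1r.
apply: cvg_trans; first exact: (near_eq_cvg E).
rewrite -expR0 -[X in expR X]oppr0.
apply: (@continuous_cvg _ _ _ _ _ _ expR); first exact: continuous_expR.
apply: cvgN.
apply: (gtr0_cvgV0 _).2 => //.
by move/cvgryPgt : uoo; exact.
Qed.

End smooth1.
Arguments smooth1_derivable {R F}.

(** * Smooth functions of several variables: algebra, composition, translation *)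

Section smooth_algebra.
Context {R : realType} {n : nat}.
Implicit Types (f g : 'rV[R]_n -> R) (F : R -> R) (i : 'I_n) (x v : 'rV[R]_n).

Lemma smooth_continuous f : smooth f -> continuous f.
Proof. by move=> sf; exact: (sf [::]).1. Qed.

Lemma smooth_derivable f : smooth f -> forall i x, derivable f x (delta_mx ord0 i).
Proof. by move=> sf; exact: (sf [::]).2. Qed.

Arguments smooth_derivable {f}.

Lemma smooth_pderiv f i : smooth f -> smooth (pderiv i f).
Proof.
move=> sf s; have := sf (rcons s i).
by rewrite /pderivs foldr_rcons.
Qed.

Lemma smooth_ind (P : ('rV[R]_n -> R) -> Prop) :
  (forall f, P f -> [/\ continuous f, forall i x, derivable f x (delta_mx ord0 i) &
     forall i, P (pderiv i f)]) ->
  forall f, P f -> smooth f.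
Proof.
move=> H f Pf s; elim/last_ind: s f Pf => [|s i IH] f Pf.
  by have [] := H f Pf.
by rewrite /pderivs foldr_rcons; apply: IH; have [_ _] := H f Pf; exact.
Qed.

Opaque smooth.

Lemma is_derive_pderiv f i x : derivable f x (delta_mx ord0 i) ->
  is_derive x (delta_mx ord0 i) f (pderiv i f x).
Proof. exact: derivableP. Qed.

Lemma is_derive_lineP f x v df :
  is_derive x v f df <-> is_derive (0 : R) 1 (fun t : R => f (t *: v + x)) df.
Proof.
have E : 'D_v f x = 'D_1 (fun t : R => f (t *: v + x)) 0.
  rewrite /derive; congr (lim (_ @ 0^')); apply/funext => h /=.
  by rewrite /shift/= scale0r add0r addr0 [h *: 1]mulr1.
split=> -[df1 df2].
  by split; [move/(@derivable1P _ _ _ f x v) : df1|rewrite -E].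
by split; [apply/(@derivable1P _ _ _ f x v)|rewrite E].
Qed.

Lemma is_derive_line f x i t : derivable f (t *: delta_mx ord0 i + x) (delta_mx ord0 i) ->
  is_derive t 1 (fun t : R => f (t *: delta_mx ord0 i + x)) (pderiv i f (t *: delta_mx ord0 i + x)).
Proof.
move=> /is_derive_pderiv/is_derive_lineP H.
have S : is_derive t 1 (fun s : R => s - t) 1.
  exact: (is_derive_shift t 1 (- t)).
have := @is_derive1_comp R (fun s => f (s *: delta_mx ord0 i + (t *: delta_mx ord0 i + x)))
  (fun s => s - t) t _ 1.
rewrite /= subrr => /(_ _ H S); rewrite mulr1.
by congr (is_derive _ _ _ _); apply/funext => s /=; rewrite addrA -scalerDl subrK.
Qed.

(** Closing under sums, products and outer composition simultaneously gives a class stable under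
    [pderiv]: the Leibniz and chain rules leave each single operation but not the whole class. *)
Inductive smooth_expr : ('rV[R]_n -> R) -> Prop :=
| smooth_expr_base f : smooth f -> smooth_expr f
| smooth_exprD f g : smooth_expr f -> smooth_expr g -> smooth_expr (f \+ g)
| smooth_exprM f g : smooth_expr f -> smooth_expr g -> smooth_expr (f \* g)
| smooth_expr_comp F f : smooth1 F -> smooth_expr f -> smooth_expr (F \o f).

Lemma pderivD f g i : (forall x, derivable f x (delta_mx ord0 i)) ->
  (forall x, derivable g x (delta_mx ord0 i)) ->
  pderiv i (f \+ g) = pderiv i f \+ pderiv i g.
Proof. by move=> df dg; apply/funext => x; exact: (deriveD (df x) (dg x)). Qed.

Lemma pderivM f g i : (forall x, derivable f x (delta_mx ord0 i)) ->
  (forall x, derivable g x (delta_mx ord0 i)) ->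
  pderiv i (f \* g) = (f \* pderiv i g) \+ (g \* pderiv i f).
Proof. by move=> df dg; apply/funext => x; exact: (deriveM (df x) (dg x)). Qed.

Lemma is_derive_comp1 F f i x : derivable F (f x) 1 -> derivable f x (delta_mx ord0 i) ->
  is_derive x (delta_mx ord0 i) (F \o f) (derive1 F (f x) * pderiv i f x).
Proof.
move=> dF df; apply/is_derive_lineP.
apply: (@is_derive1_comp R F (fun t => f (t *: delta_mx ord0 i + x))).
  by rewrite scale0r add0r derive1E; exact: derivableP.
exact/is_derive_lineP/is_derive_pderiv.
Qed.

Lemma pderiv_comp1 F f i : (forall t, derivable F t 1) ->
  (forall x, derivable f x (delta_mx ord0 i)) ->
  pderiv i (F \o f) = (derive1 F \o f) \* pderiv i f.
Proof.
by move=> dF df; apply/funext => x; have [] := is_derive_comp1 (dF (f x)) (df x).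
Qed.

Lemma smooth_expr_smooth f : smooth_expr f -> smooth f.
Proof.
apply: (@smooth_ind smooth_expr) => {}f.
elim=> {f} [f sf|f g _ [cf df sf] _ [cg dg sg]|f g ef [cf df sf] eg [cg dg sg]|F f sF ef [cf df sf]].
- split; [exact: smooth_continuous|exact: smooth_derivable|].
  by move=> i; apply: smooth_expr_base; exact: smooth_pderiv.
- split=> [x|i x|i].
  + exact: (@continuousD _ _ _ f g x (cf x) (cg x)).
  + exact: (derivableD (df i x) (dg i x)).
  + by rewrite pderivD//; exact: smooth_exprD.
- split=> [x|i x|i].
  + exact: (@continuousM _ _ f g x (cf x) (cg x)).
  + exact: (derivableM (df i x) (dg i x)).
  + by rewrite pderivM//; apply: smooth_exprD; exact: smooth_exprM.
- split=> [x|i x|i].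
  + by apply: continuous_comp; [exact: cf|exact: smooth1_continuous].
  + by have [] := is_derive_comp1 (smooth1_derivable sF (f x)) (df i x).
  + rewrite pderiv_comp1//; last exact: smooth1_derivable.
    exact: (smooth_exprM (smooth_expr_comp (smooth1_derive1 sF) ef) (sf i)).
Qed.

Lemma smoothD f g : smooth f -> smooth g -> smooth (f \+ g).
Proof. by move=> sf sg; apply: smooth_expr_smooth; apply: smooth_exprD; exact: smooth_expr_base. Qed.

Lemma smoothM f g : smooth f -> smooth g -> smooth (f \* g).
Proof. by move=> sf sg; apply: smooth_expr_smooth; apply: smooth_exprM; exact: smooth_expr_base. Qed.

Lemma smooth_comp1 F f : smooth1 F -> smooth f -> smooth (F \o f).
Proof. by move=> sF sf; apply: smooth_expr_smooth; apply: smooth_expr_comp => //; exact: smooth_expr_base. Qed.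

Lemma pderiv_cst (c : R) i : pderiv i (fun=> c) = (fun=> 0) :> ('rV[R]_n -> R).
Proof. by apply/funext => x; exact: derive_cst. Qed.

Lemma smooth_cst (c : R) : smooth ((fun=> c) : 'rV[R]_n -> R).
Proof.
apply: (@smooth_ind (fun f => exists c, f = fun=> c)); last by exists c.
move=> _ [{}c ->]; split=> [x|i x|i].
- exact: cst_continuous.
- exact: derivable_cst.
- by exists 0; rewrite pderiv_cst.
Qed.

Lemma smoothZ (c : R) f : smooth f -> smooth (c \*o f).
Proof. by move=> sf; exact: (smoothM (smooth_cst c) sf). Qed.

Lemma smoothN f : smooth f -> smooth (\- f).
Proof.
move=> /(smoothZ (-1)); congr smooth; apply/funext => x /=; exact: mulN1r.
Qed.

Lemma smoothB f g : smooth f -> smooth g -> smooth (f \- g).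
Proof. by move=> sf /smoothN sg; exact: smoothD. Qed.

Lemma pderivZ (c : R) f i : (forall x, derivable f x (delta_mx ord0 i)) ->
  pderiv i (c \*o f) = c \*o pderiv i f.
Proof.
move=> df; apply/funext => x.
have := deriveZ c (df x); rewrite /pderiv /=; exact.
Qed.

Lemma pderivB f g i : (forall x, derivable f x (delta_mx ord0 i)) ->
  (forall x, derivable g x (delta_mx ord0 i)) ->
  pderiv i (f \- g) = pderiv i f \- pderiv i g.
Proof. by move=> df dg; apply/funext => x; exact: (deriveB (df x) (dg x)). Qed.

Lemma smooth_sum I (s : seq I) (P : pred I) (f : I -> 'rV[R]_n -> R) :
  (forall k, smooth (f k)) -> smooth (fun x => \sum_(k <- s | P k) f k x).
Proof.
move=> sf; elim: s => [|k s IH].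
  by under eq_fun do rewrite big_nil; exact: smooth_cst.
have -> : (fun x => \sum_(k0 <- k :: s | P k0) f k0 x) =
    if P k then f k \+ (fun x => \sum_(k <- s | P k) f k x) else (fun x => \sum_(k <- s | P k) f k x).
  by apply/funext => x; rewrite big_cons; case: ifP.
case: ifP => _; [exact: smoothD|exact: IH].
Qed.

Lemma smooth_prod I (s : seq I) (P : pred I) (f : I -> 'rV[R]_n -> R) :
  (forall k, smooth (f k)) -> smooth (fun x => \prod_(k <- s | P k) f k x).
Proof.
move=> sf; elim: s => [|k s IH].
  by under eq_fun do rewrite big_nil; exact: smooth_cst.
have -> : (fun x => \prod_(k0 <- k :: s | P k0) f k0 x) =
    if P k then f k \* (fun x => \prod_(k <- s | P k) f k x) else (fun x => \prod_(k <- s | P k) f k x).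
  by apply/funext => x; rewrite big_cons; case: ifP.
case: ifP => _; [exact: (smoothM (sf k) IH)|exact: IH].
Qed.

Lemma is_derive_coord i j x :
  is_derive x (delta_mx ord0 i) (fun x : 'rV[R]_n => x ord0 j) (i == j)%:R.
Proof.
apply: (@is_derive_leT _ _ _ _ _ _ 0) => h.
by rewrite !mxE eqxx /= mul0r eq_sym addrK subrr normr0.
Qed.

Lemma pderiv_coord i j : pderiv i (fun x : 'rV[R]_n => x ord0 j) = (fun=> (i == j)%:R).
Proof. by apply/funext => x; case: (is_derive_coord i j x). Qed.

Lemma smooth_coord j : smooth (fun x : 'rV[R]_n => x ord0 j).
Proof.
apply: (@smooth_ind (fun f => smooth f \/ f = fun x => x ord0 j)); last by right.
move=> f [sf|->].
  split; [exact: smooth_continuous|exact: smooth_derivable|].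
  by move=> i; left; exact: smooth_pderiv.
split=> [x|i x|i]; first exact: coord_continuous.
- by case: (is_derive_coord i j x).
- by left; rewrite pderiv_coord; exact: smooth_cst.
Qed.

Lemma pderiv_translate f i v : pderiv i (fun x => f (x + v)) = (fun x => pderiv i f (x + v)).
Proof.
apply/funext => x; rewrite /pderiv /derive /= /shift/=.
by under [in LHS]eq_fun do rewrite -addrA.
Qed.

Lemma smooth_translate f v : smooth f -> smooth (fun x => f (x + v)).
Proof.
move=> sf; apply: (@smooth_ind (fun h => exists2 g, smooth g & h = fun x => g (x + v))); last by exists f.
move=> _ [g sg ->]; split=> [x|i x|i].
- apply: (@continuous_comp _ _ _ (fun x => x + v) g); last exact: smooth_continuous.
  by apply: (@continuousD _ _ _ id (cst v) x); [exact: (@cvg_id _ (nbhs x))|exact: cst_continuous].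
- have := smooth_derivable sg i (x + v); rewrite /derivable /= /shift/=.
  by under [in X in _ -> X]eq_fun do rewrite -addrA.
- by exists (pderiv i g); [exact: smooth_pderiv|exact: pderiv_translate].
Qed.

End smooth_algebra.
Arguments smooth_derivable {R n f}.

Section smooth_col.
Context {R : realType} {d : nat}.
Implicit Types (h : 'rV[R]_d -> R) (i j : 'I_d.+1).

Lemma is_derive_col' h i j (x : 'rV[R]_d.+1) :
  (forall k y, derivable h y (delta_mx ord0 k)) ->
  is_derive x (delta_mx ord0 j) (fun x => h (col' i x))
    (if unlift i j is Some k then pderiv k h (col' i x) else 0).
Proof.
move=> dh; apply/is_derive_lineP; case: unliftP => [k ->|->].
  have -> : (fun t : R => h (col' i (t *: delta_mx ord0 (lift i k) + x))) =
      (fun t => h (t *: delta_mx ord0 k + col' i x)).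
    apply/funext => t; congr h; apply/rowP => l; rewrite !mxE/=.
    by rewrite (inj_eq (@lift_inj _ i)).
  exact/is_derive_lineP/is_derive_pderiv.
have -> : (fun t : R => h (col' i (t *: delta_mx ord0 i + x))) = cst (h (col' i x)).
  apply/funext => t; congr h; apply/rowP => l; rewrite !mxE/=.
  by rewrite eq_sym (negbTE (neq_lift i l)) mulr0 add0r.
exact: is_derive_cst.
Qed.

Lemma pderiv_col' h i j : (forall k y, derivable h y (delta_mx ord0 k)) ->
  pderiv j (fun x => h (col' i x)) =
  (fun x => if unlift i j is Some k then pderiv k h (col' i x) else 0).
Proof. by move=> dh; apply/funext => x; case: (is_derive_col' i j x dh). Qed.

Lemma continuous_col' i : continuous (fun x : 'rV[R]_d.+1 => col' i x).
Proof.
move=> x; apply/(@cvgrPdist_lt _ _ _ (nbhs x)) => e e0.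
apply/nbhs_ballP; exists e => // y; rewrite mx_norm_ball /ball_ /=.
apply: le_lt_trans; rewrite /Num.norm/= !mx_normrE.
apply: bigmax_le => [|[a b] _]; first exact: bigmax_ge_id.
have -> : (col' i x - col' i y) a b = (x - y) a (lift i b) by rewrite !mxE.
by apply: (le_bigmax _ (fun k : 'I_1 * 'I_d.+1 => `|(x - y) k.1 k.2|) (a, lift i b)).
Qed.

Lemma smooth_col' h i : smooth h -> smooth (fun x : 'rV[R]_d.+1 => h (col' i x)).
Proof.
move=> sh; apply: (@smooth_ind _ _ (fun f => exists2 h, smooth h & f = fun x => h (col' i x))); last by exists h.
move=> _ [g sg ->]; have dg := smooth_derivable sg; split=> [x|j x|j].
- by apply: (@continuous_comp _ _ _ (fun x => col' i x) g);
    [exact: continuous_col'|exact: smooth_continuous].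
- by case: (is_derive_col' i j x dg).
- rewrite pderiv_col'//; case: unliftP => [k _|_].
    by exists (pderiv k g); [exact: smooth_pderiv|reflexivity].
  by exists (fun=> 0); [exact: smooth_cst|reflexivity].
Qed.

End smooth_col.

(** * Test functions *)

Section compact_rV.
Context {R : realType} {n : nat}.
Implicit Types (f : 'rV[R]_n -> R) (K U : set 'rV[R]_n).

Lemma bounded_on_compact f K : compact K -> continuous f ->
  exists2 C, 0 <= C & forall x, K x -> `|f x| <= C.
Proof.
move=> cK cf.
have : bounded_set (f @` K).
  apply: compact_bounded; apply: continuous_compact => //.
  exact: continuous_subspaceT.
move=> [M [_ H]]; exists (`|M| + 1); first by rewrite addr_ge0.
move=> x Kx; apply: (H (`|M| + 1)); last by exists x.
by rewrite (le_lt_trans (ler_norm _))// ltrDl.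
Qed.

Lemma box_compact (r : R) : compact [set x : 'rV[R]_n | forall i, `|x ord0 i| <= r].
Proof.
have := @rV_compact R n (fun=> `[-r, r]%classic) (fun=> @segment_compact R (- r) r).
congr compact; apply/seteqP; split=> x H i; have := H i; by rewrite /= in_itv/= ler_norml.
Qed.

Lemma bounded_on_bounded f U : bounded_set U -> continuous f ->
  exists2 C, 0 <= C & forall x, U x -> `|f x| <= C.
Proof.
move=> /bounded_set_rV[r _ Ur] cf.
have [C C0 HC] := bounded_on_compact (@box_compact r) cf.
by exists C => // x Ux; apply: HC => i; exact: Ur.
Qed.

Lemma compact_ball_sub K U : compact K -> open U -> K `<=` U ->
  exists2 e : R, 0 < e & forall x y, K x -> ball x e y -> U y.
Proof.
move=> cK oU KU; move/compact_near_coveringP : cK => cK.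
have := cK R 0^'+ (fun e x => ball x e `<=` U) _ .
case.
  move=> x Kx; have /nbhs_ballP[e /= e0 xeU] := open_nbhs_nbhs (conj oU (KU _ Kx)).
  have e20 : 0 < e / 2 by lra.
  exists (ball x (e / 2), [set s | 0 < s < e / 2]).
    split; first exact: nbhsx_ballx.
    by near=> s; apply/andP; split; near: s; [exact: nbhs_right_gt|exact: nbhs_right_lt].
  move=> [y s] /= [xy /andP[s0 se]] z yz; apply: xeU.
  apply: (@le_ball _ _ _ (e / 2 + e / 2)); first lra.
  by apply: ball_triangle xy _; apply: le_ball yz; exact: ltW.
move=> e /= e0 H; exists (e / 2); first lra.
move=> x y Kx; apply: (H (e / 2)) => //=; last by lra.
by rewrite /ball_/= sub0r normrN gtr0_norm; lra.
Unshelve. all: by end_near. Qed.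

End compact_rV.

(** * Mean values along the axes and equality of mixed derivatives *)

Section smooth_calculus.
Context {R : realType} {n : nat}.
Implicit Types (f : 'rV[R]_n -> R) (i j : 'I_n) (x : 'rV[R]_n) (s t : R).

Local Notation e_ i := (delta_mx ord0 i : 'rV[R]_n).

Lemma is_derive_axis f i x t : smooth f ->
  is_derive t 1 (fun t : R => f (x + t *: e_ i)) (pderiv i f (x + t *: e_ i)).
Proof.
move=> sf; rewrite (addrC x).
have := @is_derive_line R n f x i t (smooth_derivable sf _ _).
by congr (is_derive _ _ _ _); apply/funext => s; rewrite addrC.
Qed.

Lemma smooth_MVT f i x t : smooth f ->
  exists2 s, `|s| <= `|t| & f (x + t *: e_ i) - f x = t * pderiv i f (x + s *: e_ i).
Proof.
move=> sf.
have D s := @is_derive_axis f i x s sf.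
have C : continuous (fun t : R => f (x + t *: e_ i)).
  by apply: derivable1_continuous => s; case: (D s).
have [t0|t0|->] := ltgtP t 0.
- have [s] := MVT t0 (fun s _ => D s) (continuous_subspaceT C).
  rewrite in_itv/= scale0r addr0 sub0r => /andP[ts s0] H.
  by exists s; [rewrite !ltr0_norm// lerN2 ltW|move: H; lra].
- have [s] := MVT t0 (fun s _ => D s) (continuous_subspaceT C).
  rewrite in_itv/= scale0r addr0 subr0 => /andP[s0 st] H.
  by exists s; [rewrite !gtr0_norm// ltW|rewrite H mulrC].
- by exists 0 => //; rewrite mul0r scale0r addr0 subrr.
Qed.

Lemma ler_dist_half (a b c e : R) : `|a - c| <= e / 2 -> `|b - c| <= e / 2 -> `|a - b| <= e.
Proof.
by rewrite !ler_norml => /andP[A1 A2] /andP[B1 B2]; apply/andP; split; lra.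
Qed.

(** Schwarz's theorem: the second difference of [f] over a small square is symmetric in the two
    directions, and two mean value theorems write it as [t^2] times either mixed derivative at a
    point near [x]. *)
Lemma pderivC f i j : smooth f -> pderiv i (pderiv j f) = pderiv j (pderiv i f).
Proof.
move=> sf; apply/funext => x.
have key a b (t : R) : exists s s', [/\ `|s| <= `|t|, `|s'| <= `|t| &
    f (x + t *: e_ a + t *: e_ b) - f (x + t *: e_ a) - (f (x + t *: e_ b) - f x) =
    t * (t * pderiv b (pderiv a f) (x + s *: e_ a + s' *: e_ b))].
  pose g := (fun y => f (y + t *: e_ b)) \- f.
  have sg : smooth g := smoothB (smooth_translate (t *: e_ b) sf) sf.
  have [s s1 H] := smooth_MVT a x t sg.
  have [s' s2 H'] := smooth_MVT b (x + s *: e_ a) t (smooth_pderiv a sf).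
  exists s, s'; split=> //; rewrite -H' [LHS]H; congr (_ * _).
  rewrite /g pderivB; [|exact: (smooth_derivable (smooth_translate (t *: e_ b) sf))|exact: (smooth_derivable sf)].
  by rewrite pderiv_translate.
have nb a b : smooth (pderiv b (pderiv a f)) by do 2 apply: smooth_pderiv.
apply/eqP; rewrite -subr_eq0 -normr_le0; apply/ler_addgt0Pl => e e0; rewrite addr0.
have e20 : 0 < e / 2 by lra.
have cl a b : exists2 r, 0 < r & forall y, ball x r y ->
    `|pderiv b (pderiv a f) x - pderiv b (pderiv a f) y| <= e / 2.
  have /(@cvgrPdist_le _ _ _ (nbhs x)) /(_ _ e20) := @smooth_continuous R n _ (nb a b) x.
  by case/nbhs_ballP => r r0 H; exists r.
have [r1 r10 H1] := cl i j; have [r2 r20 H2] := cl j i.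
(* When [i = j] the two displacements of size at most [t] add up in one coordinate; the factor 3
   keeps the point strictly inside both balls. *)
pose t := Num.min r1 r2 / 3.
have m0 : 0 < Num.min r1 r2 by rewrite lt_min r10.
have t0 : 0 < t by rewrite divr_gt0.
have inball a b r (s s' : R) : 3 * t <= r -> `|s| <= `|t| -> `|s'| <= `|t| ->
    ball x r (x + s *: e_ a + s' *: e_ b).
  rewrite (gtr0_norm t0) => tr st s't; apply/ball_rV; split; first lra.
  move=> k; rewrite !mxE/= -addrA opprD addNKr normrN.
  apply: le_lt_trans (ler_normD _ _) _; rewrite !normrM.
  have b1 (c : bool) : `|c%:R : R| <= 1 by case: c; rewrite ?normr1 ?normr0.
  have B1 := ler_wpM2l (normr_ge0 s) (b1 (k == a)); have B2 := ler_wpM2l (normr_ge0 s') (b1 (k == b)).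
  by rewrite !mulr1 in B1 B2; lra.
have tr1 : 3 * t <= r1.
  by rewrite /t mulrCA mulfV// mulr1 ge_min lexx.
have tr2 : 3 * t <= r2.
  by rewrite /t mulrCA mulfV// mulr1 ge_min lexx orbT.
have [s [s' [s1 s2 E1]]] := key i j t.
have [u [u' [u1 u2 E2]]] := key j i t.
have E : pderiv j (pderiv i f) (x + s *: e_ i + s' *: e_ j) =
         pderiv i (pderiv j f) (x + u *: e_ j + u' *: e_ i).
  have tN0 : t != 0 by rewrite gt_eqF.
  apply: (mulfI tN0); apply: (mulfI tN0); apply: etrans (esym E1) (etrans _ E2).
  rewrite (addrAC x (t *: e_ j)).
  move: (f (x + _ + _)) (f (x + t *: e_ i)) (f (x + t *: e_ j)) (f x) => A B C D; ring.
have := H1 _ (inball i j _ _ _ tr1 s1 s2); rewrite E; apply: ler_dist_half.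
exact: H2 (inball j i _ _ _ tr2 u1 u2).
Qed.

End smooth_calculus.

Section test_functions.
Context {R : realType} {n : nat}.
Variable Om : set 'rV[R]_n.
Implicit Types (f g psi a : 'rV[R]_n -> R) (i j : 'I_n) (x : 'rV[R]_n) (s t : R).

Local Notation test := (test_function Om).
Local Notation e_ i := (delta_mx ord0 i : 'rV[R]_n).

(** Any compact subset of the domain carrying [psi] may replace the closed support, so the supports
    of sums, products and derivatives never have to be computed. *)
Lemma test_functionP psi : test psi <-> smooth psi /\
  exists K, [/\ compact K, K `<=` Om & forall x, ~ K x -> psi x = 0].
Proof.
split=> [[sf cK KOm]|[sf [K [cK KOm K0]]]].
  split=> //; exists (closure [set x | psi x != 0]); split=> // x Kx.
  by apply/eqP/negP => /negP px; apply: Kx; exact: subset_closure.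
have S : closure [set x | psi x != 0] `<=` K.
  rewrite (_ : K = closure K); last by apply/closure_id; apply: compact_closed.
  apply: closure_subset => x /= px; apply: contrapT => /K0 p0; by rewrite p0 eqxx in px.
split=> //; last exact: subset_trans KOm.
by apply: (subclosed_compact _ cK S); exact: closed_closure.
Qed.

Lemma test_smooth psi : test psi -> smooth psi.
Proof. by case. Qed.

Lemma test_out psi x : test psi -> ~ Om x -> psi x = 0.
Proof. by move=> /test_functionP[_ [K [_ KO K0]]] Ox; apply: K0 => /KO. Qed.

Lemma testM a psi : smooth a -> test psi -> test (a \* psi).
Proof.
move=> sa /test_functionP[sp [K [cK KO K0]]]; apply/test_functionP.
split; first exact: smoothM.
by exists K; split=> // x /K0 px; rewrite /= px mulr0.
Qed.

Lemma testMr a psi : smooth a -> test psi -> test (psi \* a).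
Proof.
move=> sa tp; rewrite (_ : _ \* _ = a \* psi); first exact: testM.
by apply/funext => x /=; rewrite mulrC.
Qed.

Lemma testD psi g : test psi -> test g -> test (psi \+ g).
Proof.
move=> /test_functionP[sp [K [cK KO K0]]] /test_functionP[sg [L [cL LO L0]]]; apply/test_functionP.
split; first exact: smoothD.
exists (K `|` L); split; first exact: compactU.
  by move=> x [/KO|/LO].
by move=> x /not_orP[/K0 px /L0 gx]; rewrite /= px gx addr0.
Qed.

Lemma testZ c psi : test psi -> test (c \*o psi).
Proof. by move=> tp; apply: testM => //; exact: smooth_cst. Qed.

Lemma test0 : test (fun=> 0).
Proof.
apply/test_functionP; split; first exact: smooth_cst.
by exists set0; split=> //; exact: compact0.
Qed.

Lemma test_sum I (s : seq I) (P : pred I) (f : I -> 'rV[R]_n -> R) :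
  (forall k, test (f k)) -> test (fun x => \sum_(k <- s | P k) f k x).
Proof.
move=> tf; elim: s => [|k s IH].
  by under eq_fun do rewrite big_nil; exact: test0.
have -> : (fun x => \sum_(k0 <- k :: s | P k0) f k0 x) =
    if P k then f k \+ (fun x => \sum_(k <- s | P k) f k x) else (fun x => \sum_(k <- s | P k) f k x).
  by apply/funext => x; rewrite big_cons; case: ifP.
by case: ifP => _; [exact: (testD (tf k) IH)|exact: IH].
Qed.

Lemma test_pderiv i psi : test psi -> test (pderiv i psi).
Proof.
move=> /test_functionP[sp [K [cK KO K0]]]; apply/test_functionP.
split; first exact: smooth_pderiv.
exists K; split=> // x Kx.
have : \forall y \near x, psi y = (fun=> 0) y.
  have oK : open (~` K) by apply: closed_openC; exact: compact_closed.
  by apply: filterS (open_nbhs_nbhs (conj oK Kx)) => y /K0.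
move=> /(near_eq_derive (e_ i)); rewrite /pderiv => ->; exact: derive_cst.
Qed.

Lemma test_bounded psi : test psi -> exists2 C, 0 <= C & forall x, `|psi x| <= C.
Proof.
move=> /test_functionP[sp [K [cK KO K0]]].
have [C C0 HC] := bounded_on_compact cK (smooth_continuous sp).
exists C => // x; have [/HC//|/K0 ->] := pselect (K x); by rewrite normr0.
Qed.

Lemma test_lipschitz i psi : test psi ->
  exists2 C, 0 <= C & forall x t, `|psi (x + t *: e_ i) - psi x| <= C * `|t|.
Proof.
move=> tp; have [C C0 HC] := test_bounded (test_pderiv i tp).
exists C => // x t; have [s _ ->] := smooth_MVT i x t (test_smooth tp).
by rewrite normrM mulrC ler_wpM2r.
Qed.

Lemma test_taylor i psi : test psi ->
  exists2 C, 0 <= C &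
    forall x t, `|psi (x + t *: e_ i) - psi x - t * pderiv i psi x| <= C * t ^+ 2.
Proof.
move=> tp; have [C C0 HC] := test_lipschitz i (test_pderiv i tp).
exists C => // x t; have [s st ->] := smooth_MVT i x t (test_smooth tp).
rewrite -mulrBr normrM -[t ^+ 2]real_normK ?num_real// expr2 mulrCA ler_wpM2l//.
by apply: le_trans (HC _ _) _; rewrite ler_wpM2l.
Qed.

Lemma test_translate i psi : open Om -> test psi ->
  exists2 r, 0 < r & forall t, `|t| < r -> test (fun x => psi (x + t *: e_ i)).
Proof.
move=> oO /test_functionP[sp [K [cK KO K0]]].
have [r r0 Hr] := compact_ball_sub cK oO KO.
exists r; first exact: r0.
move=> t tr; apply/test_functionP; split; first exact: (smooth_translate (t *: e_ i) sp).
exists ((fun x => x - t *: e_ i) @` K); split.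
- apply: continuous_compact => //; apply: continuous_subspaceT => x.
  by apply: (@continuousD _ _ _ id (cst (- (t *: e_ i))) x); [exact: (@cvg_id _ (nbhs x))|exact: cst_continuous].
- move=> _ [x Kx <-]; apply: Hr Kx _; apply/ball_rV; split=> // j.
  rewrite !mxE opprB addrCA subrr addr0 normrM.
  by case: (_ && _); rewrite ?normr1 ?normr0 ?mulr1 ?mulr0.
- by move=> x Kx; apply: K0 => Kx'; apply: Kx; exists (x + t *: e_ i) => //; rewrite addrK.
Qed.

End test_functions.

(** * Weak derivatives *)

Section translation.
Context {R : realType} {n : nat}.
Implicit Types (f u v : 'rV[R]_n -> R) (i : 'I_n) (x z : 'rV[R]_n) (t : R).

Local Notation leb := (@lebesgue_rV R n).
Local Notation L2T := (L2 [set: 'rV[R]_n]).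
Local Notation innerT := (inner [set: 'rV[R]_n]).
Local Notation normT := (L2norm [set: 'rV[R]_n]).
Local Notation e_ i := (delta_mx ord0 i : 'rV[R]_n).

Lemma ge0_integral_translation (f : 'rV[R]_n -> \bar R) z : measurable_fun setT f ->
  (forall x, (0 <= f x)%E) ->
  (\int[leb]_x f (x + z)%R = \int[leb]_x f x)%E.
Proof.
move=> mf f0.
transitivity (\int[pushforward leb (fun x => x + z)%R]_x f x)%E.
  by rewrite (ge0_integral_pushforward (measurable_translate z)).
have pE D : measurable D -> D `<=` setT -> pushforward leb (fun x => x + z) D = leb D.
  by move=> mD _; exact: lebesgue_rV_translation.
have := @eq_measure_integral _ 'rV[R]_n R setT leb
  (measure_function_pushforward__canonical__measure_function_Measure leb (measurable_translate z)) f.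
by move=> /(_ pE).
Qed.

Lemma Rintegral_translation f z : measurable_fun setT f ->
  \int[leb]_x f (x + z) = \int[leb]_x f x.
Proof.
move=> mf; rewrite /Rintegral; congr fine.
have mE : measurable_fun setT (EFin \o f) by exact/measurable_EFinP.
rewrite integralE [RHS]integralE; congr (_ - _)%E.
  rewrite (_ : (fun x => (f (x + z))%:E)^\+%E = (fun x => (EFin \o f)^\+%E (x + z))).
    by rewrite (ge0_integral_translation z (measurable_funepos mE) (fun x => funepos_ge0 _ x)).
  by apply/funext => x; rewrite !funeposE.
rewrite (_ : (fun x => (f (x + z))%:E)^\-%E = (fun x => (EFin \o f)^\-%E (x + z))).
  by rewrite (ge0_integral_translation z (measurable_funeneg mE) (fun x => funeneg_ge0 _ x)).
by apply/funext => x; rewrite !funenegE.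
Qed.

Lemma L2T_translate u z : L2T u -> L2T (fun x => u (x + z)).
Proof.
move=> /(L2P measurableT)[mu /integrableP[mu2 iu]]; apply/(L2P measurableT).
have mt := measurable_translate z.
split; first exact: measurableT_comp.
apply/integrableP; split.
  by apply/measurable_EFinP; apply: measurable_funX; exact: measurableT_comp.
rewrite (@ge0_integral_translation (fun x => `|(u x ^+ 2)%:E|)%E z)//.
exact: measurableT_comp.
Qed.

Lemma innerT_translate u v z : L2T u -> L2T v ->
  innerT (fun x => u (x + z)) (fun x => v (x + z)) = innerT u v.
Proof.
move=> /(L2_measurable measurableT) mu /(L2_measurable measurableT) mv.
apply: (@Rintegral_translation (fun x => u x * v x)).
exact: measurable_funM.
Qed.

Lemma innerT_translateN u v z : L2T u -> L2T v ->
  innerT (fun x => u (x + z)) v = innerT u (fun x => v (x - z)).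
Proof.
move=> uL vL; rewrite -(innerT_translate z uL (L2T_translate (- z) vL)).
by apply: inner_eq => // x _; rewrite addrK.
Qed.

Lemma normT_translate u z : L2T u -> normT (fun x => u (x + z)) = normT u.
Proof.
by move=> uL; rewrite !L2normE ?innerT_translate//; exact: L2T_translate.
Qed.

Lemma measurable_box (r : R) : measurable [set x : 'rV[R]_n | forall i, `|x ord0 i| <= r].
Proof.
apply: closed_measurable_rV; apply: compact_closed => //; exact: (@box_compact R n r).
Qed.

Lemma L2T_box (r : R) : L2T \1_[set x : 'rV[R]_n | forall i, `|x ord0 i| <= r].
Proof.
have mB := measurable_box r.
apply/(L2P measurableT); split; first exact: measurable_indic.
set B := [set x : 'rV[R]_n | _] in mB *.
have -> : (fun x : 'rV[R]_n => \1_B x ^+ 2) = (\1_B : 'rV[R]_n -> R).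
  by apply/funext => x; rewrite indicE; case: (_ \in _); rewrite ?expr1n ?expr0n.
apply/integrableP; split; first by apply/measurable_EFinP; exact: measurable_indic.
apply: le_lt_trans (lebesgue_rV_box n r); have <- : (\int[leb]_x (\1_B x)%:E)%E = leb B by rewrite integral_indic// setIT.
rewrite le_eqVlt; apply/orP; left; apply/eqP; apply: eq_integral => x _ /=.
by rewrite ger0_norm// indicE ler0n.
Qed.

Lemma box_translate x i (t r : R) : `|t| <= 1 ->
  (forall j, `|(x + t *: e_ i) ord0 j| <= r) -> forall j, `|x ord0 j| <= r + 1.
Proof.
move=> t1 H j; have := H j; rewrite !mxE => A.
set c := t * _ in A; have -> : x ord0 j = x ord0 j + c - c by rewrite addrK.
apply: le_trans (ler_normB _ _) _; apply: lerD => //.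
by rewrite /c normrM; case: (_ && _); rewrite ?normr1 ?normr0 ?mulr1 ?mulr0.
Qed.

Lemma L2T_bounded_box f c r : measurable_fun setT f -> (forall x, `|f x| <= c) ->
  (forall x, ~ (forall i, `|x ord0 i| <= r) -> f x = 0) ->
  L2T f /\ normT f <= c * normT \1_[set x : 'rV[R]_n | forall i, `|x ord0 i| <= r].
Proof.
move=> mf fc f0; set chi := \1_ _.
have fE : f = f \* chi.
  apply/funext => x; rewrite /= /chi indicE; case: (pselect (forall i, `|x ord0 i| <= r)) => H.
    by rewrite mem_set// mulr1.
  by rewrite memNset// mulr0 f0.
rewrite fE; split; [apply: (L2_bddM measurableT mf)|apply: (L2_bddM_le measurableT mf)] => //;
  exact: L2T_box.
Qed.

End translation.

Section test_translation.
Context {R : realType} {n : nat}.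
Variable Om : set 'rV[R]_n.
Hypothesis bOm : bounded_set Om.
Implicit Types (f u psi : 'rV[R]_n -> R) (i : 'I_n) (x z : 'rV[R]_n) (t : R).

Local Notation leb := (@lebesgue_rV R n).
Local Notation L2T := (L2 [set: 'rV[R]_n]).
Local Notation innerT := (inner [set: 'rV[R]_n]).
Local Notation normT := (L2norm [set: 'rV[R]_n]).
Local Notation e_ i := (delta_mx ord0 i : 'rV[R]_n).
Local Notation test := (test_function Om).

Lemma test_measurable psi : test psi -> measurable_fun setT psi.
Proof. by move=> /test_smooth/smooth_continuous; exact: continuous_measurable_rV. Qed.

Lemma test_box : exists2 r, 0 < r &
  forall psi, test psi -> forall x, ~ (forall i, `|x ord0 i| <= r) -> psi x = 0.
Proof.
have [r r0 H] := bounded_set_rV bOm.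
by exists r => // psi tp x Hx; apply: (test_out tp) => Ox; apply: Hx; exact: H.
Qed.

Lemma L2T_test psi : test psi -> L2T psi.
Proof.
move=> tp; have [r r0 H] := test_box; have [C _ HC] := test_bounded tp.
exact: (L2T_bounded_box (test_measurable tp) HC (H _ tp)).1.
Qed.

Lemma test_taylor_normT i psi : test psi -> exists C, forall h, `|h| <= 1 ->
  normT (fun x => psi (x + h *: e_ i) - psi x - h * pderiv i psi x) <= C * h ^+ 2.
Proof.
move=> tp; have [r r0 H] := test_box; have [C C0 HC] := test_taylor i tp.
(* The margin 1 makes room for the translates with [|h| <= 1]. *)
exists (C * normT \1_[set x : 'rV[R]_n | forall i, `|x ord0 i| <= r + 1]) => h h1.
rewrite mulrAC; apply: (L2T_bounded_box _ _ _).2.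
- apply: measurable_funB; last by apply: measurable_funM => //; exact: (test_measurable (test_pderiv i tp)).
  apply: measurable_funB; last exact: test_measurable.
  by apply: (measurableT_comp (test_measurable tp)); exact: measurable_translate.
- by move=> x; apply: HC.
- move=> x Hx.
  have Hx' : ~ (forall i, `|x ord0 i| <= r).
    by move=> Hx'; apply: Hx => j; apply: le_trans (Hx' j) _; rewrite lerDl.
  rewrite (H _ tp x Hx') (H _ (test_pderiv i tp) x Hx') mulr0 !subr0.
  by apply: (H _ tp) => Hx''; apply: Hx; exact: box_translate Hx''.
Qed.

Lemma is_derive_innerT i psi u t : test psi -> L2T u ->
  is_derive t 1 (fun t => innerT (fun x => psi (x + t *: e_ i)) u)
    (innerT (fun x => pderiv i psi (x + t *: e_ i)) u).
Proof.
move=> tp uL; have [C HC] := test_taylor_normT i tp.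
apply: (@is_derive_le _ _ _ _ _ _ (C * normT u)).
have : \forall h \near (0 : R), `|h| <= 1.
  by apply: (@cvgr0_norm_le _ _ _ (nbhs (0 : R))) => //; exact: (@cvg_id _ (nbhs (0 : R))).
apply: filterS => h h1.
have L z : L2T (fun x => psi (x + z)) by apply: L2T_translate; exact: L2T_test.
have L' z : L2T (fun x => pderiv i psi (x + z)).
  by apply: L2T_translate; apply: L2T_test; exact: test_pderiv.
have gL : L2T (fun x => psi (x + h *: e_ i) - psi x - h * pderiv i psi x).
  apply: L2B => //; last by apply: L2Z => //; apply: L2T_test; exact: test_pderiv.
  by apply: L2B => //; exact: L2T_test.
have -> : innerT (fun x => psi (x + (h *: 1 + t) *: e_ i)) u - innerT (fun x => psi (x + t *: e_ i)) u -
    h * innerT (fun x => pderiv i psi (x + t *: e_ i)) u =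
    innerT (fun x => psi (x + t *: e_ i + h *: e_ i) - psi (x + t *: e_ i) - h * pderiv i psi (x + t *: e_ i)) u.
  have hL := L2Z measurableT h (L' (t *: e_ i)).
  have L2 : L2T (fun x => psi (x + t *: e_ i + h *: e_ i)).
    by have := L (t *: e_ i + h *: e_ i); congr (Defs.L2 _ _); apply/funext => x; rewrite addrA.
  rewrite -(innerZl measurableT h (L' (t *: e_ i)) uL).
  have -> : (fun x => psi (x + (h *: 1 + t) *: e_ i)) = (fun x => psi (x + t *: e_ i + h *: e_ i)).
    by apply/funext => x; rewrite [h *: 1]mulr1 scalerDl -addrA (addrC (h *: _)).
  rewrite -(innerBl measurableT L2 (L (t *: e_ i)) uL).
  by rewrite -(innerBl measurableT (L2B measurableT L2 (L (t *: e_ i))) hL uL).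
apply: le_trans (inner_CS measurableT (L2T_translate (t *: e_ i) gL) uL) _.
have := normT_translate (t *: e_ i) gL; rewrite /= => ->.
by rewrite mulrAC ler_wpM2r ?L2norm_ge0//; exact: HC.
Qed.

(** By translation invariance the integral of [psi (x + t e_i)] does not depend on [t]; its
    derivative at 0 is the integral in question. No iterated integration is involved. *)
Lemma Rintegral_pderiv i psi : test psi -> \int[leb]_x pderiv i psi x = 0.
Proof.
move=> tp; have [r r0 H] := test_box.
(* The indicator of a large box stands for the constant 1, which is in general not square integrable
   on the whole space. *)
pose chi : 'rV[R]_n -> R := \1_[set x : 'rV[R]_n | forall i, `|x ord0 i| <= r + 1].
have chiL : L2T chi by exact: L2T_box.
have E f : (forall x, ~ (forall i, `|x ord0 i| <= r + 1) -> f x = 0) -> innerT f chi = \int[leb]_x f x.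
  move=> f0; apply: eq_Rintegral => x _; rewrite /chi indicE.
  case: (pselect (forall i, `|x ord0 i| <= r + 1)) => Hx.
    by rewrite mem_set// mulr1.
  by rewrite memNset// mulr0 f0.
have D := is_derive_innerT i 0 tp chiL.
have D0 : is_derive (0 : R) 1 (fun t => innerT (fun x => psi (x + t *: e_ i)) chi) 0.
  apply: (@is_derive_le _ _ _ _ _ _ 0).
  have : \forall h \near (0 : R), `|h| <= 1.
    by apply: (@cvgr0_norm_le _ _ _ (nbhs (0 : R))) => //; exact: (@cvg_id _ (nbhs (0 : R))).
  apply: filterS => h h1.
  have K t : `|t| <= 1 -> innerT (fun x => psi (x + t *: e_ i)) chi = \int[leb]_x psi x.
    move=> t1; rewrite E ?Rintegral_translation//; first exact: test_measurable.
    move=> x Hx; by apply: (H _ tp) => Hx'; apply: Hx; exact: box_translate Hx'.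
  by rewrite !K ?normr0 ?ler01// ?addr0 ?[_ *: 1]mulr1// subrr mulr0 subr0 normr0 mul0r.
have := @derive_val _ _ _ _ _ _ _ D; rewrite (@derive_val _ _ _ _ _ _ _ D0) => D00.
rewrite -[LHS]E; last first.
  move=> x Hx; apply: (H _ (test_pderiv i tp)) => Hx'; apply: Hx => j.
  by apply: le_trans (Hx' j) _; rewrite lerDl.
by rewrite [RHS]D00; apply: inner_eq => // x _; rewrite scale0r addr0.
Qed.

End test_translation.

(** * Test functions separate points of L^2; uniqueness of weak derivatives *)

Section weak.
Context {R : realType} {n : nat}.
Variable Om : set 'rV[R]_n.
Hypotheses (oOm : open Om) (bOm : bounded_set Om).
Implicit Types (f u v w psi a : 'rV[R]_n -> R) (i : 'I_n) (x : 'rV[R]_n).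

Local Notation leb := (@lebesgue_rV R n).
Local Notation L2 := (L2 Om).
Local Notation inner := (inner Om).
Local Notation L2norm := (L2norm Om).
Local Notation test := (test_function Om).

Let mOm : measurable Om := open_measurable_rV oOm.
#[local] Hint Resolve mOm : core.

Lemma continuous_measurable_on f : continuous f -> measurable_fun Om f.
Proof.
by move=> cf; apply: measurable_funS (continuous_measurable_rV cf).
Qed.

Lemma L2_1 : L2 (fun=> 1).
Proof.
apply/(L2P mOm); split; first exact: measurable_cst.
apply: (@measurable_bounded_integrable _ _ _ leb (fun=> 1 ^+ 2)) => //.
  exact: lebesgue_rV_bounded.
by exists 1; split=> // M M1 x _ /=; rewrite expr1n normr1 ltW.
Qed.

Lemma smooth_mul_bounded a : smooth a -> exists2 C, 0 <= C &
  forall u, L2 u -> L2 (a \* u) /\ L2norm (a \* u) <= C * L2norm u.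
Proof.
move=> /smooth_continuous ca; have [C C0 HC] := bounded_on_bounded bOm ca.
have ma := continuous_measurable_on ca.
by exists C => // u uL; split; [exact: (L2_bddM mOm ma HC uL)|exact: (L2_bddM_le mOm ma HC uL)].
Qed.

Lemma L2_smoothM a u : smooth a -> L2 u -> L2 (a \* u).
Proof. by move=> sa uL; have [C _ H] := smooth_mul_bounded sa; exact: (H _ uL).1. Qed.

Lemma L2_smooth a : smooth a -> L2 a.
Proof. by move=> sa; apply: L2_eq (L2_smoothM sa L2_1) => x _ /=; rewrite mulr1. Qed.

Lemma L2_test psi : test psi -> L2 psi.
Proof. by move/test_smooth/L2_smooth. Qed.

Lemma inner_patchl u v : inner u v = Defs.inner [set: 'rV[R]_n] (u \_ Om) v.
Proof.
rewrite /Defs.inner Rintegral_mkcond; apply: eq_Rintegral => x _.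
by rewrite /patch; case: ifP; rewrite ?mul0r.
Qed.

Lemma inner_testl psi u : test psi -> inner psi u = Defs.inner [set: 'rV[R]_n] psi u.
Proof.
move=> tp; rewrite inner_patchl; apply: inner_eq => // x _.
by rewrite /patch; case: ifPn => // /negP; rewrite inE => /(test_out tp).
Qed.

Lemma L2T_patch u : L2 u -> Defs.L2 [set: 'rV[R]_n] (u \_ Om).
Proof. by rewrite /Defs.L2 /= patch_setT. Qed.

Lemma inner_pderiv i a psi : smooth a -> test psi ->
  inner a (pderiv i psi) = - inner (pderiv i a) psi.
Proof.
move=> sa tp; have tap := testM sa tp.
have := Rintegral_pderiv bOm i tap.
have sp := test_smooth tp.
rewrite pderivM; [|exact: (smooth_derivable sa)|exact: (smooth_derivable sp)].
have E : \int[leb]_x ((a \* pderiv i psi) \+ (psi \* pderiv i a)) x =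
    inner (fun=> 1) ((a \* pderiv i psi) \+ (psi \* pderiv i a)).
  rewrite innerC inner_testl; last first.
    by apply: testD; [exact: (testM sa (test_pderiv i tp))|exact: (testMr (smooth_pderiv i sa) tp)].
  by apply: eq_Rintegral => x _; rewrite mulr1.
rewrite E innerDr//; [|exact: (L2_smoothM sa (L2_test (test_pderiv i tp)))
   |exact: (L2_smoothM sp (L2_smooth (smooth_pderiv i sa)))|exact: L2_1].
move/eqP; rewrite addr_eq0 => /eqP H.
rewrite (_ : inner a _ = inner (fun=> 1) (a \* pderiv i psi)); last first.
  by apply: eq_Rintegral => x _ /=; rewrite mul1r.
by rewrite H; congr (- _); apply: eq_Rintegral => x _ /=; rewrite mul1r mulrC.
Qed.

Lemma test_weak i psi : test psi -> weak_derivative Om [:: i] psi (pderiv i psi).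
Proof.
by move=> tp eta te; rewrite expr1 mulN1r; exact: (inner_pderiv i (test_smooth tp) te).
Qed.

(** A product over coordinates because the balls of row vectors are cubes: for [r > 0] it is
    positive exactly on [ball c r]. *)
Definition bump (c : 'rV[R]_n) (r : R) : 'rV[R]_n -> R :=
  fun x => \prod_(i < n) expinv (r ^+ 2 - (x ord0 i - c ord0 i) ^+ 2).

Lemma smooth_bump c r : smooth (bump c r).
Proof.
apply: smooth_prod => i.
have s0 : smooth (fun x : 'rV[R]_n => x ord0 i - c ord0 i).
  by apply: smoothB; [exact: smooth_coord|exact: smooth_cst].
apply: (@smooth_comp1 _ _ expinv (fun x => r ^+ 2 - (x ord0 i - c ord0 i) ^+ 2)).
  exact: smooth1_expinv.
by apply: smoothB; [exact: smooth_cst|exact: (smoothM s0 s0)].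
Qed.

Lemma bump_ge0 c r x : 0 <= bump c r x.
Proof. by apply: prodr_ge0 => i _; exact: expinv_ge0. Qed.

Lemma bump_gt0 c r x : ball c r x -> 0 < bump c r x.
Proof.
move=> /ball_rV[r0 H]; apply: prodr_gt0 => i _; apply: expinv_gt0.
have := H i; rewrite ltr_norml subr_gt0 => /andP[A B]; nra.
Qed.

Lemma bump_eq0 c r x : 0 < r -> ~ ball c r x -> bump c r x = 0.
Proof.
move=> r0 H; have [i ri] : exists i, r <= `|c ord0 i - x ord0 i|.
  apply: contrapT => /forallNP H'; apply: H; apply/ball_rV; split=> // i.
  by have /negP := H' i; rewrite -ltNge.
rewrite /bump (bigD1 i)//= expinv_eq0 ?mul0r// subr_le0 -[(_ - _) ^+ 2]real_normK ?num_real//.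
by rewrite distrC lerXn2r// nnegrE ?ltW.
Qed.

Lemma bump_test c r (U : set 'rV[R]_n) : 0 < r -> ball c (2 * r) `<=` U ->
  test_function U (bump c r).
Proof.
move=> r0 cU; apply/test_functionP; split; first exact: smooth_bump.
exists [set x : 'rV[R]_n | forall i, `[c ord0 i - r, c ord0 i + r]%classic (x ord0 i)]; split.
- exact: (@rV_compact R n (fun i => `[c ord0 i - r, c ord0 i + r]%classic) (fun i => @segment_compact R _ _)).
- move=> x H; apply: cU; apply/ball_rV; split; first lra.
  by move=> i; have := H i; rewrite /= in_itv/= ltr_norml => /andP[A B]; apply/andP; split; lra.
- move=> x H; apply: bump_eq0 => // /ball_rV[_ cx]; apply: H => i.
  by have := cx i; rewrite /= in_itv/= ltr_norml => /andP[A B]; apply/andP; split; lra.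
Qed.

Lemma test_subset (U : set 'rV[R]_n) psi : U `<=` Om -> test_function U psi -> test psi.
Proof. by move=> UO [sp cp pU]; split=> //; exact: subset_trans pU UO. Qed.

(** The finite sums [S m] of bumps vanish off [U] and are eventually bounded below at each point of
    [U]. Hence [m * S m] tends to infinity there, and [expinv] sends it to 1 while keeping 0
    fixed. *)
Lemma test_approx_indic (U : set 'rV[R]_n) : open U -> U `<=` Om ->
  exists psi : nat -> 'rV[R]_n -> R, [/\ forall m, test (psi m),
    forall m x, `|psi m x| <= 1 & forall x, psi m x @[m --> \oo] --> (\1_U x : R)].
Proof.
move=> oU UO; have [D [c [r [r0 DU UE]]]] := open_bigcup_ball oU.
pose S m (x : 'rV[R]_n) : R := \sum_(j < m | nat_of_ord j \in D) bump (c j) (r j) x.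
have S0 m x : 0 <= S m x by apply: sumr_ge0 => j _; exact: bump_ge0.
have tb j : j \in D -> test_function U (bump (c j) (r j)).
  by rewrite inE => Dj; apply: bump_test => //; exact: DU.
have tS m : test_function U (S m).
  rewrite (_ : S m = (fun x => \sum_(j < m) (if nat_of_ord j \in D then bump (c j) (r j) else (fun=> 0)) x)); last first.
    by apply/funext => x; rewrite /S big_mkcond; apply: eq_bigr => j _; case: ifP.
  by apply: test_sum => j; case: ifP => [/tb //|_]; exact: test0.
exists (fun m x => expinv (m%:R * S m x)); split.
- move=> m; apply: (test_subset UO); have /test_functionP[sS [K [cK KU K0]]] := tS m.
  apply/test_functionP; split.
    exact: (@smooth_comp1 _ _ expinv (m%:R \*o S m) smooth1_expinv (smoothZ _ sS)).
  by exists K; split=> // x /K0 ->; rewrite mulr0 expinv_eq0.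
- by move=> m x; rewrite ger0_norm ?expinv_ge0 ?expinv_le1.
- move=> x; have [Ux|Ux] := pselect (U x); last first.
    rewrite indicE memNset//; apply: cvg_near_cst; apply: nearW => m.
    by rewrite (test_out (tS m) Ux) mulr0 expinv_eq0.
  rewrite indicE mem_set//; apply: expinv_cvg1.
  have : U x by []. rewrite {1}UE => -[j Dj xj].
  have bp := bump_gt0 xj.
  apply/cvgryPge => A; near=> m.
  have jm : (j < m)%N by near: m; exact: nbhs_infty_gt.
  have Sb : bump (c j) (r j) x <= S m x.
    rewrite /S (bigD1 (Ordinal jm))//=; last by rewrite mem_set.
    by rewrite lerDl; apply: sumr_ge0 => k _; exact: bump_ge0.
  apply: (@le_trans _ _ (m%:R * bump (c j) (r j) x)); last by rewrite ler_wpM2l.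
  rewrite -ler_pdivrMr//; near: m; exact: nbhs_infty_ger.
Unshelve. all: by end_near. Qed.

(** The fundamental lemma of the calculus of variations: orthogonality passes from test functions to
    indicators of open sets by dominated convergence, then to all Borel sets by Dynkin induction, so
    [w] has integral 0 over every measurable subset. *)
Lemma density0 w : L2 w -> (forall psi, test psi -> inner w psi = 0) -> L2norm w = 0.
Proof.
move=> wL H.
have indM A : measurable A -> measurable_fun Om (\1_A : 'rV[R]_n -> R).
  by move=> mA; apply: measurable_indic.
have ind1 (A : set 'rV[R]_n) x : `|\1_A x : R| <= 1.
  by rewrite indicE; case: (_ \in _); rewrite ?normr1 ?normr0.
have indL A : measurable A -> L2 \1_A.
  move=> mA; apply: L2_eq (L2_bddM mOm (a := \1_A) (u := fun=> 1) (c := 1) (indM _ mA) _ L2_1).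
  - by move=> x _; rewrite /= mulr1.
  - by move=> x _; exact: ind1.
have innerI A : inner w \1_A = inner (\1_A \* w) (fun=> 1).
  by apply: eq_Rintegral => x _ /=; rewrite mulr1 mulrC.
have HU U : open U -> inner w \1_U = 0.
  move=> oU; have [psi [tp pb pU]] := test_approx_indic (openI oU oOm) (@subIsetr _ U Om).
  have C : inner (psi m \* w) (fun=> 1) @[m --> \oo] --> inner (\1_(U `&` Om) \* w) (fun=> 1).
    apply: (inner_dominated mOm (c := 1)) => //; last exact: L2_1.
    - by move=> m; apply: continuous_measurable_on; apply: smooth_continuous; exact: test_smooth.
    - by apply: indM; apply: open_measurable_rV; exact: openI.
  transitivity (inner (\1_(U `&` Om) \* w) (fun=> 1)).
    apply: eq_Rintegral => x; rewrite inE => Ox /=; rewrite mulr1 mulrC; congr (_ * _).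
    by rewrite !indicE in_setI (mem_set Ox) andbT.
  apply: (cvg_unique _ C) => //; apply: cvg_near_cst; apply: nearW => m.
  rewrite -(H _ (tp m)); apply: eq_Rintegral => x _ /=; by rewrite mulr1 mulrC.
have HA : forall A, <<s (@open 'rV[R]_n) >> A -> inner w \1_A = 0.
  apply: (@dynkin_induction _ _ (@open 'rV[R]_n)).
  - exact: measurable_rV_open.
  - exact: openI.
  - by apply: HU; exact: openT.
  - exact: HU.
  - move=> A mA A0.
    have := HU _ openT; rewrite (_ : inner w \1_setT = inner w (\1_A \+ \1_(~` A))).
      by rewrite innerDr//; [rewrite A0 add0r|exact: indL|apply: indL; exact: measurableC].
    by apply: inner_eq => // x _; rewrite /= !indicE in_setC in_setT; case: (_ \in _); rewrite ?addr0 ?add0r.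
  (* Disjointness turns the indicator of a finite union into a sum; dominated convergence then
     reaches the countable union. *)
  - move=> F mF tF F0.
    pose G m := \1_(\bigcup_(k < m) F k) : 'rV[R]_n -> R.
    have mG m : measurable (\bigcup_(k < m) F k) by apply: bigcup_measurable.
    have C : inner (G m \* w) (fun=> 1) @[m --> \oo] --> inner (\1_(\bigcup_k F k) \* w) (fun=> 1).
      apply: (inner_dominated mOm (c := 1)) => //; last exact: L2_1.
      - by move=> m; exact: indM.
      - by apply: indM; exact: bigcup_measurable.
      - by move=> m x _; exact: ind1.
      - move=> x _; rewrite indicE; case: (pselect ((\bigcup_k F k) x)) => Hx.
          rewrite mem_set//; have [k _ Fkx] := Hx.
          apply: cvg_near_cst; exists k.+1 => // m /= km.
          by rewrite /G indicE mem_set//; exists k.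
        rewrite memNset//; apply: cvg_near_cst; apply: nearW => m.
        by rewrite /G indicE memNset// => -[k _ Fkx]; apply: Hx; exists k.
    rewrite innerI; apply: (cvg_unique _ C) => //; apply: cvg_near_cst; apply: nearW => m.
    rewrite -innerI; elim: m => [|m IH].
      rewrite -[RHS](inner0r Om w); apply: inner_eq => // x _.
      by rewrite /G indicE memNset// => -[].
    rewrite (_ : inner w (G m.+1) = inner w (G m \+ \1_(F m))).
      by rewrite innerDr//; [rewrite IH F0 add0r|exact: indL|exact: indL].
    apply: inner_eq => // x _; rewrite /G /= bigcup_mkord big_ord_recr /= -bigcup_mkord.
    rewrite !indicE in_setU; case: (boolP (x \in F m)); rewrite ?orbT ?orbF ?addr0//.
    rewrite inE => Fmx; rewrite memNset ?add0r// => -[k /= km Fkx].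
    by have mk := tF m k I I (ex_intro _ x (conj Fmx Fkx)); rewrite mk ltnn in km.
have wL1 : leb.-integrable Om (EFin \o w).
  by have := L2_mul_integrable mOm wL L2_1; congr (_.-integrable _ _); apply/funext => x /=; rewrite mulr1.
have : ae_eq leb Om (EFin \o w) (cst 0%E).
  apply: (integral_ae_eq mOm wL1) => // E EO mE.
  have := HA E; rewrite -measurable_rV_open => /(_ mE) HE.
  rewrite integral0 -[in LHS](setIidr EO) integral_mkcondr.
  have wE : leb.-integrable Om (EFin \o (w \* \1_E)) by exact: (L2_mul_integrable mOm wL (indL _ mE)).
  transitivity (\int[leb]_(x in Om) (w x * \1_E x)%:E)%E.
    apply: eq_integral => x _; rewrite /patch indicE.
    by case: ifPn => xE; rewrite ?mulr1 ?mulr0.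
  by rewrite -[LHS]fineK; [rewrite [fine _]HE|exact: integrable_fin_num wE].
move=> ae0; rewrite -(L2norm0 mOm); apply: (L2norm_ae_eq mOm wL (L2_0 mOm)).
by apply: filterS ae0 => x H0 Ox; have [] := H0 Ox.
Qed.

Lemma density0_ae u v : L2 u -> L2 v -> (forall psi, test psi -> inner u psi = inner v psi) ->
  u = v %[ae leb in Om].
Proof.
move=> uL vL H; apply: (ae_L2normB0 mOm) => //.
apply: density0 => [|psi tp]; first exact: L2B.
by rewrite innerBl// ?H ?subrr//; exact: L2_test.
Qed.

Lemma weak_unique s u v v' : L2 v -> L2 v' -> weak_derivative Om s u v ->
  weak_derivative Om s u v' -> v = v' %[ae leb in Om].
Proof.
move=> vL vL' wv wv'; apply: density0_ae => // psi tp.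
have := wv _ tp; rewrite (wv' _ tp) => /mulfI -> //.
by rewrite expf_neq0// oppr_eq0 oner_eq0.
Qed.

Lemma wderivP s u v : L2 v -> weak_derivative Om s u v ->
  [/\ L2 (wderiv Om s u), weak_derivative Om s u (wderiv Om s u) &
      wderiv Om s u = v %[ae leb in Om]].
Proof.
move=> vL wv; have [wL ww] : L2 (wderiv Om s u) /\ weak_derivative Om s u (wderiv Om s u).
  by apply: (@xgetPex _ (fun=> 0) [set v | L2 v /\ weak_derivative Om s u v]); exists v.
by split=> //; exact: (weak_unique wL vL ww wv).
Qed.

Lemma wderiv_norm s u v : L2 v -> weak_derivative Om s u v ->
  L2norm (wderiv Om s u) = L2norm v.
Proof. by move=> vL wv; have [wL _ wE] := wderivP vL wv; exact: (L2norm_ae_eq mOm wL vL wE). Qed.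

Lemma weak_nil u : weak_derivative Om [::] u u.
Proof. by move=> psi _; rewrite expr0 mul1r. Qed.

Lemma test_pderivs s psi : test psi -> test (pderivs s psi).
Proof. by move=> tp; elim: s => //= i s; exact: test_pderiv. Qed.

Lemma weakD s u u' v v' : L2 u -> L2 u' -> L2 v -> L2 v' ->
  weak_derivative Om s u v -> weak_derivative Om s u' v' ->
  weak_derivative Om s (u \+ u') (v \+ v').
Proof.
move=> uL uL' vL vL' wv wv' psi tp.
have dL := L2_test (test_pderivs s tp); have pL := L2_test tp.
by rewrite !innerDl// wv// wv'//; ring.
Qed.

Lemma weakZ s c u v : L2 u -> L2 v -> weak_derivative Om s u v ->
  weak_derivative Om s (c \*o u) (c \*o v).
Proof.
move=> uL vL wv psi tp.
have dL := L2_test (test_pderivs s tp); have pL := L2_test tp.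
by rewrite !innerZl// wv//; ring.
Qed.

Lemma weakB s u u' v v' : L2 u -> L2 u' -> L2 v -> L2 v' ->
  weak_derivative Om s u v -> weak_derivative Om s u' v' ->
  weak_derivative Om s (u \- u') (v \- v').
Proof.
move=> uL uL' vL vL' wv wv' psi tp.
have dL := L2_test (test_pderivs s tp); have pL := L2_test tp.
by rewrite !innerBl// wv// wv'//; ring.
Qed.

End weak.

(** * Integration by parts for weak derivatives *)

(** A hypothesis of the calculus below; [spectral_tests_dense] later discharges it by means of the
    eigenfunctions. *)
Definition tests_dense {R : realType} {n : nat} (Om : set 'rV[R]_n) : Prop :=
  forall f, L2 Om f -> forall e : R, 0 < e ->
    exists2 psi, test_function Om psi & L2norm Om (f \- psi) <= e.

(** Lets an approximation argument end with an error [K * e] for a fixed [K], without rescaling the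
    precision beforehand. *)
Lemma le_lin {R : realType} (X Y K : R) : (forall e, 0 < e -> X <= Y + K * e) -> X <= Y.
Proof.
move=> H; apply/ler_addgt0Pr => e e0.
have K0 : 0 < `|K| + 1 by rewrite ltr_wpDl.
apply: le_trans (H (e / (`|K| + 1)) _) _; first by rewrite divr_gt0.
rewrite lerD2l mulrA ler_pdivrMr//; have := ler_norm K; nra.
Qed.

Lemma MVT_le {R : realType} (Q Q' : R -> R) (s C : R) :
  (forall y : R, `|y| <= `|s| -> is_derive y 1 Q (Q' y)) ->
  (forall y : R, `|y| <= `|s| -> `|Q' y| <= C) -> `|Q s - Q 0| <= `|s| * C.
Proof.
move=> DQ BQ.
have K (a b : R) : a < b -> (forall y, a <= y <= b -> `|y| <= `|s|) ->
    `|Q b - Q a| <= (b - a) * C.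
  move=> ab yab; have [] := MVT ab (f := Q) (df := Q').
  - by move=> y; rewrite in_itv/= => /andP[ay yb]; apply: DQ; apply: yab; rewrite !ltW.
  - apply: derivable_within_continuous => y; rewrite in_itv/= => yin.
    by have [] := DQ y (yab _ yin).
  move=> y; rewrite in_itv/= => /andP[ay yb] ->.
  rewrite normrM (gtr0_norm (_ : 0 < b - a)) ?subr_gt0// mulrC ler_wpM2l//.
    by rewrite subr_ge0 ltW.
  by apply: BQ; apply: yab; rewrite !ltW.
have [s0|s0|->] := ltgtP s 0; last by rewrite subrr !normr0 mul0r.
- rewrite distrC (ltr0_norm s0) -[- s]sub0r; apply: K => // y /andP[sy y0].
  by rewrite ler0_norm// ltr0_norm// lerN2.
- rewrite (gtr0_norm s0) -[X in X * C]subr0; apply: K => // y /andP[y0 sy].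
  by rewrite ger0_norm// gtr0_norm.
Qed.

Section product_rule.
Context {R : realType} {n : nat}.
Variable Om : set 'rV[R]_n.
Hypotheses (oOm : open Om) (bOm : bounded_set Om).
Implicit Types (f u v w G psi A : 'rV[R]_n -> R) (k : 'I_n) (x : 'rV[R]_n) (t : R).

Local Notation L2T := (L2 [set: 'rV[R]_n]).
Local Notation innerT := (inner [set: 'rV[R]_n]).
Local Notation normT := (L2norm [set: 'rV[R]_n]).
Local Notation e_ i := (delta_mx ord0 i : 'rV[R]_n).
Local Notation L2 := (L2 Om).
Local Notation inner := (inner Om).
Local Notation L2norm := (L2norm Om).
Local Notation test := (test_function Om).
Local Notation mT := (@measurableT _ 'rV[R]_n).

Let mOm : measurable Om := open_measurable_rV oOm.
#[local] Hint Resolve mOm : core.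

(** A test function close to [w] itself shows that [|w|^2] is at most [C * |w|] up to a small
    error. *)
Lemma dual_bound w (C : R) : tests_dense Om -> L2 w -> 0 <= C ->
  (forall psi, test psi -> `|inner w psi| <= C * L2norm psi) -> L2norm w <= C.
Proof.
move=> dense wL C0 H; set N := L2norm w.
have N0 : 0 <= N by exact: L2norm_ge0.
have : N * N <= C * N.
  apply: (@le_lin _ _ _ (C + N)) => e e0.
  have [psi tp pe] := dense _ wL _ e0; have pL := L2_test oOm bOm tp.
  have dL := L2B mOm wL pL.
  have E : N * N = inner w psi + inner w (w \- psi).
    by rewrite -expr2 L2norm2// innerBr//; ring.
  have H1 := le_trans (ler_norm _) (H _ tp).
  have H2 := le_trans (ler_norm _) (inner_CS mOm wL dL).
  have H3 : L2norm psi <= N + e.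
    have := L2norm_distB mOm wL pL; rewrite ler_norml => /andP[H3 _].
    by rewrite -/N in H3; move: H3 pe; move: (L2norm psi) (L2norm (w \- psi)) => p q; lra.
  rewrite E; move: H1 H2 H3 pe; rewrite -/N.
  move: (inner w psi) (inner w (w \- psi)) (L2norm psi) (L2norm (w \- psi)) => a b p q; nra.
have [->//|NN0] := eqVneq N 0.
by rewrite ler_pM2r// lt_neqAle eq_sym NN0.
Qed.

Lemma test_patch psi : test psi -> psi \_ Om = psi.
Proof.
move=> tp; apply/funext => x; rewrite /patch; case: ifPn => // /negP; rewrite inE => Ox.
by rewrite (test_out tp Ox).
Qed.

Lemma normT_patch u : normT (u \_ Om) = L2norm u.
Proof. by rewrite /Defs.L2norm patch_setT. Qed.

Lemma normT_translate_le psi k : test psi -> exists2 C, 0 <= C & forall t, `|t| <= 1 ->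
  normT (fun x => psi (x + t *: e_ k) - psi x) <= C * `|t|.
Proof.
move=> tp; have [r r0 H] := test_box bOm; have [C C0 HC] := test_lipschitz k tp.
exists (C * normT \1_[set x : 'rV[R]_n | forall i, `|x ord0 i| <= r + 1]).
  by rewrite mulr_ge0 ?L2norm_ge0.
move=> t t1; rewrite mulrAC; apply: (L2T_bounded_box _ _ _).2.
- apply: measurable_funB; last exact: (test_measurable tp).
  by apply: (measurableT_comp (test_measurable tp)); exact: measurable_translate.
- by move=> x; apply: HC.
- move=> x Hx; rewrite (H _ tp x) ?subr0; last first.
    by move=> Hx'; apply: Hx => j; apply: le_trans (Hx' j) _; rewrite lerDl.
  by apply: (H _ tp) => Hx''; apply: Hx; exact: box_translate Hx''.
Qed.

Lemma translation_continuous u k : tests_dense Om -> L2 u -> forall e, 0 < e ->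
  exists2 r, 0 < r & forall t, `|t| < r ->
    normT (fun x => (u \_ Om) (x + t *: e_ k) - (u \_ Om) x) <= e.
Proof.
move=> dense uL e e0; have e30 : 0 < e / 3 by lra.
have [psi tp pe] := dense _ uL _ e30.
have [C C0 HC] := normT_translate_le k tp.
have C10 : 0 < C + 1 by lra.
exists (Num.min 1 (e / 3 / (C + 1))); first by rewrite lt_min ltr01 divr_gt0.
move=> t; rewrite lt_min => /andP[t1]; rewrite ltr_pdivlMr// => tC.
have pL := L2T_test bOm tp; have vL := L2T_patch uL.
set v0 := u \_ Om in vL *.
have dL : L2T (v0 \- psi) by exact: L2B.
have dN : normT (v0 \- psi) <= e / 3.
  rewrite -{1}(test_patch tp) -(_ : (u \- psi) \_ Om = v0 \- psi \_ Om) ?normT_patch//.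
  by apply/funext => x; rewrite /v0 /patch /=; case: ifP => //; rewrite subr0.
pose T w := fun x => w (x + t *: e_ k).
rewrite (_ : (fun x => _) = (T (v0 \- psi) \- (v0 \- psi)) \+ (T psi \- psi)); last first.
  by apply/funext => x; rewrite /T /=; ring.
have TdL : L2T (T (v0 \- psi)) by exact: L2T_translate.
have TpL : L2T (T psi) by exact: L2T_translate.
apply: le_trans (L2normD_le mT (L2B mT TdL dL) (L2B mT TpL pL)) _.
have A1 := L2normB_le mT TdL dL.
have A2 : normT (T (v0 \- psi)) = normT (v0 \- psi) by exact: (normT_translate _ dL).
have A3 : normT (T psi \- psi) <= C * `|t| by apply: HC; exact: ltW.
rewrite A2 in A1; have t0 := normr_ge0 t; clear -A1 A3 dN tC t0.
move: (normT _) (normT _) (normT _) A1 A3 dN tC => a b c; nra.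
Qed.

(** The tolerance [e] and radius [r] depend on [A] but not on [psi], because translates of
    [A \* psi] keep their support in the domain as long as those of [A] do. The caller can thus let
    [psi] tend to [v] in L^2 at fixed [t]. *)
Lemma weak_translate k v G A : tests_dense Om -> L2 v -> L2 G ->
  weak_derivative Om [:: k] v G -> test A ->
  forall e, 0 < e -> exists2 r, 0 < r & forall psi t, test psi -> `|t| < r ->
    `|innerT (A \* psi) (fun x => (v \_ Om) (x + t *: e_ k) - (v \_ Om) x)
      - t * inner (A \* psi) G| <= `|t| * (e * L2norm (A \* psi)).
Proof.
move=> dense vL GL vG tA e e0.
have [r1 r10 H1] := translation_continuous k dense GL e0.
have [r2 r20 H2] := test_translate k oOm tA.
exists (Num.min r1 r2); first by rewrite lt_min r10.
move=> psi t tp; rewrite lt_min => /andP[tr1 tr2].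
set v0 := v \_ Om; set G0 := G \_ Om; set P := A \* psi.
have tP : test P by exact: (testMr (test_smooth tp) tA).
have v0L : L2T v0 := L2T_patch vL; have G0L : L2T G0 := L2T_patch GL.
have PL : L2T P := L2T_test bOm tP.
pose F s := innerT (fun x => P (x + s *: e_ k)) v0.
have tPs s : `|s| < r2 -> test (fun x => P (x + s *: e_ k)).
  by move=> sr; apply: (testMr (smooth_translate (s *: e_ k) (test_smooth tp)) (H2 _ sr)).
have F' (s : R) : `|s| < r2 -> is_derive s 1 F (- innerT (fun x => P (x + s *: e_ k)) G0).
  move=> sr; have D := is_derive_innerT bOm k s tP v0L.
  apply: is_derive_eq D _; rewrite -pderiv_translate.
  have tPs' := tPs _ sr.
  rewrite -(inner_testl v0 (test_pderiv k tPs')) innerC.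
  rewrite (_ : inner v0 _ = inner v (pderiv k (fun x => P (x + s *: e_ k)))); last first.
    by apply: inner_eq => // x xO; rewrite /v0 /patch xO.
  rewrite (vG _ tPs') expr1 mulN1r; congr (- _).
  by rewrite inner_patchl innerC.
have Fd s : F s - F 0 = innerT P (fun x => v0 (x - s *: e_ k) - v0 x).
  rewrite (innerBr mT (L2T_translate (- (s *: e_ k)) v0L) v0L PL) /F.
  rewrite (innerT_translateN _ PL v0L); congr (_ - _).
  by apply: inner_eq => // x _; rewrite scale0r addr0.
pose I0 := inner P G.
have I0E : I0 = innerT P G0 by rewrite /I0 innerC inner_patchl innerC.
(* The derivative of [F] at 0 is [- I0], so that of [Q] is the change of an integral against [G]
   under translation, which is small by continuity of translations in L^2. *)
pose Q s := F s + s * I0.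
have Q' (s : R) : `|s| < r2 -> is_derive s 1 Q (I0 - innerT (fun x => P (x + s *: e_ k)) G0).
  move=> sr; have D1 := F' _ sr.
  have D2 : is_derive s 1 (fun s : R => s * I0) I0.
    have := is_deriveZ I0 (is_derive_id s (1 : R)).
    rewrite [I0 *: _]mulr1; congr (is_derive _ _ _ _).
    by apply/funext => y /=; rewrite mulrC.
  have := is_deriveD D1 D2; rewrite (addrC (- _)); exact.
have B s : `|s| < r1 -> `|I0 - innerT (fun x => P (x + s *: e_ k)) G0| <= e * L2norm P.
  move=> sr; rewrite (innerT_translateN _ PL G0L) I0E.
  rewrite -(innerBr mT G0L (L2T_translate (- (s *: e_ k)) G0L) PL).
  apply: le_trans (inner_CS mT PL (L2B mT G0L (L2T_translate (- (s *: e_ k)) G0L))) _.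
  have -> : normT P = L2norm P by rewrite -{1}(test_patch tP) normT_patch.
  rewrite mulrC ler_wpM2r ?L2norm_ge0//.
  rewrite (L2normBC mT G0L (L2T_translate (- (s *: e_ k)) G0L)).
  have := H1 (- s); rewrite normrN => /(_ sr); rewrite -/G0.
  apply: le_trans; rewrite le_eqVlt; apply/orP; left; apply/eqP; apply: L2norm_eq => x _ /=.
  by rewrite scaleNr.
have key s : `|s| < Num.min r1 r2 -> `|F s - F 0 + s * I0| <= `|s| * (e * L2norm P).
  rewrite lt_min => /andP[sr1 sr2].
  have Q0 : F s - F 0 + s * I0 = Q s - Q 0 by rewrite /Q mul0r addr0; ring.
  rewrite Q0; apply: (MVT_le (Q' := fun y => I0 - innerT (fun x => P (x + y *: e_ k)) G0)) => y ys.
    by apply: Q'; apply: le_lt_trans ys _.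
  by apply: B; apply: le_lt_trans ys _.
have := key (- t); rewrite normrN lt_min tr1 tr2 => /(_ isT).
rewrite Fd mulNr; have -> : (fun x => v0 (x - - t *: e_ k) - v0 x) = (fun x => v0 (x + t *: e_ k) - v0 x).
  by apply/funext => x; rewrite scaleNr opprK.
exact.
Qed.

(* The difference quotients S(t) and S(-t) of t |-> int A v (tau_t v) at 0 differ, by translation
   invariance, by a difference quotient that falls on A alone. *)
Lemma weak_product_rule k v G A : tests_dense Om -> L2 v -> L2 G ->
  weak_derivative Om [:: k] v G -> test A ->
  2 * inner (A \* v) G = - inner (pderiv k A \* v) v.
Proof.
move=> dense vL GL vG tA.
set v0 := v \_ Om; have v0L : L2T v0 := L2T_patch vL.
have sA := test_smooth tA; have sdA := smooth_pderiv k sA.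
have tdA := test_pderiv k tA.
have [cA cA0 HA] := test_bounded tA.
have [cD cD0 HD] := test_bounded tdA.
have [cT cT0 HT] := test_taylor k tA.
have mA := test_measurable tA; have mD := test_measurable tdA.
have boundT f c w : measurable_fun setT f -> (forall x, `|f x| <= c) -> L2T w ->
    L2T (f \* w) /\ normT (f \* w) <= c * normT w.
  by move=> mf fc wL; split; [apply: (L2_bddM mT mf)|apply: (L2_bddM_le mT mf)].
have N0 : 0 <= normT v0 by exact: L2norm_ge0.
set I := inner (A \* v) G; set J := inner (pderiv k A \* v) v.
have JE : J = innerT (pderiv k A \* v0) v0.
  rewrite /J inner_mulA innerC inner_patchl -/v0; apply: eq_Rintegral => x _.
  by rewrite /v0 /patch /=; case: ifP; rewrite ?mul0r ?mulr0//; ring.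
pose tau t := fun x => v0 (x + t *: e_ k).
have tauL t : L2T (tau t) by exact: L2T_translate.
have AvL : L2T (A \* v0) := (boundT _ _ _ mA HA v0L).1.
pose S t := innerT (A \* v0) (tau t \- v0).
have main e : 0 < e -> exists2 r, 0 < r & forall t, 0 < t < r ->
    `|S t - t * I| <= t * e /\ `|S (- t) + t * I| <= t * e.
  move=> e0.
  have M0 : 0 < cA * (L2norm v + 1) + 1.
    by rewrite ltr_wpDl// mulr_ge0// addr_ge0// L2norm_ge0.
  (* For [psi] within 1 of [v] the norm of [A \* psi] is at most [cA * (L2norm v + 1)], so this
     tolerance leaves an error of at most [t * e]. *)
  have e'0 : 0 < e / (cA * (L2norm v + 1) + 1) by rewrite divr_gt0.
  have [r r0 H] := weak_translate dense vL GL vG tA e'0.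
  exists r => // t /andP[t0 tr].
  suff K s : `|s| = t -> `|S s - s * I| <= t * e.
    split; first by apply: K; rewrite gtr0_norm.
    by have := K (- t); rewrite normrN gtr0_norm// mulNr opprK; apply.
  move=> st.
  (* Here [psi] is sent to [v] with [s] fixed, which is legitimate because [r] was chosen before
     [psi]. *)
  apply: (@le_lin _ _ _ (cA * normT (tau s \- v0) + t * (cA * L2norm G))) => d d0.
  have d10 : 0 < Num.min d 1 by rewrite lt_min d0 ltr01.
  have [psi tp pd] := dense _ vL _ d10.
  have pL := L2_test oOm bOm tp; have pLT := L2T_test bOm tp.
  have pd1 : L2norm (v \- psi) <= d by apply: le_trans pd _; rewrite ge_min lexx.
  have pd2 : L2norm (v \- psi) <= 1 by apply: le_trans pd _; rewrite ge_min lexx orbT.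
  have sr : `|s| < r by rewrite st.
  have {}H := H psi s tp sr; rewrite st in H.
  have dL : L2 (v \- psi) by exact: L2B.
  have dTE : (v \- psi) \_ Om = v0 \- psi.
    apply/funext => x; rewrite /v0 /patch /=; case: ifPn => //= /negP; rewrite inE => Ox.
    by rewrite (test_out tp Ox) subr0.
  have dTL : L2T (v0 \- psi) by rewrite -dTE; exact: L2T_patch.
  have dTN : normT (v0 \- psi) = L2norm (v \- psi) by rewrite -dTE normT_patch.
  have ApN : L2norm (A \* psi) <= cA * (L2norm v + 1).
    apply: (@le_trans _ _ (cA * L2norm psi)).
      apply: (L2_bddM_le mOm) => //.
      exact: continuous_measurable_on (smooth_continuous sA).
    rewrite ler_wpM2l//; have := L2norm_distB mOm vL pL; rewrite ler_norml => /andP[+ _].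
    by move: pd2; move: (L2norm v) (L2norm psi) (L2norm _) => a b c; lra.
  have tauvL : L2T (tau s \- v0) by exact: L2B.
  have E1 : S s = innerT (A \* psi) (tau s \- v0) + innerT (A \* (v0 \- psi)) (tau s \- v0).
    rewrite -innerDl//; [|exact: (boundT _ _ _ mA HA pLT).1|exact: (boundT _ _ _ mA HA dTL).1].
    by apply: inner_eq => // x _ /=; ring.
  have AO : {in Om, forall x, `|A x| <= cA} by move=> x _; exact: HA.
  have mAO : measurable_fun Om A by exact: continuous_measurable_on (smooth_continuous sA).
  have E2 : I = inner (A \* psi) G + inner (A \* (v \- psi)) G.
    rewrite -innerDl//; [|exact: (L2_smoothM oOm bOm sA pL)|exact: (L2_smoothM oOm bOm sA dL)].
    by apply: inner_eq => // x _ /=; ring.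
  have B1 : `|innerT (A \* (v0 \- psi)) (tau s \- v0)| <= cA * d * normT (tau s \- v0).
    apply: le_trans (inner_CS mT (boundT _ _ _ mA HA dTL).1 tauvL) _.
    rewrite ler_wpM2r ?L2norm_ge0//; apply: le_trans (boundT _ _ _ mA HA dTL).2 _.
    by rewrite dTN ler_wpM2l.
  have B2 : `|inner (A \* (v \- psi)) G| <= cA * d * L2norm G.
    apply: le_trans (inner_CS mOm (L2_smoothM oOm bOm sA dL) GL) _.
    rewrite ler_wpM2r ?L2norm_ge0//; apply: le_trans (L2_bddM_le mOm mAO (fun x _ => HA x) dL) _.
    by rewrite ler_wpM2l.
  have B3 : t * (e / (cA * (L2norm v + 1) + 1) * L2norm (A \* psi)) <= t * e.
    apply: ler_wpM2l; first exact: ltW.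
    rewrite mulrAC ler_pdivrMr//; apply: ler_wpM2l; first exact: ltW.
    by apply: le_trans ApN _; rewrite lerDl.
  have E3 : S s - s * I = (innerT (A \* psi) (fun x => v0 (x + s *: e_ k) - v0 x) - s * inner (A \* psi) G)
      + (innerT (A \* (v0 \- psi)) (tau s \- v0) - s * inner (A \* (v \- psi)) G).
    by rewrite E1 E2; ring.
  rewrite E3; apply: le_trans (ler_normD _ _) _; apply: lerD; first exact: le_trans H B3.
  apply: le_trans (ler_normB _ _) _; rewrite normrM st.
  have := ler_wpM2l (ltW t0) B2; move: B1.
  move: (normT _) (L2norm G) `|_| `|_| => a b c c'; lra.
have SS t : S t - S (- t) = innerT ((fun x => A x - A (x + t *: e_ k)) \* v0) (tau t).
  have mAt : measurable_fun setT (fun x => A (x + t *: e_ k)).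
    by apply: (measurableT_comp mA); exact: measurable_translate.
  have AtL := (boundT _ cA _ mAt (fun x => HA _) (tauL t)).1.
  have AtvL := (boundT _ cA _ mAt (fun x => HA _) v0L).1.
  have E1 : innerT (A \* v0) (tau (- t)) = innerT ((fun x => A (x + t *: e_ k)) \* tau t) v0.
    rewrite -(innerT_translate (t *: e_ k) AvL (tauL (- t))); apply: inner_eq => // x _ /=.
    by rewrite /tau -addrA -scalerDl subrr scale0r addr0.
  rewrite /S !innerBr// E1.
  rewrite (_ : (fun x => A x - A (x + t *: e_ k)) \* v0 = (A \* v0) \- ((fun x => A (x + t *: e_ k)) \* v0)); last first.
    by apply/funext => x /=; ring.
  rewrite innerBl//; have -> : innerT ((fun x => A (x + t *: e_ k)) \* tau t) v0 =
      innerT ((fun x => A (x + t *: e_ k)) \* v0) (tau t).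
    by apply: eq_Rintegral => x _ /=; ring.
  ring.
apply/eqP; rewrite -subr_eq0 opprK -normr_le0.
apply: (@le_lin _ _ _ (2 + cT * normT v0 ^+ 2 + cD * normT v0)) => e e0; rewrite add0r.
have [r1 r10 H1] := main e e0.
have [r2 r20 H2] := translation_continuous k dense vL e0.
pose t := Num.min e (Num.min r1 r2) / 2.
have m0 : 0 < Num.min e (Num.min r1 r2) by rewrite !lt_min e0 r10.
have t0 : 0 < t by rewrite divr_gt0.
have tm : t < Num.min e (Num.min r1 r2) by rewrite /t ltr_pdivrMr// ltr_pMr// ltr1n.
have [te [tr1 tr2]] : t < e /\ t < r1 /\ t < r2 by move: tm; rewrite !lt_min => /andP[-> /andP[-> ->]].
have [S1 S2] : `|S t - t * I| <= t * e /\ `|S (- t) + t * I| <= t * e by apply: H1; rewrite t0.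
have {}H2 : normT (tau t \- v0) <= e by apply: H2; rewrite gtr0_norm.
(* Taylor's formula replaces the difference of [A] by its derivative, at a cost of order [t^2];
   continuity of translations then replaces [tau t] by [v0]. *)
have S3 : `|S t - S (- t) + t * J| <= t * e * (cT * normT v0 ^+ 2) + t * (cD * normT v0 * e).
  pose rem x := A x - A (x + t *: e_ k) + t * pderiv k A x.
  have mrem : measurable_fun setT rem.
    apply: measurable_funD; last exact: measurable_funM.
    apply: measurable_funB => //.
    by apply: (measurableT_comp mA); exact: measurable_translate.
  have Hrem x : `|rem x| <= cT * t ^+ 2.
    have -> : rem x = - (A (x + t *: e_ k) - A x - t * pderiv k A x) by rewrite /rem; ring.
    by rewrite normrN; exact: HT.
  have [rL rN] := boundT _ _ _ mrem Hrem v0L.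
  have [DL DN] := boundT _ _ _ mD HD v0L.
  have tvL := L2B mT (tauL t) v0L.
  have E : S t - S (- t) + t * J = innerT (rem \* v0) (tau t) - t * innerT (pderiv k A \* v0) (tau t \- v0).
    rewrite SS JE innerBr//.
    rewrite (_ : (fun x => A x - A (x + t *: e_ k)) \* v0 = (rem \* v0) \- (t \*o (pderiv k A \* v0))); last first.
      by apply/funext => x; rewrite /rem /=; ring.
    rewrite innerBl//; last exact: L2Z.
    by rewrite innerZl//; ring.
  rewrite E; apply: le_trans (ler_normB _ _) _; apply: lerD.
    apply: le_trans (inner_CS mT rL (tauL t)) _.
    rewrite (normT_translate _ v0L); apply: (@le_trans _ _ (cT * t ^+ 2 * normT v0 * normT v0)).
      by rewrite ler_wpM2r.
    rewrite (_ : _ * _ = t * t * (cT * normT v0 ^+ 2)); last by ring.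
    rewrite ler_wpM2r ?mulr_ge0 ?sqr_ge0//.
    by rewrite ler_wpM2l ?ltW// ltW.
  rewrite normrM gtr0_norm//; apply: ler_wpM2l; first exact: ltW.
  apply: le_trans (inner_CS mT DL tvL) _; apply: ler_pM; rewrite ?L2norm_ge0//.
have : t * `|2 * I + J| <= t * ((2 + cT * normT v0 ^+ 2 + cD * normT v0) * e).
  rewrite -[X in X * `|_|](gtr0_norm t0) -normrM.
  rewrite (_ : t * (2 * I + J) = (S t - S (- t) + t * J) - (S t - t * I) + (S (- t) + t * I)); last by ring.
  apply: le_trans (ler_normD _ _) _; apply: le_trans (lerD (ler_normB _ _) (lexx _)) _.
  move: S1 S2 S3; move: `|_| `|_| `|_| => a b c; lra.
by rewrite ler_pM2l.
Qed.

End product_rule.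

(** * Functions in H^2 and H^1_0 *)

Section sobolev_data.
Context {R : realType} {n : nat}.
Variable Om : set 'rV[R]_n.
Hypotheses (oOm : open Om) (bOm : bounded_set Om).
Implicit Types (u v w f psi : 'rV[R]_n -> R) (p r : 'I_n -> 'rV[R]_n -> R)
  (q : 'I_n -> 'I_n -> 'rV[R]_n -> R) (i j k : 'I_n) (c e : R).

Local Notation leb := (@lebesgue_rV R n).
Local Notation L2 := (L2 Om).
Local Notation inner := (inner Om).
Local Notation L2norm := (L2norm Om).
Local Notation test := (test_function Om).
Local Notation weak := (weak_derivative Om).

Let mOm : measurable Om := open_measurable_rV oOm.
#[local] Hint Resolve mOm : core.

(** [u] is in H^1_0 with gradient [p]. Carrying the gradient as explicit functions, instead of the
    chosen representatives [wderiv], lets linear combinations be formed pointwise. *)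
Definition H10_data u p : Prop := [/\ L2 u, forall k, L2 (p k) &
  forall e, 0 < e -> exists psi, [/\ test psi, L2norm (u \- psi) <= e &
    forall k, L2norm (p k \- pderiv k psi) <= e]].

(** The intersection of H^2 and H^1_0, with Hessian [q]: the second index is the direction in which
    [p i] is differentiated. *)
Definition H2_data u p q : Prop := [/\ H10_data u p, forall i j, L2 (q i j) &
  forall i j, weak [:: j] (p i) (q i j)].

Definition lap q : 'rV[R]_n -> R := fun x => \sum_k q k k x.

Definition gradnorm p : R := \sum_k L2norm (p k).

Lemma gradnorm_ge0 p : 0 <= gradnorm p.
Proof. by apply: sumr_ge0 => k _; exact: L2norm_ge0. Qed.

Lemma L2norm_le_gradnorm p k : L2norm (p k) <= gradnorm p.
Proof.
by rewrite /gradnorm (bigD1 k)//= lerDl; apply: sumr_ge0 => j _; exact: L2norm_ge0.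
Qed.

Lemma L2_lap q : (forall i j, L2 (q i j)) -> L2 (lap q).
Proof. by move=> qL; apply: L2_sum. Qed.

(* An identity that is linear and H^1-bounded in a test function extends to H^1_0. *)
Lemma H10_ind (I : Type) (s : seq I) u p (a : I -> 'rV[R]_n -> R) (b : I -> option 'I_n) :
  H10_data u p -> (forall m, L2 (a m)) ->
  (forall psi, test psi ->
     \sum_(m <- s) inner (a m) (if b m is Some k then pderiv k psi else psi) = 0) ->
  \sum_(m <- s) inner (a m) (if b m is Some k then p k else u) = 0.
Proof.
move=> [uL pL approx] aL H.
apply/eqP; rewrite -normr_le0; apply: (@le_lin _ _ _ (\sum_(m <- s) L2norm (a m))) => e e0.
have [psi [tp ue pe]] := approx e e0; rewrite add0r.
have psiL := L2_test oOm bOm tp; have dL k := L2_test oOm bOm (test_pderiv k tp).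
have -> : \sum_(m <- s) inner (a m) (if b m is Some k then p k else u) =
    \sum_(m <- s) inner (a m) (if b m is Some k then p k else u) -
    \sum_(m <- s) inner (a m) (if b m is Some k then pderiv k psi else psi).
  by rewrite (H _ tp) subr0.
rewrite -sumrB mulr_suml.
apply: le_trans (ler_norm_sum _ _ _) _; apply: ler_sum => m _.
case: (b m) => [k|]; rewrite -innerBr//.
  apply: le_trans (inner_CS mOm (aL m) (L2B mOm (pL k) (dL k))) _.
  by apply: ler_wpM2l; [exact: L2norm_ge0|exact: pe].
apply: le_trans (inner_CS mOm (aL m) (L2B mOm uL psiL)) _.
by apply: ler_wpM2l; [exact: L2norm_ge0|exact: ue].
Qed.

Lemma H10_weak u p k : H10_data u p -> weak [:: k] u (p k).
Proof.
move=> up psi tp; have [uL pL _] := up.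
have pdL := L2_test oOm bOm (test_pderiv k tp); have psiL := L2_test oOm bOm tp.
have K := @H10_ind bool [:: true; false] u p (fun b => if b then pderiv k psi else psi)
  (fun b => if b then None else Some k) up.
have K1 (m : bool) : L2 (if m then pderiv k psi else psi) by case: m.
have := K K1 _; rewrite !big_cons big_nil /= addr0 => {}K.
have {K} : inner (pderiv k psi) u + inner psi (p k) = 0.
  apply: K => eta te.
  rewrite !big_cons big_nil /= addr0 innerC (test_weak oOm bOm k te tp) expr1 mulN1r.
  by rewrite (innerC _ psi) addNr.
rewrite expr1 mulN1r (innerC _ u) (innerC _ psi (p k)).
by move/eqP; rewrite addr_eq0 => /eqP.
Qed.

Lemma H10D u p v r : H10_data u p -> H10_data v r -> H10_data (u \+ v) (fun k => p k \+ r k).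
Proof.
move=> [uL pL up] [vL rL vr]; split; first exact: L2D.
  by move=> k; exact: L2D.
move=> e e0; have e20 : 0 < e / 2 by lra.
have [psi [tp a1 a2]] := up _ e20; have [eta [te b1 b2]] := vr _ e20.
have psiL := L2_test oOm bOm tp; have dpL k := L2_test oOm bOm (test_pderiv k tp).
have etaL := L2_test oOm bOm te; have deL k := L2_test oOm bOm (test_pderiv k te).
exists (psi \+ eta); split; first exact: testD.
  rewrite (@L2norm_eq _ _ _ _ ((u \- psi) \+ (v \- eta))); last by move=> x _ /=; ring.
  have := L2normD_le mOm (L2B mOm uL psiL) (L2B mOm vL etaL).
  by move: a1 b1; move: (L2norm _) (L2norm _) (L2norm _) => x y z; lra.
move=> k; rewrite pderivD; [|exact: (smooth_derivable (test_smooth tp))|exact: (smooth_derivable (test_smooth te))].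
rewrite (@L2norm_eq _ _ _ _ ((p k \- pderiv k psi) \+ (r k \- pderiv k eta))); last by move=> x _ /=; ring.
have := L2normD_le mOm (L2B mOm (pL k) (dpL k)) (L2B mOm (rL k) (deL k)).
by move: (a2 k) (b2 k); move: (L2norm _) (L2norm _) (L2norm _) => x y z; lra.
Qed.

Lemma H10Z c u p : H10_data u p -> H10_data (c \*o u) (fun k => c \*o p k).
Proof.
move=> [uL pL up]; split; first exact: L2Z.
  by move=> k; exact: L2Z.
move=> e e0; have c0 : 0 < `|c| + 1 by rewrite ltr_wpDl.
have [|psi [tp a1 a2]] := up (e / (`|c| + 1)); first by rewrite divr_gt0.
have psiL := L2_test oOm bOm tp; have dpL k := L2_test oOm bOm (test_pderiv k tp).
have K w f : L2 w -> L2 f -> L2norm (w \- f) <= e / (`|c| + 1) -> L2norm ((c \*o w) \- (c \*o f)) <= e.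
  move=> wL fL; rewrite ler_pdivlMr// => H.
  rewrite (@L2norm_eq _ _ _ _ (c \*o (w \- f))); last by move=> x _ /=; ring.
  rewrite L2normZ//; last exact: L2B.
  have := L2norm_ge0 Om (w \- f); have := normr_ge0 c; move: H.
  by move: (L2norm _) `|c| => x y; nra.
exists (c \*o psi); split; [exact: testZ|exact: K|move=> k].
by rewrite pderivZ; [exact: K|exact: (smooth_derivable (test_smooth tp))].
Qed.

Lemma H10_ext u p v r : H10_data u p -> u = v -> (forall k, p k = r k) -> H10_data v r.
Proof. by move=> up <- pr; have -> : r = p by apply/funext => k; rewrite pr. Qed.

Lemma H10_test psi : test psi -> H10_data psi (fun k => pderiv k psi).
Proof.
move=> tp; split; [exact: (L2_test oOm bOm tp)|by move=> k; exact: (L2_test oOm bOm (test_pderiv k tp))|].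
move=> e e0; exists psi; split=> // [|k].
- rewrite (@L2norm_eq _ _ _ _ (fun=> 0)) ?(L2norm0 mOm) ?ltW// => x _ /=; exact: subrr.
- rewrite (@L2norm_eq _ _ _ _ (fun=> 0)) ?(L2norm0 mOm) ?ltW// => x _ /=; exact: subrr.
Qed.

Lemma H2D u p q v r (q' : 'I_n -> 'I_n -> 'rV[R]_n -> R) : H2_data u p q -> H2_data v r q' ->
  H2_data (u \+ v) (fun k => p k \+ r k) (fun i j => q i j \+ q' i j).
Proof.
move=> [up qL wq] [vr qL' wq']; have [_ pL _] := up; have [_ rL _] := vr; split.
- exact: H10D.
- by move=> i j; exact: L2D.
- by move=> i j; exact: (weakD oOm bOm (pL i) (rL i) (qL i j) (qL' i j) (wq i j) (wq' i j)).
Qed.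

Lemma H2Z c u p q : H2_data u p q ->
  H2_data (c \*o u) (fun k => c \*o p k) (fun i j => c \*o q i j).
Proof.
move=> [up qL wq]; have [_ pL _] := up; split.
- exact: H10Z.
- by move=> i j; exact: L2Z.
- by move=> i j; exact: (weakZ oOm bOm c (pL i) (qL i j) (wq i j)).
Qed.

Lemma H2_0 : H2_data (fun=> 0) (fun _ _ => 0) (fun _ _ _ => 0).
Proof.
have E k : pderiv k ((fun=> 0) : 'rV[R]_n -> R) = fun=> 0 by exact: pderiv_cst.
split.
- by apply: H10_ext (H10_test (test0 Om)) _ _.
- by move=> i j; exact: L2_0.
- by move=> i j psi tp; rewrite !inner0l mulr0.
Qed.

Lemma H2_sum (N : nat) (c : nat -> R) (U : nat -> 'rV[R]_n -> R)
    (P : nat -> 'I_n -> 'rV[R]_n -> R) (Q : nat -> 'I_n -> 'I_n -> 'rV[R]_n -> R) :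
  (forall m, H2_data (U m) (P m) (Q m)) ->
  H2_data (fun x => \sum_(m < N) c m * U m x) (fun k x => \sum_(m < N) c m * P m k x)
    (fun i j x => \sum_(m < N) c m * Q m i j x).
Proof.
move=> H; elim: N => [|N IH].
  have := H2_0; congr H2_data; do ?[apply/funext => ?]; by rewrite big_ord0.
have := H2D IH (H2Z (c N) (H N)); congr H2_data; do ?[apply/funext => ?];
  by rewrite big_ord_recr.
Qed.

Lemma H2B u p q v r (q' : 'I_n -> 'I_n -> 'rV[R]_n -> R) : H2_data u p q -> H2_data v r q' ->
  H2_data (u \- v) (fun k => p k \- r k) (fun i j => q i j \- q' i j).
Proof.
move=> H1 /(H2Z (-1)) H2; have := H2D H1 H2.
by congr H2_data; do ?[apply/funext => ?]; rewrite /= mulN1r.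
Qed.

Lemma H2_weak2 u p q i j psi : H2_data u p q -> test psi ->
  inner u (pderiv i (pderiv j psi)) = inner (q i j) psi.
Proof.
move=> [up qL wq] tp; rewrite (H10_weak i up (test_pderiv j tp)) (wq i j _ tp) expr1; ring.
Qed.

Lemma H2_sym u p q i j : H2_data u p q -> q i j = q j i %[ae leb in Om].
Proof.
move=> H; have [_ qL _] := H; apply: (density0_ae oOm bOm) => // psi tp.
by rewrite -(H2_weak2 i j H tp) -(H2_weak2 j i H tp) (pderivC i j (test_smooth tp)).
Qed.

Lemma green u p q v r : H2_data u p q -> H10_data v r ->
  inner (lap q) v = - \sum_k inner (p k) (r k).
Proof.
move=> [up qL wq] vr; have [_ pL _] := up; have [vL rL _] := vr.
rewrite inner_suml// -sumrN; apply: eq_bigr => k _.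
have K := @H10_ind bool [:: true; false] v r (fun b => if b then q k k else p k)
  (fun b => if b then None else Some k) vr.
have K1 (m : bool) : L2 (if m then q k k else p k) by case: m.
have := K K1 _; rewrite !big_cons big_nil /= addr0 => {}K.
have {K} : inner (q k k) v + inner (p k) (r k) = 0.
  apply: K => eta te.
  by rewrite !big_cons big_nil /= addr0 (wq k k _ te) expr1 mulN1r addrN.
by move/eqP; rewrite addr_eq0 => /eqP.
Qed.

Lemma H2_gradient u p q : H2_data u p q ->
  \sum_k L2norm (p k) ^+ 2 = - inner (lap q) u.
Proof.
move=> H; have [up _ _] := H; have [_ pL _] := up.
by rewrite (green H up) opprK; apply: eq_bigr => k _; rewrite L2norm2.
Qed.

Lemma wderiv_le_sobolev_norm (N : nat) u (s : seq 'I_n) : (size s <= N)%N ->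
  L2norm (wderiv Om s u) <= sobolev_norm Om N u.
Proof.
move=> sN; rewrite -(ger0_norm (L2norm_ge0 _ _)) -sqrtr_sqr /sobolev_norm ler_wsqrtr//.
have sN1 : (size s < N.+1)%N by [].
rewrite (bigD1 (Ordinal sN1))//= (bigD1 (in_tuple s))//= -addrA lerDl.
by rewrite addr_ge0//; apply: sumr_ge0 => ? _; [|apply: sumr_ge0 => ? _]; exact: sqr_ge0.
Qed.

Lemma sobolev_norm_le (N : nat) : exists2 C, 0 <= C & forall u c, 0 <= c ->
  (forall s : seq 'I_n, (size s <= N)%N -> L2norm (wderiv Om s u) <= c) ->
  sobolev_norm Om N u <= C * c.
Proof.
exists (Num.sqrt (\sum_(j < N.+1) \sum_(s : j.-tuple 'I_n) 1)); first exact: sqrtr_ge0.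
move=> u c c0 H; rewrite -[c in _ * c](ger0_norm c0) -sqrtr_sqr -sqrtrM; last first.
  by apply: sumr_ge0 => j _; apply: sumr_ge0.
apply: ler_wsqrtr; rewrite mulr_suml; apply: ler_sum => j _.
rewrite mulr_suml; apply: ler_sum => s _; rewrite mul1r.
by rewrite lerXn2r ?nnegrE ?L2norm_ge0//; apply: H; rewrite size_tuple -ltnS.
Qed.

(** With [H2_sobolev] as converse, this moves between the spaces of the theorem and explicit
    derivative data. *)
Lemma sobolev_H2 u : sobolev Om 2 u -> sobolev10 Om u ->
  H2_data u (fun k => wderiv Om [:: k] u) (fun i j => wderiv Om [:: i; j] u).
Proof.
move=> [uL su] [_ s10].
have W s : (size s <= 2)%N -> L2 (wderiv Om s u) /\ weak s u (wderiv Om s u).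
  by move=> /su[v [vL wv]]; have [? ? _] := wderivP oOm bOm vL wv.
split.
- split=> // [k|e e0]; first exact: (W [:: k] isT).1.
  have [psi [tp pe]] := s10 e e0; exists psi; have psiL := L2_test oOm bOm tp.
  have dL k := L2_test oOm bOm (test_pderiv k tp).
  split=> // [|k].
    rewrite -(wderiv_norm oOm bOm (L2B mOm uL psiL) (weak_nil (u \- psi))).
    by apply: le_trans (ltW pe); exact: wderiv_le_sobolev_norm.
  have [wL ww] := W [:: k] isT.
  rewrite -(wderiv_norm oOm bOm (L2B mOm wL (dL k)) (weakB oOm bOm uL psiL wL (dL k) ww (test_weak oOm bOm k tp))).
  by apply: le_trans (ltW pe); exact: wderiv_le_sobolev_norm.
- by move=> i j; exact: (W [:: i; j] isT).1.
- move=> i j psi tp; have [_ w1] := W [:: i] isT; have [_ w2] := W [:: i; j] isT.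
  have := w1 _ (test_pderiv j tp); rewrite [inner u _](w2 _ tp) /=.
  rewrite !expr1 sqrrN expr1n mul1r => ->; ring.
Qed.

Lemma H2_wderiv u p q : H2_data u p q -> forall s : seq 'I_n, (size s <= 2)%N ->
  exists v, [/\ L2 v, weak s u v & [\/ v = u, exists k, v = p k | exists i j, v = q i j]].
Proof.
move=> H; have [up qL wq] := H; have [uL pL _] := up.
case=> [|i [|j [|]]]//= _.
- by exists u; split=> //; [exact: weak_nil|constructor 1].
- by exists (p i); split=> //; [exact: H10_weak|constructor 2; exists i].
- exists (q i j); split=> //; last by constructor 3; exists i, j.
  by move=> psi tp; rewrite sqrrN expr1n mul1r; exact: H2_weak2 H tp.
Qed.

Lemma H2_sobolev u p q : H2_data u p q ->
  sobolev Om 2 u /\ sobolev10 Om u.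
Proof.
move=> H; have [up qL wq] := H; have [uL pL approx] := up.
have W s : (size s <= 2)%N -> exists v, L2 v /\ weak s u v.
  by move=> /(H2_wderiv H)[v [vL wv _]]; exists v.
split; first by split.
split; first by split=> // s s1; apply: W; exact: leq_trans s1 _.
move=> e e0; have [C C0 HC] := sobolev_norm_le 1.
have C1 : 0 < C + 1 by lra.
have [|psi [tp a1 a2]] := approx (e / 2 / (C + 1)); first by rewrite divr_gt0//; lra.
have psiL := L2_test oOm bOm tp; have dL k := L2_test oOm bOm (test_pderiv k tp).
exists psi; split=> //; apply: (@le_lt_trans _ _ (C * (e / 2 / (C + 1)))).
  apply: HC; first by rewrite !divr_ge0//; lra.
  case=> [|k [|]]//= _.
    by rewrite (wderiv_norm oOm bOm (L2B mOm uL psiL) (weak_nil (u \- psi))).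
  rewrite (wderiv_norm oOm bOm (L2B mOm (pL k) (dL k)))//.
  by apply: weakB => //; [exact: H10_weak|exact: test_weak].
rewrite mulrA ltr_pdivrMr//; nra.
Qed.

Lemma H2_laplacian u p q : H2_data u p q -> laplacian Om u = lap q %[ae leb in Om].
Proof.
move=> H; have [_ qL _] := H.
have W k : wderiv Om [:: k; k] u = q k k %[ae leb in Om].
  have w2 : weak [:: k; k] u (q k k).
    by move=> psi tp; rewrite sqrrN expr1n mul1r; exact: H2_weak2 H tp.
  by have [_ _] := wderivP oOm bOm (qL k k) w2.
have : \forall x \ae leb, forall k, Om x -> wderiv Om [:: k; k] u x = q k k x.
  by apply: filter_forall => k; exact: W.
by apply: filterS => x Hx Ox; apply: eq_bigr => k _; exact: Hx.
Qed.

Lemma H2_sobolev_norm_le : exists2 C, 0 <= C & forall u p q c, H2_data u p q -> 0 <= c ->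
  L2norm u <= c -> (forall k, L2norm (p k) <= c) -> (forall i j, L2norm (q i j) <= c) ->
  sobolev_norm Om 2 u <= C * c.
Proof.
have [C C0 HC] := sobolev_norm_le 2; exists C => // u p q c H c0 uc pc qc.
apply: HC => // s /(H2_wderiv H)[v [vL wv vE]].
by rewrite (wderiv_norm oOm bOm vL wv); case: vE => [->|[k ->]|[i [j ->]]].
Qed.

End sobolev_data.

(** * The Rellich identity *)

Section tangential_fields.
Context {R : realType} {n : nat}.
Variable Om : set 'rV[R]_n.
Hypotheses (oOm : open Om) (bOm : bounded_set Om) (dense : tests_dense Om).
Implicit Types (u v w f psi a : 'rV[R]_n -> R) (p G : 'I_n -> 'rV[R]_n -> R)
  (q : 'I_n -> 'I_n -> 'rV[R]_n -> R) (i j k l : 'I_n) (c : R) (al : 'I_n -> 'rV[R]_n -> R).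

Local Notation L2 := (L2 Om).
Local Notation inner := (inner Om).
Local Notation L2norm := (L2norm Om).
Local Notation test := (test_function Om).
Local Notation weak := (weak_derivative Om).
Local Notation gradnorm := (gradnorm Om).
Local Notation H2_data := (H2_data Om).
Local Notation H10_data := (H10_data Om).

Let mOm : measurable Om := open_measurable_rV oOm.
#[local] Hint Resolve mOm : core.

Definition divergence al : 'rV[R]_n -> R := fun x => \sum_l pderiv l (al l) x.

(* No boundary term appears when integrating by parts along the field al. *)
Definition tangential al : Prop := forall v G, L2 v -> (forall k, L2 (G k)) ->
  (forall k, weak [:: k] v (G k)) ->
  2 * \sum_l inner (al l \* v) (G l) = - inner (divergence al \* v) v.

Definition field al p : 'rV[R]_n -> R := fun x => \sum_l al l x * p l x.

Lemma smooth_divergence al : (forall l, smooth (al l)) -> smooth (divergence al).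
Proof. by move=> sal; apply: smooth_sum => l; exact: smooth_pderiv. Qed.

(** Polarization of the quadratic identity defining [tangential], applied to [v + v']. In [rellich]
    the two functions are matching components of two gradients. *)
Lemma tangential_polar al v G v' (G' : 'I_n -> 'rV[R]_n -> R) :
  (forall l, smooth (al l)) -> tangential al ->
  L2 v -> (forall k, L2 (G k)) -> (forall k, weak [:: k] v (G k)) ->
  L2 v' -> (forall k, L2 (G' k)) -> (forall k, weak [:: k] v' (G' k)) ->
  \sum_l (inner (al l \* v) (G' l) + inner (al l \* v') (G l)) =
  - inner (divergence al \* v) v'.
Proof.
move=> sal tal vL GL wG vL' GL' wG'.
have sd := smooth_divergence sal.
have alv l w : L2 w -> L2 (al l \* w) := @L2_smoothM _ _ _ oOm bOm _ w (sal l).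
have dv w : L2 w -> L2 (divergence al \* w) := @L2_smoothM _ _ _ oOm bOm _ w sd.
have := tal (v \+ v') (fun k => G k \+ G' k) (L2D mOm vL vL') (fun k => L2D mOm (GL k) (GL' k))
  (fun k => weakD oOm bOm vL vL' (GL k) (GL' k) (wG k) (wG' k)).
have Dd w w' : divergence al \* (w \+ w') = (divergence al \* w) \+ (divergence al \* w').
  by apply/funext => x /=; ring.
have Da l w w' : al l \* (w \+ w') = (al l \* w) \+ (al l \* w').
  by apply/funext => x /=; ring.
rewrite Dd innerDl ?innerDr//; try by [exact: dv|exact: L2D].
have -> : \sum_l inner (al l \* (v \+ v')) (G l \+ G' l) =
    \sum_l inner (al l \* v) (G l) + \sum_l inner (al l \* v') (G' l) +
    \sum_l (inner (al l \* v) (G' l) + inner (al l \* v') (G l)).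
  rewrite -!big_split/=; apply: eq_bigr => l _.
  rewrite Da innerDl ?innerDr//; try by [exact: alv|exact: L2D]. 
  ring.
have S : inner (divergence al \* v') v = inner (divergence al \* v) v'.
  by rewrite inner_mulA innerC.
have := tal v G vL GL wG; have := tal v' G' vL' GL' wG'; rewrite S.
move: (\sum_l _) (\sum_l _) (\sum_l _) (inner _ _) (inner _ _) (inner _ _) => A B C D E F.
by lra.
Qed.

Lemma tangential_test al : (forall l, test (al l)) -> tangential al.
Proof.
move=> tal v G vL GL wG.
have E : inner (divergence al \* v) v = \sum_l inner (pderiv l (al l) \* v) v.
  rewrite -inner_suml//; last by move=> l; exact: (L2_smoothM oOm bOm (smooth_pderiv l (test_smooth (tal l))) vL).
  by apply: inner_eq => // x _; rewrite /divergence /= mulr_suml.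
rewrite E mulr_sumr -sumrN; apply: eq_bigr => l _.
exact: (weak_product_rule oOm bOm dense vL (GL l) (wG l) (tal l)).
Qed.

Lemma pderiv_off (K : set 'rV[R]_n) f k x : closed K -> (forall y, ~ K y -> f y = 0) ->
  ~ K x -> pderiv k f x = 0.
Proof.
move=> cK f0 Kx.
have : \forall y \near x, f y = (fun=> 0) y.
  by apply: filterS (open_nbhs_nbhs (conj (closed_openC cK) Kx)) => y /f0.
move=> /(near_eq_derive (delta_mx ord0 k)); rewrite /pderiv => ->; exact: derive_cst.
Qed.

Lemma closed_ge_smooth (m : nat) (rho : 'rV[R]_n -> R) : smooth rho ->
  closed [set x : 'rV[R]_n | 1 <= m.+1%:R * rho x].
Proof.
move=> sr; rewrite (_ : [set x : 'rV[R]_n | _] = (m.+1%:R \*o rho) @^-1` [set t | 1 <= t])//.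
apply: preimage_closed; last exact: closed_ge.
by move=> x _; exact: (@smooth_continuous R n _ (smoothZ m.+1%:R sr) x).
Qed.

Lemma cvg_scale_sub1 (t : R) : 0 < t -> m.+1%:R * t - 1 @[m --> \oo] --> +oo.
Proof.
move=> t0; apply/cvgryPge => A.
near=> m; rewrite lerBrDr -ler_pdivrMr//.
apply: le_trans (_ : m%:R <= _); last by rewrite ler_nat.
by near: m; exact: nbhs_infty_ger.
Unshelve. all: by end_near. Qed.

(* The cutoffs expinv (m rho - 1) have compact support in Om near the boundary, and al does not
   differentiate them. *)
Lemma tangential_boundary al (rho : 'rV[R]_n -> R) (K : set 'rV[R]_n) :
  (forall l, smooth (al l)) -> smooth rho -> compact K ->
  (forall l x, ~ K x -> al l x = 0) -> (forall x, K x -> Om x <-> 0 < rho x) ->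
  (forall x, \sum_l al l x * pderiv l rho x = 0) -> tangential al.
Proof.
move=> sal sr cK al0 KO Xr v G vL GL wG.
have clK : closed K by exact: compact_closed.
(* The shift by 1 makes the cutoff vanish where [rho <= 1/(m+1)], so that [chi m \* al l] has
   compact support in the domain. *)
pose chi m x := expinv (m.+1%:R * rho x - 1).
have sl m : smooth (fun x => m.+1%:R * rho x - 1).
  by apply: smoothB; [exact: smoothZ|exact: smooth_cst].
have schi m : smooth (chi m) by exact: (smooth_comp1 smooth1_expinv (sl m)).
have tm m l : test (chi m \* al l).
  apply/test_functionP; split; first exact: (smoothM (schi m) (sal l)).
  exists (K `&` [set x | 1 <= m.+1%:R * rho x]); split.
  - apply: (subclosed_compact _ cK); last by move=> x [].
    have C2 := @closed_ge_smooth m _ sr; apply: closedI; [exact: clK|exact: C2].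
  - move=> x [Kx /= H]; apply/(KO _ Kx).
    have m0 : 0 < m.+1%:R :> R by rewrite ltr0n.
    by rewrite -(pmulr_rgt0 _ m0); apply: lt_le_trans H.
  - move=> x H /=; have [Kx|/al0 ->] := pselect (K x); last by rewrite mulr0.
    rewrite /chi expinv_eq0 ?mul0r// subr_le0 leNgt; apply/negP => /ltW H1.
    by apply: H; split.
have id m := tangential_test (tm m) vL GL wG.
(* The extra term is a multiple of the derivative of [rho] along [al], which is 0. Otherwise it
   would carry a factor of order [m] and spoil the limit. *)
have dchi m : divergence (fun l => chi m \* al l) = chi m \* divergence al.
  apply/funext => x; rewrite /divergence /= mulr_sumr.
  have Dchi l : pderiv l (chi m) = (derive1 expinv \o (fun x => m.+1%:R * rho x - 1)) \*
      (m.+1%:R \*o pderiv l rho).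
    have -> : chi m = expinv \o (fun x => m.+1%:R * rho x - 1) by [].
    rewrite pderiv_comp1; [|exact: smooth1_derivable smooth1_expinv|exact: (smooth_derivable (sl m))].
    congr (_ \* _); rewrite (_ : (fun x => _) = (m.+1%:R \*o rho) \- (fun=> 1))//.
    rewrite pderivB; [|exact: (smooth_derivable (smoothZ _ sr))|exact: (smooth_derivable (smooth_cst 1))].
    rewrite pderivZ; last exact: (smooth_derivable sr).
    by rewrite pderiv_cst; apply/funext => y /=; rewrite subr0.
  have -> : \sum_l pderiv l (chi m \* al l) x = \sum_l chi m x * pderiv l (al l) x +
      derive1 expinv (m.+1%:R * rho x - 1) * m.+1%:R * \sum_l al l x * pderiv l rho x.
    rewrite mulr_sumr -big_split/=; apply: eq_bigr => l _.
    rewrite pderivM; [|exact: (smooth_derivable (schi m))|exact: (smooth_derivable (sal l))].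
    by rewrite Dchi /=; ring.
  by rewrite Xr mulr0 addr0.
have cf f : smooth f -> (forall x, ~ K x -> f x = 0) -> forall w, L2 w -> forall w', L2 w' ->
    inner ((chi m \* f) \* w) w' @[m --> \oo] --> inner (f \* w) w'.
  move=> sf f0 w wL w' wL'.
  have [C C0 HC] := bounded_on_bounded bOm (smooth_continuous sf).
  apply: (inner_dominated mOm (c := C)) => //.
  - move=> m; exact: (continuous_measurable_on (smooth_continuous (smoothM (schi m) sf))).
  - exact: (continuous_measurable_on (smooth_continuous sf)).
  - move=> m x Ox /=; rewrite normrM ger0_norm ?expinv_ge0//.
    apply: le_trans (HC _ Ox); rewrite -[leRHS]mul1r ler_wpM2r//; exact: expinv_le1.
  - move=> x Ox; have [Kx|/f0 fx0] := pselect (K x); last first.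
      by rewrite fx0; apply: cvg_near_cst; apply: nearW => m; rewrite /= fx0 mulr0.
    have rx : 0 < rho x by apply/(KO _ Kx).
    rewrite -[f x in X in _ --> X]mul1r; apply: cvgMr_tmp; exact: expinv_cvg1 (cvg_scale_sub1 rx).
have L1 : 2 * \sum_l inner ((chi m \* al l) \* v) (G l) @[m --> \oo] -->
    2 * \sum_l inner (al l \* v) (G l).
  apply: cvgMl_tmp; apply: (cvg_big add_continuous) => l _; exact: cf (sal l) (al0 l) _ vL _ (GL l).
have L2' : - inner ((chi m \* divergence al) \* v) v @[m --> \oo] --> - inner (divergence al \* v) v.
  apply: cvgN; apply: cf => //; first exact: smooth_divergence.
  move=> x Kx; rewrite /divergence big1// => l _.
  by apply: (pderiv_off l clK _ Kx) => y; exact: al0.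
apply: (cvg_unique _ L1) => //.
have -> : (fun m => 2 * \sum_l inner ((chi m \* al l) \* v) (G l)) =
    (fun m => - inner ((chi m \* divergence al) \* v) v).
  by apply/funext => m; rewrite id dchi.
exact: L2'.
Qed.

(** For a test function in place of [u], moving the derivative off [r k] in direction [k] on the
    left, or in direction [l] on the right, leaves the pairing of [r k] with the same mixed
    derivative of [u]. The resulting identity involves only first derivatives of [u], so it extends
    to H^1_0. *)
Lemma rellich_term a k l u p v r q : smooth a -> H10_data u p -> H2_data v r q ->
  inner (a \* p l) (q k k) = - inner (pderiv k a \* p l) (r k) +
    inner (a \* p k) (q k l) + inner (pderiv l a \* p k) (r k).
Proof.
move=> sa up [vr qL wq]; have [_ rL _] := vr; have [_ pL _] := up.
have sda j := smooth_pderiv j sa.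
have aL w : L2 w -> L2 (a \* w) := @L2_smoothM _ _ _ oOm bOm a w sa.
have daL j w : L2 w -> L2 (pderiv j a \* w) := @L2_smoothM _ _ _ oOm bOm _ w (sda j).
pose A := (a \* q k k) \+ (pderiv k a \* r k).
pose B := (a \* q k l) \+ (pderiv l a \* r k).
have AL : L2 A by apply: L2D; [|exact: aL|exact: daL].
have BL : L2 B by apply: L2D; [|exact: aL|exact: daL].
have K := @H10_ind _ _ _ oOm bOm bool [:: true; false] u p (fun b => if b then A else \- B)
  (fun b => if b then Some l else Some k) up.
have K1 (m : bool) : L2 (if m then A else \- B) by case: m => //; exact: L2N.
have {K} : inner A (p l) + inner (\- B) (p k) = 0.
  have E2 (X : bool -> R) : \sum_(m <- [:: true; false]) X m = X true + X false.
    by rewrite !big_cons big_nil addr0.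
  have := K K1; rewrite !E2 => -> // psi tp; rewrite E2.
  have sp := test_smooth tp; have dpL j := L2_test oOm bOm (test_pderiv j tp).
  have parts i j : inner (a \* q k i) (pderiv j psi) + inner (pderiv i a \* r k) (pderiv j psi) =
      - inner (r k) (a \* pderiv i (pderiv j psi)).
    have tj := test_pderiv j tp; have := wq k i _ (testM sa tj).
    rewrite /= pderivM; [|exact: (smooth_derivable sa)|exact: (smooth_derivable (test_smooth tj))].
    rewrite expr1 mulN1r (innerDr mOm (aL _ (L2_test oOm bOm (test_pderiv i tj)))
      (L2_smoothM oOm bOm (test_smooth tj) (L2_smooth oOm bOm (sda i))) (rL k)).
    have -> : inner (pderiv i a \* r k) (pderiv j psi) = inner (r k) (pderiv j psi \* pderiv i a).
      by apply: eq_Rintegral => x _ /=; ring.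
    have -> : inner (a \* q k i) (pderiv j psi) = inner (q k i) (a \* pderiv j psi).
      by apply: eq_Rintegral => x _ /=; ring.
    by move: (inner _ _) (inner _ _) (inner _ _) => X Y Z; lra.
  rewrite (innerNl mOm BL (dpL k)) (innerDl mOm (aL _ (qL k k)) (daL k _ (rL k)) (dpL l)).
  rewrite (innerDl mOm (aL _ (qL k l)) (daL l _ (rL k)) (dpL k)).
  have Q : - inner (r k) (a \* pderiv k (pderiv l psi)) = - inner (r k) (a \* pderiv l (pderiv k psi)).
    by rewrite (pderivC l k sp).
  by apply/eqP; rewrite subr_eq0; apply/eqP; exact: (etrans (parts k l) (etrans Q (esym (parts l k)))).
rewrite (innerNl mOm BL (pL k)) (innerDl mOm (aL _ (qL k k)) (daL k _ (rL k)) (pL l)).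
rewrite (innerDl mOm (aL _ (qL k l)) (daL l _ (rL k)) (pL k)).
have sw b w w' : inner (b \* w) w' = inner (b \* w') w by rewrite inner_mulA innerC.
rewrite (sw a (q k k) (p l)) (sw _ (r k) (p l)) (sw a (q k l) (p k)) (sw _ (r k) (p k)).
by move: (inner _ _) (inner _ _) (inner _ _) (inner _ _) => X Y Z W; lra.
Qed.

Lemma field_bound0 al : (forall l, smooth (al l)) -> exists2 C, 0 <= C &
  forall p, (forall k, L2 (p k)) -> L2 (field al p) /\ L2norm (field al p) <= C * gradnorm p.
Proof.
move=> sal.
have /choice[c cP] : forall l, exists c, 0 <= c /\
    forall w, L2 w -> L2 (al l \* w) /\ L2norm (al l \* w) <= c * L2norm w.
  by move=> l; have [c c0 H] := smooth_mul_bounded oOm bOm (sal l); exists c.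
exists (\sum_l c l); first by apply: sumr_ge0 => l _; exact: (cP l).1.
move=> p pL.
have aL l : L2 (al l \* p l) by exact: ((cP l).2 _ (pL l)).1.
split; first exact: (L2_sum mOm _ _ aL).
apply: le_trans (L2norm_sum mOm _ _ aL) _; rewrite mulr_suml; apply: ler_sum => l _.
apply: le_trans ((cP l).2 _ (pL l)).2 _; apply: ler_wpM2l; first exact: (cP l).1.
exact: L2norm_le_gradnorm.
Qed.

(* Symmetrizing [rellich_term] in [u] and [v] leaves a derivative along [al] of the product of the
   gradients, which [tangential_polar] turns into lower-order terms. *)
Lemma rellich al : (forall l, smooth (al l)) -> tangential al ->
  exists2 C, 0 <= C & forall u p q v r (q' : 'I_n -> 'I_n -> 'rV[R]_n -> R),
    H2_data u p q -> H2_data v r q' ->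
    `|inner (field al p) (lap q')| <= C * (L2norm (lap q) + gradnorm p) * gradnorm r.
Proof.
move=> sal tal.
have [C0 C00 HC0] := field_bound0 sal.
have sdal k l := smooth_pderiv k (sal l).
have /choice[d dP] : forall kl : 'I_n * 'I_n, exists c, 0 <= c /\
    forall w, L2 w -> L2 (pderiv kl.1 (al kl.2) \* w) /\
      L2norm (pderiv kl.1 (al kl.2) \* w) <= c * L2norm w.
  move=> kl; have [c c0 H] := smooth_mul_bounded oOm bOm (sdal kl.1 kl.2); by exists c.
have d0 k l : 0 <= d (k, l) by exact: (dP (k, l)).1.
(* For each pair [(k, l)] the sum [S] below has two terms with [pderiv k (al l)] and three with
   [pderiv l (al l)]. *)
pose C1 := \sum_k \sum_l (2 * d (k, l) + 3 * d (l, l)).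
have C10 : 0 <= C1 by apply: sumr_ge0 => k _; apply: sumr_ge0 => l _; rewrite addr_ge0// mulr_ge0.
exists (C0 + C1); first exact: addr_ge0.
move=> u p q v r q' H H'.
have [up qL wq] := H; have [_ pL _] := up; have [vr qL' wq'] := H'; have [_ rL _] := vr.
have N0 := gradnorm_ge0 Om p; have N0' := gradnorm_ge0 Om r.
have aL l w : L2 w -> L2 (al l \* w) := @L2_smoothM _ _ _ oOm bOm _ w (sal l).
have daL k l w : L2 w -> L2 (pderiv k (al l) \* w) := @L2_smoothM _ _ _ oOm bOm _ w (sdal k l).
have E p1 (q1 : 'I_n -> 'I_n -> 'rV[R]_n -> R) : (forall k, L2 (p1 k)) -> (forall i j, L2 (q1 i j)) ->
    inner (field al p1) (lap q1) = \sum_k \sum_l inner (al l \* p1 l) (q1 k k).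
  move=> pL1 qL1; rewrite (inner_sumr mOm _ _ (fun k => qL1 k k) (HC0 _ pL1).1).
  apply: eq_bigr => k _; exact: (inner_suml mOm _ _ (fun l => aL l _ (pL1 l)) (qL1 k k)).
(* Tangentiality enters here, applied to [p k] and [r k], whose weak gradients are rows of the
   Hessians. It removes all second derivatives from the symmetrized expression. *)
have P k : \sum_l (inner (al l \* p k) (q' k l) + inner (al l \* r k) (q k l)) =
    - inner (divergence al \* p k) (r k).
  by apply: tangential_polar.
have Ediv k : inner (divergence al \* p k) (r k) = \sum_l inner (pderiv l (al l) \* p k) (r k).
  rewrite -(inner_suml mOm)//; last by move=> l; exact: daL.
  by apply: inner_eq => // x _; rewrite /divergence /= mulr_suml.
have S : inner (field al p) (lap q') + inner (field al r) (lap q) =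
    \sum_k \sum_l (- inner (pderiv k (al l) \* p l) (r k) + inner (pderiv l (al l) \* p k) (r k)
      - inner (pderiv k (al l) \* r l) (p k) + inner (pderiv l (al l) \* r k) (p k)
      - inner (pderiv l (al l) \* p k) (r k)).
  rewrite !E// -big_split/=; apply: eq_bigr => k _.
  have -> : \sum_l (- inner (pderiv k (al l) \* p l) (r k) + inner (pderiv l (al l) \* p k) (r k)
      - inner (pderiv k (al l) \* r l) (p k) + inner (pderiv l (al l) \* r k) (p k)
      - inner (pderiv l (al l) \* p k) (r k)) =
    \sum_l (- inner (pderiv k (al l) \* p l) (r k) + inner (pderiv l (al l) \* p k) (r k)
      - inner (pderiv k (al l) \* r l) (p k) + inner (pderiv l (al l) \* r k) (p k)) +
    \sum_l (inner (al l \* p k) (q' k l) + inner (al l \* r k) (q k l)).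
    by rewrite P Ediv -sumrB.
  rewrite -!big_split/=; apply: eq_bigr => l _.
  rewrite (rellich_term k l (sal l) up H') (rellich_term k l (sal l) vr H).
  by move: (inner _ _) (inner _ _) (inner _ _) (inner _ _) (inner _ _) (inner _ _) => a1 a2 a3 a4 a5 a6; ring.
have B1 : `|inner (field al p) (lap q') + inner (field al r) (lap q)| <= C1 * (gradnorm p * gradnorm r).
  rewrite S /C1 mulr_suml; apply: le_trans (ler_norm_sum _ _ _) _; apply: ler_sum => k _.
  rewrite mulr_suml; apply: le_trans (ler_norm_sum _ _ _) _; apply: ler_sum => l _.
  have T k' l' w w' (c c' : R) : L2 w -> L2 w' -> L2norm w <= c -> L2norm w' <= c' ->
      `|inner (pderiv k' (al l') \* w) w'| <= d (k', l') * (c * c').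
    move=> wL wL' wc wc'; apply: le_trans (inner_CS mOm (daL k' l' _ wL) wL') _.
    rewrite mulrA; apply: ler_pM; rewrite ?L2norm_ge0//.
    apply: le_trans ((dP (k', l')).2 _ wL).2 _; exact: ler_wpM2l.
  have Np := L2norm_le_gradnorm Om p; have Nr := L2norm_le_gradnorm Om r.
  have T1 := T k l (p l) (r k) _ _ (pL l) (rL k) (Np l) (Nr k).
  have T2 := T l l (p k) (r k) _ _ (pL k) (rL k) (Np k) (Nr k).
  have T3 := T k l (r l) (p k) _ _ (rL l) (pL k) (Nr l) (Np k).
  have T4 := T l l (r k) (p k) _ _ (rL k) (pL k) (Nr k) (Np k).
  rewrite (mulrC (gradnorm r)) in T3 T4.
  apply: le_trans (ler_normB _ _) _; apply: le_trans (lerD (ler_normD _ _) T2) _.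
  apply: le_trans (lerD (lerD (ler_normB _ _) T4) (lexx _)) _.
  apply: le_trans (lerD (lerD (lerD (ler_normD _ _) T3) (lexx _)) (lexx _)) _.
  rewrite normrN; apply: le_trans (lerD (lerD (lerD (lerD T1 T2) (lexx _)) (lexx _)) (lexx _)) _.
  by rewrite le_eqVlt; apply/orP; left; apply/eqP; ring.
(* The mirror term needs only Cauchy-Schwarz: the Laplacian in it is that of [u], which is allowed
   in the bound. *)
have B2 : `|inner (field al r) (lap q)| <= C0 * L2norm (lap q) * gradnorm r.
  have [fL fN] := HC0 _ rL.
  apply: le_trans (inner_CS mOm fL (L2_lap oOm qL)) _.
  by rewrite mulrAC ler_wpM2r// L2norm_ge0.
have : `|inner (field al p) (lap q')| <= C1 * (gradnorm p * gradnorm r) + C0 * L2norm (lap q) * gradnorm r.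
  rewrite -[X in `|X|](addrK (inner (field al r) (lap q))).
  by apply: le_trans (ler_normB _ _) _; exact: lerD.
move=> /le_trans; apply.
have Lq := L2norm_ge0 Om (lap q).
have X1 : 0 <= C0 * gradnorm p * gradnorm r by rewrite !mulr_ge0.
have X2 : 0 <= C1 * L2norm (lap q) * gradnorm r by rewrite !mulr_ge0.
rewrite -subr_ge0; apply: le_trans (addr_ge0 X1 X2) _.
by rewrite le_eqVlt; apply/orP; left; apply/eqP; ring.
Qed.

End tangential_fields.

(** * Eigenfunction expansions *)

Section spectrum.
Context {R : realType} {n : nat}.
Variables (Om : set 'rV[R]_n) (lam : nat -> R) (phi : nat -> 'rV[R]_n -> R).
Hypotheses (oOm : open Om) (bOm : bounded_set Om) (hphi : dirichlet_spectrum Om lam phi).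
Implicit Types (u v w f psi a : 'rV[R]_n -> R) (p G : 'I_n -> 'rV[R]_n -> R)
  (q : 'I_n -> 'I_n -> 'rV[R]_n -> R) (i j k l : 'I_n) (e : R) (al : 'I_n -> 'rV[R]_n -> R)
  (c : nat -> R).

Local Notation L2 := (L2 Om).
Local Notation inner := (inner Om).
Local Notation L2norm := (L2norm Om).
Local Notation test := (test_function Om).
Local Notation weak := (weak_derivative Om).
Local Notation gradnorm := (gradnorm Om).
Local Notation H2_data := (H2_data Om).

Let mOm : measurable Om := open_measurable_rV oOm.
#[local] Hint Resolve mOm : core.

Definition dphi (m : nat) k := wderiv Om [:: k] (phi m).
Definition d2phi (m : nat) i j := wderiv Om [:: i; j] (phi m).

Lemma phi_H2 m : H2_data (phi m) (dphi m) (d2phi m).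
Proof. by have [_ /(_ m)[s2 s1 _] _ _] := hphi; exact: (sobolev_H2 oOm bOm s2 s1). Qed.

Lemma phi_L2 m : L2 (phi m).
Proof. by have [[]] := phi_H2 m. Qed.

Lemma inner_phi (m m' : nat) : inner (phi m) (phi m') = (m == m')%:R.
Proof. by have [_ _ H _] := hphi; exact: H. Qed.

Lemma lam_le (m m' : nat) : (m <= m')%N -> lam m <= lam m'.
Proof. by have [[_ _ H _] _ _ _] := hphi; exact: H. Qed.

Lemma lam_gt0 (m : nat) : 0 < lam m.
Proof. by have [[H _ _ _] _ _ _] := hphi; apply: lt_le_trans H (lam_le _). Qed.

Lemma inner_lap_phi (m : nat) v : L2 v -> inner (lap (d2phi m)) v = - (lam m * inner (phi m) v).
Proof.
move=> vL; have [_ /(_ m)[_ _ ev] _ _] := hphi; have [_ qL _] := phi_H2 m.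
have LL := L2_lap oOm qL; have pL := phi_L2 m.
rewrite -[LHS]opprK -(innerNl mOm LL vL) -(innerZl mOm (lam m) pL vL); congr (- _).
exact: (inner_ae_eq mOm (L2N mOm LL) vL (L2Z mOm _ pL) vL ev (ae_eq_refl _ _ _)).
Qed.

Definition lincomb (N : nat) c : 'rV[R]_n -> R := fun x => \sum_(m < N) c m * phi m x.
Definition dlincomb (N : nat) c k : 'rV[R]_n -> R := fun x => \sum_(m < N) c m * dphi m k x.
Definition d2lincomb (N : nat) c i j : 'rV[R]_n -> R := fun x => \sum_(m < N) c m * d2phi m i j x.

Lemma lincomb_H2 N c : H2_data (lincomb N c) (dlincomb N c) (d2lincomb N c).
Proof. exact: (H2_sum oOm bOm N c phi_H2). Qed.

Lemma lincomb_L2 N c : L2 (lincomb N c).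
Proof. by have [[]] := lincomb_H2 N c. Qed.

Lemma inner_lincomb N c v : L2 v -> inner (lincomb N c) v = \sum_(m < N) c m * inner (phi m) v.
Proof.
move=> vL; have cL (m : 'I_N) := L2Z mOm (c m) (phi_L2 m).
rewrite (inner_suml mOm _ _ cL vL); apply: eq_bigr => m _; exact: (innerZl mOm (c m) (phi_L2 m) vL).
Qed.

Lemma inner_lincomb_phi N c (m : nat) : inner (lincomb N c) (phi m) = if (m < N)%N then c m else 0.
Proof.
rewrite (inner_lincomb _ _ (phi_L2 m)); case: ifPn => [mN|mN].
  rewrite (bigD1 (Ordinal mN))//= inner_phi eqxx mulr1 big1 ?addr0// => m' m'm.
  by rewrite inner_phi; case: eqP => [E|]; [case/eqP: m'm; exact: val_inj|rewrite mulr0].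
apply: big1 => m' _; rewrite inner_phi; case: eqP => [E|]; last by rewrite mulr0.
by move: mN; rewrite -E ltn_ord.
Qed.

Lemma inner_lap_lincomb N c v : L2 v ->
  inner (lap (d2lincomb N c)) v = - \sum_(m < N) c m * lam m * inner (phi m) v.
Proof.
move=> vL; have -> : lap (d2lincomb N c) = fun x => \sum_(m < N) c m * lap (d2phi m) x.
  apply/funext => x; rewrite /lap /d2lincomb exchange_big/=; apply: eq_bigr => m _.
  by rewrite mulr_sumr.
have LL (m : nat) : L2 (lap (d2phi m)) by have [_ qL _] := phi_H2 m; exact: (L2_lap oOm qL).
have cL (m : 'I_N) := L2Z mOm (c m) (LL m).
rewrite (inner_suml mOm _ _ cL vL) -sumrN; apply: eq_bigr => m _.
by rewrite (innerZl mOm (c m) (LL m) vL) (inner_lap_phi _ vL) -mulrA mulrN.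
Qed.

Lemma lincomb_approx w : L2 w -> forall e, 0 < e -> exists N0 : nat, forall N, (N0 <= N)%N ->
  L2norm (w \- lincomb N (fun m => inner w (phi m))) <= e.
Proof.
move=> wL e e0; have [_ _ _ /(_ w wL)/cvgrPdist_le/(_ e e0)[N0 _ H]] := hphi.
exists N0 => N NN; have := H N NN; rewrite /= sub0r normrN ger0_norm//; exact: L2norm_ge0.
Qed.

(** Finite combinations of eigenfunctions are dense by completeness, and each belongs to H^1_0,
    hence is an L^2 limit of test functions. *)
Lemma spectral_tests_dense : tests_dense Om.
Proof.
move=> f fL e e0; have e20 : 0 < e / 2 by rewrite divr_gt0.
have [N H] := lincomb_approx fL e20; have {}H := H N (leqnn N).
set c := fun m => inner f (phi m) in H.
have [[gL _ ap] _ _] := lincomb_H2 N c.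
have [psi [tp H1 _]] := ap _ e20; exists psi => //.
apply: le_trans (L2norm_tri mOm fL gL (L2_test oOm bOm tp)) _.
by rewrite [e in _ <= e]splitr lerD.
Qed.

(* The partial sums [w_N] of [w] satisfy
   [|grad w_N|^2 = - <w_N, lap w_N> = - <w, lap w_N> <= C * gradnorm w_N]. *)
Lemma sobolev_by_duality w (C : R) : L2 w -> 0 < C ->
  (forall v p q, H2_data v p q -> `|inner w (lap q)| <= C * gradnorm p) ->
  forall k psi, test psi -> `|inner w (pderiv k psi)| <= n%:R * C * L2norm psi.
Proof.
move=> wL C0 H k psi tp.
pose c m := inner w (phi m).
have pL := L2_test oOm bOm tp; have dpL := L2_test oOm bOm (test_pderiv k tp).
have G N : gradnorm (dlincomb N c) <= n%:R * C.
  have D := lincomb_H2 N c; have [_ qL _] := D; have LL := L2_lap oOm qL.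
  have E : inner (lap (d2lincomb N c)) (lincomb N c) = inner (lap (d2lincomb N c)) w.
    rewrite (inner_lap_lincomb _ _ (lincomb_L2 N c)) (inner_lap_lincomb _ _ wL); congr (- _).
    apply: eq_bigr => m _; congr (_ * _).
    by rewrite innerC inner_lincomb_phi ltn_ord /c innerC.
  have S := H2_gradient oOm bOm D; rewrite E innerC in S.
  have S2 := H _ _ _ D.
  have S4 : \sum_k L2norm (dlincomb N c k) ^+ 2 <= C * gradnorm (dlincomb N c).
    by rewrite S; apply: le_trans (ler_norm _) _; rewrite normrN.
  (* Expanding this square turns [sum of squares <= C * sum] into [sum <= n * C]; this is where the
     factor [n] comes from. *)
  have : 0 <= \sum_k (L2norm (dlincomb N c k) - C) ^+ 2 by apply: sumr_ge0 => i _; exact: sqr_ge0.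
  have -> : \sum_k (L2norm (dlincomb N c k) - C) ^+ 2 =
      \sum_k L2norm (dlincomb N c k) ^+ 2 - 2 * C * gradnorm (dlincomb N c) + n%:R * C ^+ 2.
    rewrite -[n%:R]/(n%:R) /gradnorm mulr_sumr -sumrB (_ : n%:R * C ^+ 2 = \sum_(k < n) C ^+ 2).
      rewrite -big_split/=; apply: eq_bigr => i _; ring.
    by rewrite sumr_const card_ord mulr_natl.
  move: (gradnorm _) S4 => g; move: (\sum_k _) => s S4 S5.
  rewrite -(ler_pM2l C0) (mulrCA C) -expr2 -subr_ge0; apply: le_trans S5 _.
  by rewrite -subr_ge0 [leRHS](_ : _ = C * g - s) ?subr_ge0//; ring.
apply: (@le_lin _ _ _ (L2norm (pderiv k psi))) => e e0.
have [N AN] := lincomb_approx wL e0; have {}AN := AN N (leqnn N).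
have gL := lincomb_L2 N c; have [[_ dL _] _ _] := lincomb_H2 N c.
have W : inner (lincomb N c) (pderiv k psi) = - inner (dlincomb N c k) psi.
  have [up _ _] := lincomb_H2 N c.
  by have := H10_weak oOm bOm k up tp; rewrite /= expr1 mulN1r.
have -> : inner w (pderiv k psi) = inner (w \- lincomb N c) (pderiv k psi) - inner (dlincomb N c k) psi.
  by rewrite (innerBl mOm wL gL dpL) W; ring.
apply: le_trans (ler_normB _ _) _; rewrite addrC; apply: lerD.
  apply: le_trans (inner_CS mOm (dL k) pL) _; apply: ler_wpM2r; first exact: L2norm_ge0.
  exact: le_trans (L2norm_le_gradnorm _ _ _) (G N).
apply: le_trans (inner_CS mOm (L2B mOm wL gL) dpL) _; rewrite mulrC.
by apply: ler_wpM2l => //; exact: L2norm_ge0.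
Qed.

Lemma weakM k a v w : smooth a -> L2 v -> L2 w -> weak [:: k] v w ->
  weak [:: k] (a \* v) ((a \* w) \+ (pderiv k a \* v)).
Proof.
move=> sa vL GL wG psi tp.
have dpL := L2_test oOm bOm (test_pderiv k tp); have pL := L2_test oOm bOm tp.
have sd := smooth_pderiv k sa.
rewrite (innerDl mOm (L2_smoothM oOm bOm sa GL) (L2_smoothM oOm bOm sd vL) pL).
have := wG _ (testM sa tp); rewrite /= expr1 !mulN1r.
rewrite (pderivM (smooth_derivable sa k) (smooth_derivable (test_smooth tp) k)).
rewrite (innerDr mOm (L2_smoothM oOm bOm sa dpL) (L2_smoothM oOm bOm (test_smooth tp)
  (L2_smooth oOm bOm sd)) vL).
have -> : inner (a \* v) (pderiv k psi) = inner v (a \* pderiv k psi).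
  by apply: eq_Rintegral => x _ /=; ring.
have -> : inner (pderiv k a \* v) psi = inner v (psi \* pderiv k a).
  by apply: eq_Rintegral => x _ /=; ring.
have -> : inner (a \* w) psi = inner w (a \* psi).
  by apply: eq_Rintegral => x _ /=; ring.
by move: (inner _ _) (inner _ _) (inner _ _) => X Y Z; lra.
Qed.

(** [rellich] bounds the pairing of [X u] with Laplacians, so [sobolev_by_duality] bounds each
    [d_k (X u)]. The commutator of [d_k] with [X] is of first order, so the same bound holds for
    [X (d_k u)]. *)
Lemma tangential_bound al : (forall l, smooth (al l)) -> tangential Om al ->
  exists2 C, 0 <= C & forall u p q, H2_data u p q -> forall k,
    L2norm (field al (fun l => q l k)) <= C * (L2norm (lap q) + gradnorm p).
Proof.
move=> sal tal; have dense := spectral_tests_dense.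
have [C C0 HC] := rellich oOm bOm sal tal.
have [C1 C10 HC1] := field_bound0 oOm bOm sal.
have /choice[C2 HC2] : forall k, exists C, 0 <= C /\ forall p, (forall l, L2 (p l)) ->
    L2 (field (fun l => pderiv k (al l)) p) /\
    L2norm (field (fun l => pderiv k (al l)) p) <= C * gradnorm p.
  by move=> k; have [D D0 HD] := field_bound0 oOm bOm (fun l => smooth_pderiv k (sal l)); exists D.
have S0 : 0 <= \sum_k C2 k by apply: sumr_ge0 => k _; exact: (HC2 k).1.
exists (n%:R * C + \sum_k C2 k); first by rewrite addr_ge0// mulr_ge0.
move=> u p q D k; have [up qL wq] := D; have [uL pL _] := up.
have [wL _] := HC1 p pL; have [fL _] := HC1 _ (fun l => qL l k).
have [gL gC] := (HC2 k).2 p pL.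
set K := L2norm (lap q) + gradnorm p.
have K0 : 0 <= K by rewrite addr_ge0 ?L2norm_ge0 ?gradnorm_ge0.
have B : L2norm (field al (fun l => q l k) \+ field (fun l => pderiv k (al l)) p) <= n%:R * (C * K).
  (* The added [e] makes the constant strictly positive, as the duality argument divides by it. *)
  apply: (@le_lin _ _ _ n%:R) => e e0; rewrite -mulrDr.
  have CK : 0 < C * K + e by rewrite ltr_wpDl// mulr_ge0.
  apply: (dual_bound oOm bOm dense (L2D mOm fL gL)); first by rewrite mulr_ge0// ltW.
  move=> psi tp.
  have := sobolev_by_duality wL CK _ k tp.
  have -> : inner (field al p) (pderiv k psi) =
      - inner (field al (fun l => q l k) \+ field (fun l => pderiv k (al l)) p) psi.
    have dpL := L2_test oOm bOm (test_pderiv k tp); have pL' := L2_test oOm bOm tp.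
    have aL l := L2_smoothM oOm bOm (sal l) (pL l).
    have bL l := L2D mOm (L2_smoothM oOm bOm (sal l) (qL l k))
      (L2_smoothM oOm bOm (smooth_pderiv k (sal l)) (pL l)).
    have -> : field al (fun l => q l k) \+ field (fun l => pderiv k (al l)) p =
        fun x => \sum_l ((al l \* q l k) \+ (pderiv k (al l) \* p l)) x.
      by apply/funext => x; rewrite /field /= -big_split.
    rewrite (inner_suml mOm _ _ bL pL') (inner_suml mOm _ _ aL dpL) -sumrN.
    apply: eq_bigr => l _; have := weakM (sal l) (pL l) (qL l k) (wq l k) tp.
    by rewrite /= expr1 mulN1r.
  rewrite normrN; apply => v p' q' D'.
  apply: le_trans (HC _ _ _ _ _ _ D D') _; rewrite -/K; apply: ler_wpM2r; first exact: gradnorm_ge0.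
  by rewrite lerDl ltW.
have -> : L2norm (field al (fun l => q l k)) =
    L2norm ((field al (fun l => q l k) \+ field (fun l => pderiv k (al l)) p) \- field (fun l => pderiv k (al l)) p).
  by apply: L2norm_eq => x _ /=; rewrite addrK.
apply: le_trans (L2normB_le mOm (L2D mOm fL gL) gL) _; rewrite mulrDl -mulrA; apply: lerD => //.
apply: le_trans gC _; apply: ler_pM => //; rewrite ?gradnorm_ge0 ?(HC2 k).1//; last first.
  by rewrite /K lerDr L2norm_ge0.
by rewrite (bigD1 k)//= lerDl; apply: sumr_ge0 => l _; exact: (HC2 l).1.
Qed.

End spectrum.

(** * The H^2 estimate *)

Lemma L2norm_le {R : realType} {n : nat} (Om : set 'rV[R]_n) (u v : 'rV[R]_n -> R) :
  measurable Om -> L2 Om u -> L2 Om v ->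
  (forall x, Om x -> `|u x| <= `|v x|) -> L2norm Om u <= L2norm Om v.
Proof.
move=> mOm uL vL uv; rewrite (L2normE mOm uL) (L2normE mOm vL) ler_wsqrtr//.
apply: (le_Rintegral mOm (L2_mul_integrable mOm uL uL) (L2_mul_integrable mOm vL vL)) => x Ox.
by rewrite /= -!expr2 -real_normK ?num_real// -[leRHS]real_normK ?num_real// lerXn2r ?nnegrE//; exact: uv.
Qed.

Lemma bump_lower_bound {R : realType} {n : nat} (c : 'rV[R]_n) (r : R) : 0 < r ->
  exists2 del, 0 < del & forall x, ball c (r / 2) x -> del <= bump c r x.
Proof.
move=> r0; pose s := r ^+ 2 - (r / 2) ^+ 2.
have s0 : 0 < s by rewrite /s; nra.
have r2 : 0 <= r / 2 by rewrite divr_ge0// ltW.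
exists (\prod_(i < n) expinv s); first by apply: prodr_gt0 => i _; exact: expinv_gt0.
move=> x /ball_rV[_ H]; apply: ler_prod => i _; rewrite expinv_ge0/=.
apply: le_expinv; rewrite /s lerD2l lerN2 -[(_ - c ord0 i) ^+ 2]real_normK ?num_real// distrC.
by apply: lerXn2r; rewrite ?nnegrE//; apply: ltW.
Qed.

Section elliptic_estimate.
Context {R : realType} {d : nat}.
Local Notation n := d.+1.
Variables (Om : set 'rV[R]_n) (lam : nat -> R) (phi : nat -> 'rV[R]_n -> R).
Hypotheses (oOm : open Om) (bOm : bounded_set Om) (hphi : dirichlet_spectrum Om lam phi).
Implicit Types (u psi a : 'rV[R]_n -> R) (p : 'I_n -> 'rV[R]_n -> R)
  (q : 'I_n -> 'I_n -> 'rV[R]_n -> R) (i j k l : 'I_n).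

Local Notation leb := (@lebesgue_rV R n).
Local Notation L2 := (L2 Om).
Local Notation L2norm := (L2norm Om).
Local Notation test := (test_function Om).
Local Notation gradnorm := (gradnorm Om).
Local Notation H2_data := (H2_data Om).
Local Notation hess := ('I_n -> 'I_n -> 'rV[R]_n -> R).

Let mOm : measurable Om := open_measurable_rV oOm.
#[local] Hint Resolve mOm : core.

(** Expressions in the Hessian bounded in L^2 by [|lap u| + |grad u|], with one constant for all
    data. Stating this for maps of [q] makes it stable under sums and smooth coefficients, so that
    estimates combine algebraically. *)
Definition controlled (T : hess -> 'rV[R]_n -> R) : Prop := exists2 C, 0 <= C &
  forall u p q, H2_data u p q -> L2 (T q) /\ L2norm (T q) <= C * (L2norm (lap q) + gradnorm p).

Let K0 p q : 0 <= L2norm (lap q) + gradnorm p.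
Proof. by rewrite addr_ge0 ?L2norm_ge0 ?gradnorm_ge0. Qed.

Lemma controlledD S T : controlled S -> controlled T -> controlled (fun q => S q \+ T q).
Proof.
move=> [C C0 HC] [D D0 HD]; exists (C + D); first exact: addr_ge0.
move=> u p q H; have [SL Sn] := HC _ _ _ H; have [TL Tn] := HD _ _ _ H.
split; first exact: (L2D mOm SL TL).
by apply: le_trans (L2normD_le mOm SL TL) _; rewrite mulrDl lerD.
Qed.

Lemma controlledM a T : smooth a -> controlled T -> controlled (fun q => a \* T q).
Proof.
move=> sa [C C0 HC]; have [D D0 HD] := smooth_mul_bounded oOm bOm sa.
exists (D * C); first exact: mulr_ge0.
move=> u p q H; have [TL Tn] := HC _ _ _ H; have [aTL aTn] := HD _ TL; split=> //.
by apply: le_trans aTn _; rewrite -mulrA ler_wpM2l.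
Qed.

Lemma controlledB S T : controlled S -> controlled T -> controlled (fun q => S q \- T q).
Proof.
move=> cS /(controlledM (smooth_cst (-1))) cT; have := controlledD cS cT.
congr controlled; apply/funext => q; apply/funext => x /=; by rewrite mulN1r.
Qed.

Lemma controlled0 : controlled (fun _ _ => 0).
Proof.
exists 0 => // u p q _; split; first exact: L2_0.
by rewrite (L2norm0 mOm) mul0r.
Qed.

Lemma controlled_sum (I : Type) (s : seq I) (T : I -> hess -> 'rV[R]_n -> R) :
  (forall b, controlled (T b)) -> controlled (fun q x => \sum_(b <- s) T b q x).
Proof.
move=> cT; elim: s => [|b s IH].
  have := controlled0; congr controlled; apply/funext => q; apply/funext => x; by rewrite big_nil.
have := controlledD (cT b) IH; congr controlled; apply/funext => q; apply/funext => x.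
by rewrite big_cons.
Qed.

Lemma controlled_lap : controlled lap.
Proof.
exists 1 => // u p q [_ qL _]; split; first exact: (L2_lap oOm qL).
by rewrite mul1r lerDl gradnorm_ge0.
Qed.

Lemma controlled_ae S T : controlled S ->
  (forall u p q, H2_data u p q -> L2 (T q) /\ S q = T q %[ae leb in Om]) -> controlled T.
Proof.
move=> [C C0 HC] H; exists C => // u p q D; have [SL Sn] := HC _ _ _ D; have [TL TS] := H _ _ _ D.
by split=> //; rewrite -(L2norm_ae_eq mOm SL TL TS).
Qed.

Lemma controlled_le S T : controlled S -> (forall u p q, H2_data u p q -> L2 (T q)) ->
  (forall q x, Om x -> `|T q x| <= `|S q x|) -> controlled T.
Proof.
move=> [C C0 HC] TL TS; exists C => // u p q D; have [SL Sn] := HC _ _ _ D.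
split; first exact: TL D.
by apply: le_trans Sn; apply: (L2norm_le mOm (TL _ _ _ D) SL) => x; exact: TS.
Qed.

Lemma controlled_field (al : 'I_n -> 'rV[R]_n -> R) k : (forall l, smooth (al l)) ->
  tangential Om al -> controlled (fun q => field al (fun l => q l k)).
Proof.
move=> sal tal; have [C C0 HC] := tangential_bound oOm bOm hphi sal tal.
have [D _ HD] := field_bound0 oOm bOm sal.
exists C => // u p q H; split; last exact: HC H k.
by have [_ qL _] := H; exact: (HD _ (fun l => qL l k)).1.
Qed.

(** The field [psi * e_i] has compact support in the domain and is therefore tangential: interior
    points are covered by the same estimate as boundary points. *)
Lemma controlled_interior psi i j : test psi -> controlled (fun q => psi \* q i j).
Proof.
move=> tp; pose al l : 'rV[R]_n -> R := if l == i then psi else fun=> 0.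
have tal l : test (al l) by rewrite /al; case: ifP => // _; exact: test0.
have := controlled_field j (fun l => test_smooth (tal l))
  (tangential_test oOm bOm (spectral_tests_dense oOm bOm hphi) tal).
congr controlled; apply/funext => q; apply/funext => x; rewrite /field (bigD1 i)//= /al eqxx big1 ?addr0//.
by move=> l /negbTE ->; rewrite mul0r.
Qed.

(** * Second derivatives near a boundary point *)

Section chart.
Variables (zeta : 'rV[R]_n -> R) (i : 'I_n) (s : bool) (h : 'rV[R]_d -> R) (K : set 'rV[R]_n).
Hypotheses (sz : smooth zeta) (sh : smooth h) (cK : compact K)
  (zK : forall x, ~ K x -> zeta x = 0)
  (KO : forall x, K x -> Om x <-> 0 < (-1) ^+ s * (x ord0 i - h (col' i x))).

Let slope (kap : 'I_d) : 'rV[R]_n -> R := fun x => pderiv kap h (col' i x).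

Let smooth_slope kap : smooth (slope kap).
Proof. by apply: smooth_col'; exact: smooth_pderiv. Qed.

(* A multiple of [d_(lift i kap) + slope kap * d_i], which annihilates [x_i - h (col' i x)]. *)
Let al (kap : 'I_d) (l : 'I_n) : 'rV[R]_n -> R :=
  oapp (fun kap' => if kap' == kap then zeta else fun=> 0) (zeta \* slope kap) (unlift i l).

Let sum_al kap (F : 'I_n -> R) x :
  \sum_l al kap l x * F l = zeta x * (F (lift i kap) + slope kap x * F i).
Proof.
rewrite (bigD1_ord i)//= /al unlift_none /= (bigD1 kap)//= liftK /= eqxx big1.
  ring.
by move=> kap' /negbTE E; rewrite liftK /= E mul0r.
Qed.

(** The field [al kap] annihilates [rho], vanishes off [K], and on [K] the domain is [rho > 0]; so
    [tangential_boundary] applies. *)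
Lemma chart_tangential kap m :
  controlled (fun q => zeta \* (q (lift i kap) m \+ (slope kap \* q i m))).
Proof.
have sal l : smooth (al kap l).
  rewrite /al; case: unlift => [kap'|] /=; last exact: (smoothM sz (smooth_slope kap)).
  by case: ifP => _; [exact: sz|exact: (@smooth_cst R n 0)].
pose rho : 'rV[R]_n -> R := fun x => (-1) ^+ s * (x ord0 i - h (col' i x)).
have sr0 : smooth (fun x : 'rV[R]_n => x ord0 i - h (col' i x)).
  exact: (smoothB (smooth_coord i) (smooth_col' i sh)).
have sr : smooth rho by exact: (smoothZ _ sr0).
have drho l x : pderiv l rho x = (-1) ^+ s * ((l == i)%:R - (if unlift i l is Some kap then slope kap x else 0)).
  rewrite /rho (_ : (fun x => _) = (-1) ^+ s \*o ((fun x : 'rV[R]_n => x ord0 i) \- (fun x => h (col' i x))))//.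
  rewrite (pderivZ _ (smooth_derivable sr0 l)).
  rewrite (pderivB (smooth_derivable (smooth_coord i) l) (smooth_derivable (smooth_col' i sh) l)).
  by rewrite pderiv_coord (pderiv_col' _ _ (smooth_derivable sh)).
have tal : tangential Om (al kap).
  apply: (tangential_boundary oOm bOm (spectral_tests_dense oOm bOm hphi) sal sr cK _ KO).
    move=> l x /zK zx; rewrite /al; case: unlift => [kap'|] /=; last by rewrite zx mul0r.
    by case: ifP.
  move=> x; rewrite sum_al !drho liftK unlift_none eqxx.
  have /negbTE -> : lift i kap != i by rewrite eq_sym neq_lift.
  by rewrite /=; ring.
have := controlled_field m sal tal; congr controlled.
by apply/funext => q; apply/funext => x; rewrite /field sum_al.
Qed.

(* Expressing the tangential second derivatives in [lap q] through [q i i] and controlled terms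
   gives [(1 + |slope|^2) * q i i]. *)
Lemma chart_normal : controlled (fun q => zeta \* q i i).
Proof.
have zL u : L2 u -> L2 (zeta \* u) := @L2_smoothM _ _ _ oOm bOm _ u sz.
have cN : controlled (fun q => (fun x => 1 + \sum_kap slope kap x ^+ 2) \* (zeta \* q i i)).
  pose E kap m q := zeta \* (q (lift i kap) m \+ (slope kap \* q i m)).
  have cE kap m : controlled (E kap m) by exact: chart_tangential.
  (* With [l = lift i kap] and symmetric second derivatives, each subtracted bracket equals
     [zeta * (q l l - slope^2 * q i i)], so only multiples of [q i i] survive. *)
  have c1 : controlled (fun q => (zeta \* lap q) \-
      (fun x => \sum_kap (E kap (lift i kap) q \- (slope kap \* E kap i q)) x)).
    apply: (controlledB (controlledM sz controlled_lap)).
    apply: controlled_sum => kap; exact: (controlledB (cE _ _) (controlledM (smooth_slope kap) (cE _ _))).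
  apply: (controlled_ae c1) => u p q D; have [_ qL _] := D; split.
    apply: (L2_smoothM oOm bOm _ (zL _ (qL i i))); apply: smoothD; first exact: smooth_cst.
    by apply: smooth_sum => kap; exact: (smoothM (smooth_slope kap) (smooth_slope kap)).
  have : {ae leb, forall x, Om x -> forall kap, q i (lift i kap) x = q (lift i kap) i x}.
    have sym kap := H2_sym oOm bOm i (lift i kap) D.
    have := @filter_forall _ _ _ _ (ae_filter_ringOfSetsType leb) sym.
    by apply: filterS => x H Ox kap; exact: H.
  apply: filterS => x H Ox; have E1 : lap q x = q i i x + \sum_kap q (lift i kap) (lift i kap) x by exact: bigD1_ord.
  rewrite /= E1 mulrDr mulr_sumr -addrA -sumrB [RHS]mulrDl mul1r mulr_suml; congr (_ + _).
  by apply: eq_bigr => kap _; rewrite /E /= (H Ox kap); ring.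
apply: (controlled_le cN) => [u p q [_ qL _]|q x Ox]; first exact: zL.
rewrite /= [leRHS]normrM ler_peMl// ger0_norm ?lerDl ?addr_ge0//; apply: sumr_ge0 => kap _; exact: sqr_ge0.
Qed.

(** [chart_tangential] expresses row [lift i kap] through row [i]. In row [i], the normal entry is
    [chart_normal], and the others follow from it by one such step and symmetry. *)
Lemma chart_controlled j k : controlled (fun q => zeta \* q j k).
Proof.
have zL u : L2 u -> L2 (zeta \* u) := @L2_smoothM _ _ _ oOm bOm _ u sz.
have step kap m : controlled (fun q => zeta \* q i m) -> controlled (fun q => zeta \* q (lift i kap) m).
  move=> c; have := controlledB (chart_tangential kap m) (controlledM (smooth_slope kap) c).
  congr controlled; apply/funext => q; apply/funext => x /=; ring.
have [kap ->|->] := unliftP i j; [apply: (step)|]; have [kap' ->|->] := unliftP i k;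
  do ?exact: chart_normal.
- apply: (controlled_ae (step kap' i chart_normal)) => u p q D; have [_ qL _] := D.
  split; first exact: zL.
  by apply: filterS (H2_sym oOm bOm (lift i kap') i D) => x H Ox; rewrite /= H.
- apply: (controlled_ae (step kap' i chart_normal)) => u p q D; have [_ qL _] := D.
  split; first exact: zL.
  by apply: filterS (H2_sym oOm bOm (lift i kap') i D) => x H Ox; rewrite /= H.
Qed.

End chart.

Hypothesis sbOm : smooth_boundary Om.

Lemma local_estimate (x : 'rV[R]_n) : closure Om x -> exists r zeta,
  [/\ 0 < r, forall y, 0 <= zeta y, forall y, ball x r y -> 1 <= zeta y &
      forall i j, controlled (fun q => zeta \* q i j)].
Proof.
move=> cx.
suff [r [r0 H]] : exists r, 0 < r /\ forall i j, controlled (fun q => bump x r \* q i j).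
  have [del del0 Hdel] := bump_lower_bound x r0.
  exists (r / 2), (fun y => del^-1 * bump x r y); split; first by rewrite divr_gt0.
  - by move=> y; rewrite mulr_ge0 ?bump_ge0// invr_ge0 ltW.
  - by move=> y /Hdel; rewrite mulrC ler_pdivlMr// mul1r.
  - move=> i j; have := controlledM (smooth_cst del^-1) (H i j).
    by congr controlled; apply/funext => q; apply/funext => y /=; rewrite mulrA.
have [Ox|Ox] := pselect (Om x).
  have /nbhs_ballP[r /= r0 rO] := open_nbhs_nbhs (conj oOm Ox).
  exists (r / 2); split; first by rewrite divr_gt0.
  move=> i j; apply: controlled_interior; apply: bump_test; first by rewrite divr_gt0.
  by rewrite mulrC divfK// pnatr_eq0.
have [r [i [s [h [r0 sh H]]]]] := sbOm (conj cx Ox).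
(* The closed cube [K] of radius [r / 2] carries the bump and still lies in the ball where the graph
   describes the domain. *)
have r20 : 0 < r / 2 by rewrite divr_gt0.
exists (r / 2); split=> // j k.
pose K := [set y : 'rV[R]_n | forall i, `[x ord0 i - r / 2, x ord0 i + r / 2]%classic (y ord0 i)].
have cK : compact K.
  exact: (@rV_compact R n (fun i => `[x ord0 i - r / 2, x ord0 i + r / 2]%classic)
    (fun i => @segment_compact R _ _)).
apply: (@chart_controlled _ i s h K (smooth_bump _ _) sh cK).
- move=> y Ky; apply: bump_eq0 => // /ball_rV[_ By]; apply: Ky => l.
  by have := By l; rewrite /= in_itv/= ltr_distlC => /andP[A B]; rewrite !ltW.
- move=> y Ky; apply: H; apply/ball_rV; split=> // l; have := Ky l.
  rewrite /= in_itv/= => /andP[A B]; rewrite ltr_distlC; apply/andP; split; lra.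
Qed.

Lemma compact_closure_bounded : compact (closure Om).
Proof.
have [r r0 H] := bounded_set_rV bOm.
have cB := @box_compact R n r.
apply: (subclosed_compact _ cB); first exact: closed_closure.
have cl : closed [set x : 'rV[R]_n | forall i, `|x ord0 i| <= r] by exact: compact_closed.
rewrite [X in _ `<=` X](closure_id _).1//.
by apply: closure_subset => x Ox i; exact: H.
Qed.

(** By compactness of the closure, finitely many local weights have a sum [W >= 1] on the domain.
    Domination by [W] suffices, so the weights need not form a partition of unity. *)
Lemma hessian_controlled i j : controlled (fun q => q i j).
Proof.
have /choice[f Hf] : forall x : 'rV[R]_n, exists rz : R * ('rV[R]_n -> R), closure Om x ->
    [/\ 0 < rz.1, forall y, 0 <= rz.2 y, forall y, ball x rz.1 y -> 1 <= rz.2 y &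
      forall i j, controlled (fun q => rz.2 \* q i j)].
  move=> x; have [cx|cx] := pselect (closure Om x); last by exists (0, fun=> 0).
  by have [r [z H]] := local_estimate cx; exists (r, z).
have := compact_closure_bounded; rewrite compact_cover.
move=> /(_ _ (closure Om) (fun x => (ball x (f x).1)^°)) [||D DO cD].
- by move=> x _; exact: open_interior.
- move=> x cx; exists x => //; have [r0 _ _ _] := Hf x cx; exact: nbhsx_ballx.
pose W : 'rV[R]_n -> R := fun y => \sum_(x <- finmap.enum_fset D) (f x).2 y.
have DC x : x \in finmap.enum_fset D -> closure Om x by move=> xD; have := DO x xD; rewrite inE.
have cW : controlled (fun q => W \* q i j).
  have : controlled (fun q y => \sum_(x <- finmap.enum_fset D) (if x \in finmap.enum_fset D then (f x).2 y * q i j y else 0)).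
    apply: (@controlled_sum _ (finmap.enum_fset D) (fun x q y => if x \in finmap.enum_fset D then (f x).2 y * q i j y else 0)) => x.
    by have [xD|xD] := boolP (x \in finmap.enum_fset D); [have [_ _ _ H] := Hf x (DC x xD); exact: H|exact: controlled0].
  congr controlled; apply/funext => q; apply/funext => y; rewrite /W /= mulr_suml big_seq [RHS]big_seq.
  by apply: eq_bigr => x ->.
apply: (controlled_le cW) => [u p q [_ qL _]//|q y Oy].
rewrite /= normrM ler_peMl//; apply: le_trans (ler_norm _).
have [x xD /interior_subset yx] := cD y (subset_closure Oy).
rewrite /W (perm_big _ (perm_to_rem (xD : x \in finmap.enum_fset D)))/= big_cons.
have [_ _ H _] := Hf x (DC x xD); apply: le_trans (H y yx) _.
rewrite lerDl big_seq; apply: sumr_ge0 => z /mem_rem zD; have [_ H0 _ _] := Hf z (DC z zD); exact: H0.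
Qed.

(** The gradient term of the controlled bounds is absorbed by [|grad u|^2 = - (lap u, u) <= (|lap u|
    + |u|)^2]. *)
Lemma H2_estimate : exists2 C, 0 <= C & forall u p q, H2_data u p q ->
  [/\ forall i, L2norm (p i) <= C * (L2norm (lap q) + L2norm u),
      forall i j, L2norm (q i j) <= C * (L2norm (lap q) + L2norm u) &
      sobolev_norm Om 2 u <= C * (L2norm (lap q) + L2norm u)].
Proof.
have /choice[c Hc] : forall ij : 'I_n * 'I_n, exists C, 0 <= C /\ forall u p q, H2_data u p q ->
    L2norm (q ij.1 ij.2) <= C * (L2norm (lap q) + gradnorm p).
  by move=> ij; have [C C0 H] := hessian_controlled ij.1 ij.2; exists C; split=> // u p q /H[].
pose C1 := \sum_ij c ij.
have C10 : 0 <= C1 by apply: sumr_ge0 => ij _; exact: (Hc ij).1.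
have [D D0 HD] := H2_sobolev_norm_le oOm bOm.
pose C2 := 1 + C1 * (1 + n%:R).
have C20 : 1 <= C2 by rewrite lerDl mulr_ge0// addr_ge0.
have C2p : 0 <= C2 by exact: le_trans C20.
exists (C2 + D * C2); first by rewrite addr_ge0// mulr_ge0.
move=> u p q H; set S := L2norm (lap q) + L2norm u.
have L0 := L2norm_ge0 Om (lap q); have U0 := L2norm_ge0 Om u.
have S0 : 0 <= S by rewrite addr_ge0.
have [up qL _] := H; have [uL _ _] := up.
have P i : L2norm (p i) <= S.
  rewrite -(@ler_pXn2r _ 2)// ?nnegrE ?L2norm_ge0//.
  have E := H2_gradient oOm bOm H.
  have : L2norm (p i) ^+ 2 <= \sum_k L2norm (p k) ^+ 2.
    by rewrite (bigD1 i)//= lerDl; apply: sumr_ge0 => k _; exact: sqr_ge0.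
  move=> /le_trans; apply; rewrite E; apply: le_trans (ler_norm _) _; rewrite normrN.
  apply: le_trans (inner_CS mOm (L2_lap oOm qL) uL) _; rewrite /S sqrrD.
  rewrite -addrA [_ + (_ + _)]addrC -addrA.
  have X := mulr_ge0 L0 U0; rewrite mulr2n -addrA lerDl !addr_ge0//; exact: sqr_ge0.
have N : gradnorm p <= n%:R * S.
  apply: le_trans (ler_sum _ (fun i _ => P i)) _.
  by rewrite sumr_const card_ord mulr_natl.
have Q i j : L2norm (q i j) <= C2 * S.
  apply: le_trans ((Hc (i, j)).2 _ _ _ H) _.
  apply: (@le_trans _ _ (C1 * ((1 + n%:R) * S))).
    apply: ler_pM; [exact: (Hc (i, j)).1|by rewrite addr_ge0// gradnorm_ge0| |].
      by rewrite /C1 (bigD1 (i, j))//= lerDl; apply: sumr_ge0 => kl _; exact: (Hc kl).1.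
    by rewrite mulrDl mul1r; apply: lerD => //; rewrite lerDl.
  by rewrite mulrA /C2 mulrDl lerDr mul1r.
have P' i : L2norm (p i) <= C2 * S by apply: le_trans (P i) _; rewrite ler_peMl.
have le2 : C2 * S <= (C2 + D * C2) * S by rewrite [leRHS]mulrDl lerDl !mulr_ge0.
split=> [i|i j|].
- exact: le_trans (P' i) le2.
- exact: le_trans (Q i j) le2.
apply: le_trans (HD _ _ _ _ H _ _ P' Q) _; first exact: mulr_ge0.
  by apply: le_trans (_ : S <= _); [rewrite lerDr|rewrite ler_peMl].
by rewrite mulrA mulrDl lerDr mulr_ge0.
Qed.

End elliptic_estimate.

(** * The linear problem *)

Section linear_problem.
Context {R : realType} {d : nat}.
Local Notation n := d.+1.
Variables (Om : set 'rV[R]_n) (lam : nat -> R) (phi : nat -> 'rV[R]_n -> R).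
Hypotheses (oOm : open Om) (bOm : bounded_set Om) (hphi : dirichlet_spectrum Om lam phi).
Implicit Types (u v w f psi F : 'rV[R]_n -> R) (p : 'I_n -> 'rV[R]_n -> R)
  (q : 'I_n -> 'I_n -> 'rV[R]_n -> R) (i j k : 'I_n) (e s : R) (a c : nat -> R) (N K m : nat).

Local Notation leb := (@lebesgue_rV R n).
Local Notation L2 := (L2 Om).
Local Notation inner := (inner Om).
Local Notation L2norm := (L2norm Om).
Local Notation H2_data := (H2_data Om).
Local Notation comb := (lincomb phi).
Local Notation coef u := (fun m : nat => inner u (phi m)).

Let mOm : measurable Om := open_measurable_rV oOm.
#[local] Hint Resolve mOm : core.
Let linL N a : L2 (comb N a) := lincomb_L2 oOm bOm hphi N a.
Let phiL m : L2 (phi m) := phi_L2 oOm bOm hphi m.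

Lemma lincomb_norm2 N a : L2norm (comb N a) ^+ 2 = \sum_(m < N) a m ^+ 2.
Proof.
rewrite (L2norm2 mOm (linL N a)) (inner_lincomb oOm bOm hphi _ _ (linL N a)).
apply: eq_bigr => m _; rewrite innerC (inner_lincomb_phi oOm bOm hphi) ltn_ord expr2 //.
Qed.

Lemma lincomb_norm_le N a c s : 0 <= s -> (forall m, `|a m| <= s * `|c m|) ->
  L2norm (comb N a) <= s * L2norm (comb N c).
Proof.
move=> s0 H; rewrite -(@ler_pXn2r _ 2)// ?nnegrE ?mulr_ge0 ?L2norm_ge0//.
rewrite exprMn !lincomb_norm2 mulr_sumr; apply: ler_sum => m _.
rewrite -[a m ^+ 2]real_normK ?num_real// -[c m ^+ 2]real_normK ?num_real// -exprMn.
by apply: lerXn2r => //; rewrite nnegrE ?mulr_ge0.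
Qed.

Lemma lincomb_diff N K a : (N <= K)%N ->
  comb K a \- comb N a = comb K (fun m => if (m < N)%N then 0 else a m).
Proof.
move=> NK; apply/funext => x; rewrite /lincomb /= (big_ord_widen _ (fun m => a m * phi m x) NK).
rewrite [X in _ - X]big_mkcond -sumrB; apply: eq_bigr => m _.
by case: ifP; rewrite ?mul0r ?subrr ?subr0.
Qed.

Lemma coef_cauchy w e : L2 w -> 0 < e -> exists N0 : nat, forall N K, (N0 <= N)%N -> (N0 <= K)%N ->
  L2norm (comb K (coef w) \- comb N (coef w)) <= e.
Proof.
move=> wL e0; have e20 : 0 < e / 2 by rewrite divr_gt0.
have [N0 H] := lincomb_approx hphi wL e20; exists N0 => N K NN NK.
apply: le_trans (L2norm_tri mOm (linL _ _) wL (linL _ _)) _.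
rewrite (L2normBC mOm (linL _ _) wL) [e in _ <= e]splitr; apply: lerD; exact: H.
Qed.

(** Square summability of the coefficients [a] is expressed by domination by the coefficients of a
    known L^2 function, whose partial sums are already Cauchy. *)
Lemma lincomb_complete w a s : L2 w -> 0 <= s -> (forall m, `|a m| <= s * `|inner w (phi m)|) ->
  exists2 u, L2 u & forall m, inner u (phi m) = a m.
Proof.
move=> wL s0 H.
have C e : 0 < e -> exists N0, forall N K, (N0 <= N)%N -> (N0 <= K)%N ->
    L2norm (comb N a \- comb K a) <= e.
  move=> e0; have s1 : 0 < s + 1 by rewrite ltr_wpDl.
  have [|N0 HN0] := coef_cauchy wL (_ : 0 < e / (s + 1)); first by rewrite divr_gt0.
  exists N0; suff W N K : (N0 <= N)%N -> (N <= K)%N -> L2norm (comb K a \- comb N a) <= e.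
    move=> N K NN NK; have [KN|/ltnW KN] := leqP K N; first exact: W.
    by rewrite (L2normBC mOm (linL _ _) (linL _ _)); exact: W.
  move=> NN NK; have := HN0 N K NN (leq_trans NN NK); rewrite !lincomb_diff// => B.
  apply: le_trans (lincomb_norm_le _ s0 (c := fun m => if (m < N)%N then 0 else inner w (phi m)) _) _.
    by move=> m; case: ifP; rewrite ?normr0 ?mulr0.
  apply: le_trans (ler_wpM2l s0 B) _; rewrite mulrCA ger_pMr// ler_pdivrMr// mul1r lerDl//.
have [u uL Hu] := L2_complete mOm (fun N => linL N a) C; exists u => // m.
have := inner_cvgl mOm (fun N => linL N a) uL (phiL m) Hu => /cvg_lim <-//.
apply: cvg_lim => //; apply: cvg_near_cst; exists m.+1 => // N /= mN.
by rewrite (inner_lincomb_phi oOm bOm hphi) mN.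
Qed.

(** Parseval's comparison, carried out on common partial sums. It turns bounds on spectral
    multipliers into operator bounds. *)
Lemma coef_norm_le v w s : L2 v -> L2 w -> 0 <= s ->
  (forall m, `|inner v (phi m)| <= s * `|inner w (phi m)|) -> L2norm v <= s * L2norm w.
Proof.
move=> vL wL s0 H; apply: (@le_lin _ _ _ (1 + s)) => e e0.
have [N1 H1] := lincomb_approx hphi vL e0; have [N2 H2] := lincomb_approx hphi wL e0.
pose K := maxn N1 N2; have {}H1 := H1 K (leq_maxl _ _); have {}H2 := H2 K (leq_maxr _ _).
have A := le_trans (ler_norm _) (le_trans (L2norm_distB mOm vL (linL K _)) H1).
have B := L2norm_distB mOm wL (linL K (coef w)).
have {}B := le_trans B H2; rewrite distrC in B; have {}B := le_trans (ler_norm _) B.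
have := lincomb_norm_le K s0 H.
move: A B; move: (L2norm v) (L2norm w) (L2norm (comb K _)) (L2norm (comb K _)) => x y z t A B D.
have : s * z <= s * (y + e) by apply: ler_wpM2l => //; lra.
rewrite !mulrDr mulrDl; lra.
Qed.

Lemma spectral_gap N w F : L2 w -> L2 F -> (forall m, (m < N)%N -> inner w (phi m) = 0) ->
  (forall m, (N <= m)%N -> lam m * inner w (phi m) = inner F (phi m)) ->
  lam N * L2norm w ^+ 2 <= inner F w.
Proof.
move=> wL FL w0 wF; apply: (@le_lin _ _ _ (L2norm F + lam N * L2norm w)) => e e0.
have [K H] := lincomb_approx hphi wL e0; have {}H := H K (leqnn K).
set z := comb K _ in H; have zL : L2 z by exact: linL.
have BL := L2B mOm wL zL.
have E v : L2 v -> inner v w = inner v z + inner v (w \- z).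
  by move=> vL; rewrite (innerBr mOm wL zL vL); ring.
have A : lam N * inner w z <= inner F z.
  rewrite !(innerC _ _ z) !(inner_lincomb oOm bOm hphi)// mulr_sumr; apply: ler_sum => m _.
  rewrite ![inner (phi m) _]innerC; have [mN|mN] := ltnP m N; first by rewrite w0// !(mul0r, mulr0).
  rewrite -wF// [leRHS]mulrCA -expr2; apply: ler_wpM2r; first exact: sqr_ge0.
  exact: (lam_le hphi mN).
have lN := lam_gt0 hphi N.
have B1 := le_trans (ler_norm _) (inner_CS mOm wL BL).
have B2 := inner_CS mOm FL BL; rewrite -normrN in B2; have {}B2 := le_trans (ler_norm _) B2.
have nw := L2norm_ge0 Om w; have nF := L2norm_ge0 Om F.
have B3 : L2norm w * L2norm (w \- z) <= L2norm w * e by exact: ler_wpM2l.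
have B4 : L2norm F * L2norm (w \- z) <= L2norm F * e by exact: ler_wpM2l.
rewrite (L2norm2 mOm wL) (E w wL) (E F FL) mulrDr.
have B5 : lam N * inner w (w \- z) <= lam N * (L2norm w * e).
  by apply: ler_wpM2l; [exact: ltW|exact: le_trans B3].
have B6 := le_trans B2 B4.
rewrite [(_ + lam N * _) * e]mulrDl -[lam N * L2norm w * e]mulrA.
move: A B5 B6; move: (inner _ _) (inner _ _) (inner _ _) (inner _ _) => x1 x2 x3 x4; move: (lam N * x1).
move: (lam N * x2) (lam N * _) (L2norm F * e) => *; lra.
Qed.

Lemma H2_limit u p q (U : nat -> 'rV[R]_n -> R) (P : nat -> 'I_n -> 'rV[R]_n -> R)
    (Q : nat -> 'I_n -> 'I_n -> 'rV[R]_n -> R) :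
  L2 u -> (forall k, L2 (p k)) -> (forall i j, L2 (q i j)) -> (forall m, H2_data (U m) (P m) (Q m)) ->
  L2norm (U m \- u) @[m --> \oo] --> (0 : R) ->
  (forall k, L2norm (P m k \- p k) @[m --> \oo] --> (0 : R)) ->
  (forall i j, L2norm (Q m i j \- q i j) @[m --> \oo] --> (0 : R)) -> H2_data u p q.
Proof.
move=> uL pL qL D Uu Pp Qq.
have UL m : L2 (U m) by have [[]] := D m.
have PL m k : L2 (P m k) by have [[_ H _] _ _] := D m; exact: H.
have QL m i j : L2 (Q m i j) by have [_ H _] := D m; exact: H.
split=> //; last first.
  move=> i j psi tp; have psiL := L2_test oOm bOm tp; have dpL := L2_test oOm bOm (test_pderiv j tp).
  have C1 := inner_cvgl mOm (fun m => PL m i) (pL i) dpL (Pp i).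
  have C2 := inner_cvgl mOm (fun m => QL m i j) (qL i j) psiL (Qq i j).
  apply: (cvg_unique _ C1) => //=; rewrite expr1 mulN1r.
  rewrite (_ : (fun m => inner (P m i) (pderiv j psi)) = (fun m => - inner (Q m i j) psi)); first exact: cvgN C2.
  by apply/funext => m; have [_ _ W] := D m; have := W i j psi tp; rewrite /= expr1 mulN1r.
split=> // e e0; have e20 : 0 < e / 2 by rewrite divr_gt0.
have [m [Hm1 Hm2]] : exists m, L2norm (U m \- u) <= e / 2 /\ forall k, L2norm (P m k \- p k) <= e / 2.
  have near0 (a : nat -> R) : (forall m, 0 <= a m) -> a m @[m --> \oo] --> (0 : R) -> \forall m \near \oo, a m <= e / 2.
    move=> a0 /cvgrPdist_le /(_ _ e20); apply: filterS => m; rewrite sub0r normrN ger0_norm//.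
  have N1 := near0 _ (fun m => L2norm_ge0 _ _) Uu.
  have N2 k := near0 _ (fun m => L2norm_ge0 _ _) (Pp k).
  have [m _ H] := filterI N1 (@filter_forall _ _ _ _ _ N2).
  by exists m; exact: H (leqnn m).
have [[_ _ ap] _ _] := D m; have [psi [tp A1 A2]] := ap _ e20; exists psi.
have psiL := L2_test oOm bOm tp; have dpL k := L2_test oOm bOm (test_pderiv k tp).
split=> // [|k]; rewrite [e in _ <= e]splitr.
  apply: le_trans (L2norm_tri mOm uL (UL m) psiL) _; apply: lerD => //.
  by rewrite (L2normBC mOm uL (UL m)).
apply: le_trans (L2norm_tri mOm (pL k) (PL m k) (dpL k)) _; apply: lerD => //.
by rewrite (L2normBC mOm (pL k) (PL m k)).
Qed.

Lemma inner_lap_spectrum u p q m : H2_data u p q -> inner (lap q) (phi m) = - (lam m * inner u (phi m)).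
Proof.
move=> D; have H := phi_H2 oOm bOm hphi m; have [up _ _] := D; have [hp _ _] := H; have [uL _ _] := up.
rewrite (green oOm bOm D hp) [inner u _]innerC -(inner_lap_phi oOm bOm hphi m uL) (green oOm bOm H up).
by congr (- _); apply: eq_bigr => k _; rewrite innerC.
Qed.

Hypothesis sbOm : smooth_boundary Om.

(** The partial sums of [u] are in H^2 because the eigenfunctions are, and their Laplacians are
    minus the partial sums of [F]. [H2_estimate] on differences then makes all first and second
    derivatives Cauchy. *)
Lemma H2_solve u F : L2 u -> L2 F -> (forall m, lam m * inner u (phi m) = inner F (phi m)) ->
  exists p q, H2_data u p q /\ lap q = (fun x => - F x) %[ae leb in Om].
Proof.
move=> uL FL uF; have [C C0 HC] := H2_estimate oOm bOm hphi sbOm.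
pose c := coef u; pose f := coef F.
pose U N := comb N c; pose P N := dlincomb Om phi N c; pose Q N := d2lincomb Om phi N c.
have D N : H2_data (U N) (P N) (Q N) by exact: (lincomb_H2 oOm bOm hphi).
have PL m k : L2 (P m k) by have [[_ H _] _ _] := D m; exact: H.
have QL m i j : L2 (Q m i j) by have [_ H _] := D m; exact: H.
have lapL N : L2 (lap (Q N)) by exact: (L2_lap oOm (QL N)).
have lapE N v : L2 v -> inner (lap (Q N)) v = - inner (comb N f) v.
  move=> vL; rewrite (inner_lap_lincomb oOm bOm hphi _ _ vL) (inner_lincomb oOm bOm hphi _ _ vL).
  by congr (- _); apply: eq_bigr => m _; rewrite /f -uF [c m * _]mulrC.
(* The Laplacians of eigenfunctions are known only almost everywhere, so the norm of the difference
   is found by duality. *)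
have lapB N K : L2norm (lap (fun i j => Q N i j \- Q K i j)) <= L2norm (comb N f \- comb K f).
  have E : lap (fun i j => Q N i j \- Q K i j) = lap (Q N) \- lap (Q K).
    by apply/funext => x; rewrite /lap /= sumrB.
  rewrite E; apply: (dual_bound oOm bOm (spectral_tests_dense oOm bOm hphi) (L2B mOm (lapL N) (lapL K))).
    exact: L2norm_ge0.
  move=> psi tp; have psiL := L2_test oOm bOm tp.
  rewrite (innerBl mOm (lapL N) (lapL K) psiL) !lapE// -opprD normrN.
  rewrite -(innerBl mOm (linL _ _) (linL _ _) psiL).
  exact: (inner_CS mOm (L2B mOm (linL _ _) (linL _ _)) psiL).
have cau e : 0 < e -> exists N0, forall N K, (N0 <= N)%N -> (N0 <= K)%N ->
    (forall i, L2norm (P N i \- P K i) <= e) /\ forall i j, L2norm (Q N i j \- Q K i j) <= e.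
  move=> e0; have C2 : 0 < C * 2 + 1 by rewrite ltr_wpDl// mulr_ge0.
  have e1 : 0 < e / (C * 2 + 1) by rewrite divr_gt0.
  have [N1 H1] := coef_cauchy uL e1; have [N2 H2] := coef_cauchy FL e1.
  exists (maxn N1 N2) => N K; rewrite !geq_max => /andP[a1 a2] /andP[b1 b2].
  have [X Y _] := HC _ _ _ (H2B oOm bOm (D N) (D K)).
  have S : C * (L2norm (lap (fun i j => Q N i j \- Q K i j)) + L2norm (U N \- U K)) <= e.
    apply: (@le_trans _ _ (C * (e / (C * 2 + 1) + e / (C * 2 + 1)))).
      apply: ler_wpM2l => //; apply: lerD; last exact: H1.
      apply: le_trans (lapB N K) _; exact: H2.
    have -> : C * (e / (C * 2 + 1) + e / (C * 2 + 1)) = e * ((C * 2) / (C * 2 + 1)) by ring.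
    rewrite ger_pMr//.
    by rewrite ler_pdivrMr// mul1r lerDl.
  by split=> [i|i j]; apply: le_trans S; [exact: X|exact: Y].
have /choice[p pP] : forall k, exists v, L2 v /\ L2norm (P m k \- v) @[m --> \oo] --> (0 : R).
  move=> k; have [|v vL Hv] := L2_complete mOm (fun m => PL m k); last by exists v.
  by move=> e /cau[N0 H]; exists N0 => x y xN yN; have [X _] := H x y xN yN; exact: X.
have /choice[q0 qP] : forall ij : 'I_n * 'I_n, exists v, L2 v /\ L2norm (Q m ij.1 ij.2 \- v) @[m --> \oo] --> (0 : R).
  move=> [i j]; have [|v vL Hv] := L2_complete mOm (fun m => QL m i j); last by exists v.
  by move=> e /cau[N0 H]; exists N0 => x y xN yN; have [_ X] := H x y xN yN; exact: X.
pose q i j := q0 (i, j).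
have pL k : L2 (p k) := (pP k).1; have qL i j : L2 (q i j) := (qP (i, j)).1.
have to0 w : L2 w -> L2norm (comb m (coef w) \- w) @[m --> \oo] --> (0 : R).
  move=> wL; apply/cvgrPdist_le => e e0; have [N0 H] := lincomb_approx hphi wL e0.
  exists N0 => // N NN; rewrite sub0r normrN ger0_norm ?L2norm_ge0// (L2normBC mOm (linL _ _) wL).
  exact: H.
exists p, q; split.
  exact: (@H2_limit u p q U P Q uL pL qL D (to0 u uL) (fun k => (pP k).2) (fun i j => (qP (i, j)).2)).
have lqL : L2 (lap q) by exact: (L2_lap oOm qL).
have NL := L2N mOm FL.
apply: (ae_L2normB0 mOm lqL NL); have BL := L2B mOm lqL NL.
(* The limit of the Laplacians is identified by testing with the discrepancy [v = lap q + F]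
   itself. *)
apply/eqP; rewrite -sqrf_eq0 (L2norm2 mOm BL); set v := (lap q \- _).
rewrite -/v in BL *; rewrite {1}/v (innerBl mOm lqL NL BL) (innerNl mOm FL BL) opprK addrC addr_eq0; apply/eqP.
have C1 := inner_cvgl mOm (fun m => linL m f) FL BL (to0 F FL).
have C2 : \sum_k inner (Q m k k) v @[m --> \oo] --> \sum_k inner (q k k) v.
  apply: (cvg_big add_continuous) => k _.
  exact: (inner_cvgl mOm (fun m => QL m k k) (qL k k) BL (qP (k, k)).2).
apply: (cvg_unique _ C1) => //.
have -> : (fun m => inner (comb m f) v) = (fun m => - \sum_k inner (Q m k k) v).
  apply/funext => m; rewrite -[LHS]opprK -(lapE m v BL); congr (- _).
  exact: (inner_suml mOm _ _ (fun k => QL m k k) BL).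
by rewrite (inner_suml mOm _ _ (fun k => qL k k) BL); exact: cvgN C2.
Qed.

End linear_problem.

(** * The nonlinearity *)

Section clamp.
Context {R : realType}.
Implicit Types r s t : R.

Definition clamp r t : R := Num.max (- r) (Num.min t r).

Lemma clamp_id r t : `|t| <= r -> clamp r t = t.
Proof. by rewrite ler_norml => /andP[a c]; rewrite /clamp min_l// max_r. Qed.

Lemma clamp_in r t : 0 <= r -> `|clamp r t| <= r.
Proof.
move=> r0; rewrite /clamp ler_norml le_max lexx /= ge_max ge_min lexx orbT andbT.
lra.
Qed.

Lemma clamp_incr r s t : 0 <= r -> s <= t -> 0 <= clamp r t - clamp r s <= t - s.
Proof.
move=> r0 st; rewrite /clamp /Num.max /Num.min; apply/andP.
by case: (ltP s r) => ?; case: (ltP t r) => ?; do ?[case: ltP => ?]; split; lra.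
Qed.

End clamp.

Section nonlinearity.
Context {R : realType}.
Variables (g b : R -> R) (gamma M : R).
Hypotheses (dg : forall t, derivable g t 1) (cg : continuous (derive1 g))
  (hg : forall t, g t = gamma * t + b t) (hg' : forall t, derive1 g t <= M).
Implicit Types r s t : R.

Lemma mean_value (f f' : R -> R) s t : (forall x : R, is_derive x 1 f (f' x)) -> s < t ->
  exists2 c, s <= c <= t & f t - f s = f' c * (t - s).
Proof.
move=> df st; have [|c] := MVT st (fun x _ => df x).
  by apply: derivable_within_continuous => y _; have [] := df y.
by rewrite in_itv/= => /andP[a c'] E; exists c => //; rewrite !ltW.
Qed.

Let dgE (x : R) : is_derive x 1 g (derive1 g x).
Proof. by rewrite derive1E; exact/derivableP. Qed.

Lemma slope_le s t : s <= t -> g t - g s <= M * (t - s).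
Proof.
rewrite le_eqVlt => /orP[/eqP ->|st]; first by rewrite !subrr mulr0.
have [c _ ->] := mean_value dgE st; rewrite ler_wpM2r// subr_ge0; exact: ltW.
Qed.

Let db (x : R) : is_derive x 1 b (derive1 g x - gamma).
Proof.
have -> : b = fun t => g t - gamma * t by apply/funext => t; rewrite hg; ring.
have := dgE x => D; apply: is_derive_eq.
by rewrite scaler1.
Qed.

Lemma lipschitz_on r : exists2 L, 0 <= L &
  forall s t, `|s| <= r -> `|t| <= r -> `|b s - b t| <= L * `|s - t|.
Proof.
pose h x := derive1 g x - gamma.
have ch : continuous h by move=> x; apply: cvgB; [exact: cg|exact: cvg_cst].
have [L HL] : exists L, forall x, `|x| <= r -> `|h x| <= L.
  have [r0|r0] := ltP r 0.
    by exists 0 => x xr; have := le_lt_trans (le_trans (normr_ge0 x) xr) r0; rewrite ltxx.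
  have [||c _ Hc] := @EVT_max R (fun x => `|h x|) (- r) r; first lra.
    by apply: continuous_subspaceT => x; apply: cvg_norm; exact: ch.
  by exists `|h c| => x; rewrite ler_norml => xr; apply: Hc; rewrite in_itv.
exists `|L|; first exact: normr_ge0.
suff W s t : `|s| <= r -> `|t| <= r -> s < t -> `|b t - b s| <= `|L| * (t - s).
  move=> s t sr tr; have [st|st|->] := ltgtP s t; last by rewrite !subrr normr0 mulr0.
    by rewrite distrC [`|s - t|]distrC (gtr0_norm (_ : 0 < t - s)) ?subr_gt0//; exact: W.
  by rewrite (gtr0_norm (_ : 0 < s - t)) ?subr_gt0//; exact: W.
move=> sr tr st; have [c /andP[sc ct] ->] := mean_value db st.
rewrite normrM (gtr0_norm (_ : 0 < t - s)) ?subr_gt0// ler_wpM2r ?subr_ge0 ?(ltW st)//.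
apply: le_trans (ler_norm _); apply: HL; move: sr tr; rewrite !ler_norml => /andP[a _] /andP[_ e].
by rewrite (le_trans a sc) (le_trans ct e).
Qed.

Lemma continuous_nonlinearity : continuous b.
Proof.
by move=> x; apply: differentiable_continuous; apply/derivable1_diffP; have [] := db x.
Qed.

Lemma trunc_lipschitz r : 0 <= r -> exists2 L, 0 <= L &
  forall s t, `|b (clamp r s) - b (clamp r t)| <= L * `|s - t|.
Proof.
move=> r0; have [L L0 HL] := lipschitz_on r; exists L => // s t.
apply: le_trans (HL _ _ (clamp_in _ r0) (clamp_in _ r0)) _; apply: ler_wpM2l => //.
wlog st : s t / s <= t.
  by move=> W; have [/W//|/ltW/W] := leP s t; rewrite distrC [X in _ <= X]distrC.
have /andP[A B] := clamp_incr r0 st.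
by rewrite distrC (ger0_norm A) distrC ger0_norm ?subr_ge0.
Qed.

Variable B : R.
Hypothesis hB : forall t, `|b t| <= B.

Let B0 : 0 <= B. Proof. exact: le_trans (hB 0). Qed.

(* Otherwise [g] would outgrow [M t] at infinity, since [b] is bounded. *)
Lemma gamma_le : gamma <= M.
Proof.
rewrite leNgt; apply/negP => Mg.
pose t := (2 * B + 1) / (gamma - M).
have D0 : 0 < gamma - M by rewrite subr_gt0.
have t0 : 0 <= t by rewrite divr_ge0 ?ltW// ltr_wpDl ?mulr_ge0.
have := slope_le t0; rewrite !hg mulr0 add0r subr0 => H.
have E : (gamma - M) * t = 2 * B + 1 by rewrite mulrC divfK// gt_eqF.
have := hB 0; have := hB t; rewrite !ler_norml => /andP[b1 b2] /andP[b3 b4].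
by rewrite mulrBl in E; lra.
Qed.

(** The bound [g' <= M] for [gamma * t + beta t], written without derivatives because truncations
    are not differentiable at the cutoff level. *)
Definition one_sided (beta : R -> R) : Prop := forall s t,
  (gamma * s + beta s - (gamma * t + beta t)) * (s - t) <= M * (s - t) ^+ 2.

Let one_sidedP beta : (forall s t, s <= t ->
  gamma * t + beta t - (gamma * s + beta s) <= M * (t - s)) -> one_sided beta.
Proof.
move=> H s t; wlog st : s t / t <= s.
  move=> W; have [/W//|/ltW/W] := leP t s; move=> H1.
  by rewrite -[(s - t) ^+ 2]sqrrN opprB -mulrNN !opprB.
by rewrite expr2 mulrA; apply: ler_wpM2r; [rewrite subr_ge0|exact: H].
Qed.

Lemma one_sided_id : one_sided b.
Proof. by apply: one_sidedP => s t /slope_le; rewrite !hg. Qed.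

(* Split [t] as [clamp r t + (t - clamp r t)]: both summands are nondecreasing in [t]. *)
Lemma one_sided_trunc r : 0 <= r -> one_sided (b \o clamp r).
Proof.
move=> r0; apply: one_sidedP => s t st /=.
have /andP[A1 A2] := clamp_incr r0 st.
have := slope_le (_ : clamp r s <= clamp r t); rewrite -subr_ge0 => /(_ A1); rewrite !hg.
have A3 : 0 <= t - s - (clamp r t - clamp r s) by rewrite subr_ge0.
have := ler_wpM2r A3 gamma_le.
lra.
Qed.

Lemma trunc_diff r t : 0 < r -> `|b (clamp r t) - b t| <= 2 * B / r * `|t|.
Proof.
move=> r0; have [tr|/ltW tr] := leP `|t| r.
  by rewrite clamp_id// subrr normr0 !mulr_ge0// invr_ge0 ltW.
apply: (@le_trans _ _ (2 * B)).
  by apply: le_trans (ler_normB _ _) _; rewrite mulrDl mul1r lerD.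
by rewrite mulrAC ler_pdivlMr// ler_wpM2l// mulr_ge0.
Qed.

Lemma trunc_diff2 r r1 r2 t : 0 < r -> r <= r1 -> r <= r2 ->
  `|b (clamp r1 t) - b (clamp r2 t)| <= 2 * B / r * `|t|.
Proof.
move=> r0 rr1 rr2; have [tr|/ltW tr] := leP `|t| r.
  by rewrite !clamp_id ?(le_trans tr)// subrr normr0 !mulr_ge0// invr_ge0 ltW.
apply: (@le_trans _ _ (2 * B)).
  by apply: le_trans (ler_normB _ _) _; rewrite mulrDl mul1r lerD.
by rewrite mulrAC ler_pdivlMr// ler_wpM2l// mulr_ge0.
Qed.

Lemma continuous_lipschitz (beta : R -> R) (L : R) : 0 <= L ->
  (forall s t, `|beta s - beta t| <= L * `|s - t|) -> continuous beta.
Proof.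
move=> L0 H t; apply/cvgrPdist_le => e e0; have L1 : 0 < L + 1 by rewrite ltr_wpDl.
near=> s; apply: le_trans (H t s) _; apply: (@le_trans _ _ ((L + 1) * `|t - s|)).
  by apply: ler_wpM2r => //; rewrite lerDl.
rewrite mulrC -ler_pdivlMr//; near: s.
by apply: (@cvgr_dist_le _ _ _ (nbhs t) _ id); [exact: cvg_id|rewrite divr_gt0].
Unshelve. all: by end_near. Qed.

End nonlinearity.

(** * The semilinear problem *)

Section semilinear.
Context {R : realType} {d : nat}.
Local Notation n := d.+1.
Variables (Om : set 'rV[R]_n) (lam : nat -> R) (phi : nat -> 'rV[R]_n -> R).
Hypotheses (oOm : open Om) (bOm : bounded_set Om) (hphi : dirichlet_spectrum Om lam phi).
Implicit Types (u v w : 'rV[R]_n -> R) (beta : R -> R) (k r s t : R) (m : nat).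

Local Notation L2 := (L2 Om).
Local Notation inner := (inner Om).
Local Notation L2norm := (L2norm Om).

Let mOm : measurable Om := open_measurable_rV oOm.
#[local] Hint Resolve mOm : core.
Let phiL m : L2 (phi m) := phi_L2 oOm bOm hphi m.

Lemma L2_comp beta (C : R) u : continuous beta -> (forall t, `|beta t| <= C) -> L2 u ->
  L2 (fun x => beta (u x)).
Proof.
move=> cb hC uL.
have mb : measurable_fun [set: R] beta by exact: continuous_measurable_fun.
have mc : measurable_fun Om (beta \o u) by exact: (measurableT_comp mb (L2_measurable mOm uL)).
have := L2_bddM mOm mc (fun x _ => hC (u x)) (L2_1 oOm bOm).
by apply: L2_eq => x _ /=; rewrite mulr1.
Qed.

(** Banach's theorem on representatives: functions are not identified almost everywhere, so the
    fixed point equation reads as distance 0. *)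
Lemma contraction_fixpoint (Phi : ('rV[R]_n -> R) -> 'rV[R]_n -> R) (th : R) : 0 <= th < 1 ->
  (forall u, L2 u -> L2 (Phi u)) ->
  (forall u v, L2 u -> L2 v -> L2norm (Phi u \- Phi v) <= th * L2norm (u \- v)) ->
  exists2 u, L2 u & L2norm (Phi u \- u) = 0.
Proof.
move=> /andP[th0 th1] PL Pc; pose U m := iter m Phi (fun=> 0).
have UL m : L2 (U m) by elim: m => [|m IH]; [exact: L2_0|exact: PL].
have t1 : 0 < 1 - th by rewrite subr_gt0.
(* The sum of the geometric series of steps, characterized by [|U 0 - U 1| + th * D = D]. *)
pose D := L2norm (U 0 \- U 1) / (1 - th).
have D0 : 0 <= D by rewrite divr_ge0 ?L2norm_ge0// ltW.
have ED : L2norm (U 0 \- U 1) + th * D = D.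
  have : D * (1 - th) = L2norm (U 0 \- U 1) by rewrite divfK// gt_eqF.
  by lra.
have B0 l : L2norm (U 0 \- U l) <= D.
  elim: l => [|l IH]; first by rewrite (@L2norm_eq _ _ _ _ (fun=> 0)) ?(L2norm0 mOm)// => x _ /=; rewrite subrr.
  apply: le_trans (L2norm_tri mOm (UL 0) (UL 1) (UL l.+1)) _; rewrite -ED lerD2l.
  by apply: le_trans (Pc _ _ (UL 0) (UL l)) _; apply: ler_wpM2l.
have B m l : L2norm (U m \- U (m + l)) <= th ^+ m * D.
  elim: m => [|m IH]; first by rewrite mul1r.
  apply: le_trans (Pc _ _ (UL m) (UL _)) _; rewrite exprS -mulrA; exact: ler_wpM2l.
have T0 : th ^+ m * D @[m --> \oo] --> (0 : R).
  by rewrite -[0](mul0r D); apply: cvgMr_tmp; apply: cvg_expr; rewrite ger0_norm.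
have small e : 0 < e -> exists N0, forall m, (N0 <= m)%N -> th ^+ m * D <= e.
  move=> e0; have /cvgrPdist_le/(_ e e0)[N0 _ H] := T0; exists N0 => m mN.
  by have := H m mN; rewrite sub0r normrN ger0_norm// mulr_ge0// exprn_ge0.
have C e : 0 < e -> exists N0, forall m l, (N0 <= m)%N -> (N0 <= l)%N -> L2norm (U m \- U l) <= e.
  move=> /small[N0 H]; exists N0 => m l mN lN; have [ml|/ltnW lm] := leqP m l.
    by rewrite -(subnKC ml); apply: le_trans (B _ _) (H m mN).
  by rewrite (L2normBC mOm (UL _) (UL _)) -(subnKC lm); apply: le_trans (B _ _) (H l lN).
have [u uL Hu] := L2_complete mOm UL C; exists u => //.
apply/eqP; rewrite eq_le L2norm_ge0 andbT; apply: (@le_lin _ _ _ 2) => e e0.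
have /cvgrPdist_le/(_ e e0)[N0 _ H] := Hu.
have K m : (N0 <= m)%N -> L2norm (U m \- u) <= e.
  by move=> /(H m); rewrite sub0r normrN ger0_norm// L2norm_ge0.
apply: le_trans (L2norm_tri mOm (PL _ uL) (UL N0.+1) uL) _; rewrite add0r mulrDl mul1r.
apply: lerD; last exact: K.
apply: le_trans (Pc _ _ uL (UL N0)) _; rewrite (L2normBC mOm uL (UL N0)).
apply: le_trans (ler_wpM2l th0 (K N0 (leqnn _))) _; rewrite ger_pMl//; exact: ltW.
Qed.

Variables (N : nat) (f : 'rV[R]_n -> R) (xi : nat -> R) (gamma M : R).
Hypotheses (fL : L2 f) (M0 : 0 < M).

Definition reaction beta k u : 'rV[R]_n -> R := fun x => k * (gamma * u x + beta (u x)).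

(* The equation tested against [phi m] for [m >= N]; for [m < N] it only determines [mu]. *)
Definition weak_solution beta k u : Prop := [/\ L2 u,
  forall m, (m < N)%N -> inner u (phi m) = xi m &
  forall m, (N <= m)%N -> lam m * inner u (phi m) = inner (reaction beta k u) (phi m) - inner f (phi m)].

Definition bounded_continuous beta : Prop :=
  continuous beta /\ exists C : R, forall t, `|beta t| <= C.

Lemma L2_reaction beta k u : bounded_continuous beta -> L2 u -> L2 (reaction beta k u).
Proof.
move=> [cb [C hC]] uL.
exact: (L2Z mOm k (L2D mOm (L2Z mOm gamma uL) (L2_comp cb hC uL))).
Qed.

Lemma L2norm_reaction_diff beta1 beta2 k u v : 0 <= k -> bounded_continuous beta1 ->
  bounded_continuous beta2 -> L2 u -> L2 v ->
  L2norm (reaction beta1 k u \- reaction beta2 k v) <=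
  k * (`|gamma| * L2norm (u \- v) + L2norm ((fun x => beta1 (u x)) \- (fun x => beta2 (v x)))).
Proof.
move=> k0 [c1 [C1 h1]] [c2 [C2 h2]] uL vL.
have bL := L2B mOm (L2_comp c1 h1 uL) (L2_comp c2 h2 vL); have wL := L2B mOm uL vL.
have gL := L2Z mOm gamma wL.
rewrite -(L2normZ mOm gamma wL) -[k in leRHS](ger0_norm k0).
apply: le_trans (ler_wpM2l (normr_ge0 k) (L2normD_le mOm gL bL)).
rewrite -(L2normZ mOm k (L2D mOm gL bL)) le_eqVlt; apply/orP; left; apply/eqP.
by apply: L2norm_eq => x _; rewrite /reaction /=; ring.
Qed.

(** Allowing two nonlinearities and two parameters makes one inequality serve uniqueness, the Cauchy
    property of truncated solutions, and continuity in [k]. The one-sided bound is needed for the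
    first nonlinearity alone. *)
Lemma weak_solution_compare beta1 beta2 (k1 k2 : R) u v : 0 <= k1 ->
  bounded_continuous beta1 -> bounded_continuous beta2 -> one_sided gamma M beta1 ->
  weak_solution beta1 k1 u -> weak_solution beta2 k2 v ->
  (lam N - k1 * M) * L2norm (u \- v) <= L2norm (reaction beta1 k1 v \- reaction beta2 k2 v).
Proof.
move=> k10 c1 c2 os [uL u0 uE] [vL v0 vE]; set w := u \- v.
have wL : L2 w by exact: L2B.
have R1u := L2_reaction k1 c1 uL; have R1v := L2_reaction k1 c1 vL; have R2v := L2_reaction k2 c2 vL.
have GL := L2B mOm R1u R2v; have DL := L2B mOm R1v R2v; have SL := L2B mOm R1u R1v.
have gap := spectral_gap oOm bOm hphi (N := N) wL GL.
have {}gap : lam N * L2norm w ^+ 2 <= inner (reaction beta1 k1 u \- reaction beta2 k2 v) w.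
  apply: gap => m mN; first by rewrite (innerBl mOm uL vL (phiL m)) u0// v0// subrr.
  rewrite (innerBl mOm uL vL (phiL m)) mulrBr uE// vE// (innerBl mOm R1u R2v (phiL m)); ring.
have E : inner (reaction beta1 k1 u \- reaction beta2 k2 v) w =
    inner (reaction beta1 k1 u \- reaction beta1 k1 v) w + inner (reaction beta1 k1 v \- reaction beta2 k2 v) w.
  rewrite -(innerDl mOm SL DL wL); apply: inner_eq => // x _ /=; ring.
have S : inner (reaction beta1 k1 u \- reaction beta1 k1 v) w <= k1 * M * L2norm w ^+ 2.
  rewrite (L2norm2 mOm wL) -(innerZl mOm (k1 * M) wL wL).
  apply: (le_Rintegral mOm (L2_mul_integrable mOm SL wL)
    (L2_mul_integrable mOm (L2Z mOm (k1 * M) wL) wL)) => x _.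
  have O := ler_wpM2l k10 (os (u x) (v x)).
  rewrite /w /reaction /=.
  rewrite [leLHS](_ : _ = k1 * ((gamma * u x + beta1 (u x) - (gamma * v x + beta1 (v x))) * (u x - v x))).
    by rewrite [leRHS](_ : _ = k1 * (M * (u x - v x) ^+ 2))//; ring.
  by ring.
have CS := le_trans (ler_norm _) (inner_CS mOm DL wL).
have := L2norm_ge0 Om w; rewrite le_eqVlt => /orP[/eqP <-|w0]; first by rewrite mulr0 L2norm_ge0.
rewrite -(ler_pM2r w0) -mulrA -expr2 mulrBl; apply: le_trans CS; rewrite lerBlDr.
by apply: le_trans gap _; rewrite E addrC lerD2l.
Qed.

(* Adding [sg * u] to both sides makes the right-hand side nondecreasing in [u], with slope at most
   [sg + k * M], while the smallest relevant eigenvalue becomes [lam N + sg]. *)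
Lemma weak_solution_lipschitz beta k (L : R) : 0 <= k -> k * M < lam N ->
  bounded_continuous beta -> one_sided gamma M beta -> 0 <= L ->
  (forall s t, `|beta s - beta t| <= L * `|s - t|) -> exists u, weak_solution beta k u.
Proof.
move=> k0 kM cb os L0 HL.
(* [sg] is a Lipschitz constant of the reaction, the least shift visible from the hypotheses that
   makes it nondecreasing. *)
pose sg := k * (`|gamma| + L); have sg0 : 0 <= sg by rewrite mulr_ge0// addr_ge0.
have l0 := lam_gt0 hphi N.
have ls0 : 0 < lam N + sg by rewrite ltr_wpDr.
have lm m : (N <= m)%N -> 0 < lam m + sg.
  by move=> Nm; apply: lt_le_trans ls0 _; rewrite lerD2r (lam_le hphi Nm).
pose s := (lam N + sg)^-1; have s0 : 0 <= s by rewrite invr_ge0 ltW.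
have sm m : (N <= m)%N -> (lam m + sg)^-1 <= s.
  by move=> Nm; rewrite lef_pV2 ?posrE ?lm// lerD2r (lam_le hphi Nm).
pose G u := (reaction beta k u \- f) \+ (sg \*o u).
have GL u : L2 u -> L2 (G u).
  by move=> uL; exact: (L2D mOm (L2B mOm (L2_reaction k cb uL) fL) (L2Z mOm sg uL)).
pose cf u m := if (m < N)%N then xi m else (lam m + sg)^-1 * inner (G u) (phi m).
have /choice[Phi HPhi] : forall u, exists v, L2 u -> L2 v /\ forall m, inner v (phi m) = cf u m.
  move=> u; have [uL|] := pselect (L2 u); last by exists u.
  have [|v vL vE] := lincomb_complete oOm bOm hphi
      (a := fun m => if (m < N)%N then 0 else (lam m + sg)^-1 * inner (G u) (phi m)) (GL u uL) s0.
    move=> m; case: ltnP => [_|Nm]; first by rewrite normr0 mulr_ge0.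
    by rewrite normrM ler_wpM2r// ger0_norm ?sm// invr_ge0 ltW ?lm.
  have lL := lincomb_L2 oOm bOm hphi N xi.
  exists (lincomb phi N xi \+ v) => _; split; first exact: (L2D mOm lL vL).
  move=> m; rewrite (innerDl mOm lL vL (phiL m)) vE (inner_lincomb_phi oOm bOm hphi) /cf.
  by case: ifP; rewrite ?addr0 ?add0r.
have PL u : L2 u -> L2 (Phi u) by move=> /HPhi[].
(* For [x > y] the upper bound comes from the one-sided condition and the lower bound from the
   Lipschitz condition through [sg]. *)
have slope x y : `|k * (gamma * x + beta x) - k * (gamma * y + beta y) + sg * (x - y)| <= (sg + k * M) * `|x - y|.
  rewrite -mulrBr; set D := gamma * x + beta x - (gamma * y + beta y); set h := x - y.
  have D1 : `|D| <= (`|gamma| + L) * `|h|.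
    rewrite (_ : D = gamma * h + (beta x - beta y)); last by rewrite /D /h; ring.
    by apply: le_trans (ler_normD _ _) _; rewrite normrM mulrDl lerD2l; exact: HL.
  have D2 : D * h <= M * h ^+ 2 by exact: os.
  have D3 : k * `|D| <= sg * `|h| by rewrite /sg -mulrA ler_wpM2l.
  have sgh : 0 <= sg * `|h| by rewrite mulr_ge0.
  have [h0|h0|h0] := ltgtP h 0; last first.
  - by move: D3; rewrite h0 normr0 !mulr0 addr0 normrM (ger0_norm k0).
  - have DM : D <= M * h by rewrite -(ler_pM2r h0) -mulrA -expr2.
    have kD : k * D <= k * (M * h) by exact: ler_wpM2l.
    move: D3; rewrite (gtr0_norm h0) => D3.
    have : - (k * D) <= k * `|D| by rewrite -mulrN ler_wpM2l// -normrN ler_norm.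
    by move: D3 kD; rewrite ler_norml mulrDl -[k * M * h]mulrA; move: (k * `|D|) (k * D) (sg * h) (k * (M * h)) => *; apply/andP; split; lra.
  - have nh : 0 < - h by rewrite oppr_gt0.
    have DM : - D <= M * - h by rewrite -(ler_pM2r nh) mulrNN -mulrA -expr2 sqrrN.
    have kD : k * - D <= k * (M * - h) by exact: ler_wpM2l.
    move: D3; rewrite (ltr0_norm h0) => D3.
    have : k * D <= k * `|D| by rewrite ler_wpM2l// ler_norm.
    by move: D3 kD; rewrite ler_norml mulrDl -[k * M * - h]mulrA !mulrN; move: (k * `|D|) (k * D) (sg * h) (k * (M * h)) => *; apply/andP; split; lra.
(* [th = (sg + k * M) / (lam N + sg)], which is below 1 exactly when [k * M < lam N]. *)
pose th := s * (sg + k * M).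
have kM0 : 0 <= k * M by rewrite mulr_ge0// ltW.
have th01 : 0 <= th < 1.
  rewrite /th mulr_ge0 ?addr_ge0//= mulrC ltr_pdivrMr// mul1r addrC; rewrite ltrD2r.
  exact: kM.
have [|u uL u0] := contraction_fixpoint th01 PL.
  move=> u v uL vL; have [PuL Pu] := HPhi u uL; have [PvL Pv] := HPhi v vL.
  have GB := L2B mOm (GL u uL) (GL v vL).
  apply: (@le_trans _ _ (s * L2norm (G u \- G v))).
    apply: (coef_norm_le oOm bOm hphi (L2B mOm PuL PvL) GB s0) => m.
    rewrite (innerBl mOm PuL PvL (phiL m)) Pu Pv /cf; case: ltnP => [_|Nm].
      by rewrite subrr normr0 mulr_ge0.
    rewrite -mulrBr -(innerBl mOm (GL u uL) (GL v vL) (phiL m)) normrM ler_wpM2r//.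
    by rewrite ger0_norm ?sm// invr_ge0 ltW ?lm.
  rewrite /th -mulrA; apply: ler_wpM2l => //.
  have uvL := L2B mOm uL vL; have c0 : 0 <= sg + k * M by exact: addr_ge0.
  rewrite -[sg + k * M]ger0_norm// -(L2normZ mOm _ uvL).
  apply: (L2norm_le mOm GB (L2Z mOm _ uvL)) => x _.
  rewrite /G /reaction /= normrM (ger0_norm c0).
  apply: le_trans (slope (u x) (v x)); rewrite le_eqVlt; apply/orP; left; apply/eqP; congr (`|_|); ring.
exists u; have [PuL Pu] := HPhi u uL.
have uP m : inner u (phi m) = cf u m.
  rewrite -Pu; apply/eqP; rewrite eq_sym -subr_eq0 -(innerBl mOm PuL uL (phiL m)) -normr_le0.
  by apply: le_trans (inner_CS mOm (L2B mOm PuL uL) (phiL m)) _; rewrite u0 mul0r.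
split=> // m mN; rewrite uP /cf; first by rewrite mN.
have lm0 := lm m mN; have ul := uP m; rewrite /cf ltnNge mN/= in ul.
rewrite ltnNge mN /= -ul.
have RL := L2_reaction k cb uL.
have : (lam m + sg) * inner u (phi m) = inner (G u) (phi m) by rewrite ul mulrA divff ?mul1r// gt_eqF.
rewrite /G (innerDl mOm (L2B mOm RL fL) (L2Z mOm sg uL) (phiL m)) (innerBl mOm RL fL (phiL m)).
rewrite (innerZl mOm sg uL (phiL m)) mulrDl; exact: addIr.
Qed.

Variables (b : R -> R) (B : R).
Hypotheses (cb : continuous b) (hB : forall t, `|b t| <= B) (ob : one_sided gamma M b)
  (ot : forall r, 0 <= r -> one_sided gamma M (b \o clamp r))
  (lt : forall r, 0 <= r -> exists2 L, 0 <= L &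
     forall s t, `|b (clamp r s) - b (clamp r t)| <= L * `|s - t|).

Let B0 : 0 <= B. Proof. exact: le_trans (hB 0). Qed.

Lemma bounded_continuous_id : bounded_continuous b.
Proof. by split=> //; exists B. Qed.

Lemma bounded_continuous_trunc r : 0 <= r -> bounded_continuous (b \o clamp r).
Proof.
move=> r0; have [L L0 HL] := lt r0; split; last by exists B => t; exact: hB.
exact: (continuous_lipschitz L0 HL).
Qed.

Lemma L2norm_trunc_diff r u : 0 < r -> L2 u ->
  L2norm ((fun x => b (clamp r (u x))) \- (fun x => b (u x))) <= 2 * B / r * L2norm u.
Proof.
move=> r0 uL; have c0 : 0 <= 2 * B / r by rewrite !mulr_ge0// invr_ge0 ltW.
have [ct [C hC]] := bounded_continuous_trunc (ltW r0).
rewrite -[2 * B / r]ger0_norm// -(L2normZ mOm _ uL).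
apply: (L2norm_le mOm (L2B mOm (L2_comp ct hC uL) (L2_comp cb hB uL)) (L2Z mOm _ uL)) => x _.
by rewrite /= normrM (ger0_norm c0); exact: trunc_diff.
Qed.

(** [b] is not assumed globally Lipschitz, so it is compared with a truncation: the tails cost
    [2 * B / r] times the norms, uniformly for [v] near [u], and the truncation itself is
    Lipschitz. *)
Lemma superposition_continuous u : L2 u -> forall e : R, 0 < e -> exists2 del, 0 < del &
  forall v, L2 v -> L2norm (v \- u) <= del -> L2norm ((fun x => b (v x)) \- (fun x => b (u x))) <= e.
Proof.
move=> uL e e0; pose r := (2 * B) * (2 * L2norm u + 1) / (e / 2) + 1.
have u0 := L2norm_ge0 Om u; have e20 : 0 < e / 2 by rewrite divr_gt0.
have a0 : 0 <= (2 * B) * (2 * L2norm u + 1) by rewrite mulr_ge0 ?addr_ge0 ?mulr_ge0.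
have r0 : 0 < r by rewrite /r ltr_wpDl// divr_ge0// ltW.
have [L L0 HL] := lt (ltW r0); have L1 : 0 < L + 1 by rewrite ltr_wpDl.
exists (Num.min 1 (e / 2 / (L + 1))); first by rewrite lt_min ltr01 divr_gt0.
move=> v vL; rewrite le_min => /andP[v1 v2].
have [ct [C hC]] := bounded_continuous_trunc (ltW r0).
have bL w : L2 w -> L2 (fun x => b (w x)) by exact: (L2_comp cb hB).
have tL w : L2 w -> L2 (fun x => b (clamp r (w x))) by exact: (L2_comp ct hC).
have vn : L2norm v <= L2norm u + 1.
  have := le_trans (ler_norm _) (le_trans (L2norm_distB mOm vL uL) v1); lra.
apply: le_trans (L2norm_tri mOm (bL v vL) (tL v vL) (bL u uL)) _.
rewrite (L2normBC mOm (bL v vL) (tL v vL)).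
apply: le_trans (lerD (L2norm_trunc_diff r0 vL) (L2norm_tri mOm (tL v vL) (tL u uL) (bL u uL))) _.
have H2 : L2norm ((fun x => b (clamp r (v x))) \- (fun x => b (clamp r (u x)))) <= e / 2.
  have vu := L2B mOm vL uL.
  apply: (@le_trans _ _ (L2norm (L \*o (v \- u)))).
    apply: (L2norm_le mOm (L2B mOm (tL v vL) (tL u uL)) (L2Z mOm L vu)) => x _.
    by rewrite /= normrM (ger0_norm L0); exact: HL.
  rewrite (L2normZ mOm L vu) (ger0_norm L0); apply: le_trans (ler_wpM2l L0 v2) _.
  by rewrite mulrCA ger_pMr// ler_pdivrMr// mul1r lerDl.
have c0 : 0 <= 2 * B / r by rewrite !mulr_ge0// invr_ge0 ltW.
have H1 : 2 * B / r * L2norm v + 2 * B / r * L2norm u <= e / 2.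
  rewrite -mulrDr; apply: (@le_trans _ _ (2 * B / r * (2 * L2norm u + 1))); first by apply: ler_wpM2l => //; lra.
  rewrite mulrAC ler_pdivrMr// /r [leRHS]mulrDr [e / 2 * (_ / _)]mulrC divfK ?gt_eqF// mulr1 lerDl; exact: ltW.
have := L2norm_trunc_diff r0 uL; move: H1 H2; rewrite addrCA.
move: (L2norm _) (L2norm _) (2 * B / r * L2norm v) (2 * B / r * L2norm u) => *; lra.
Qed.

Lemma weak_solution_exists k : 0 <= k -> k * M < lam N -> exists u, weak_solution b k u.
Proof.
move=> k0 kM; have D0 : 0 < lam N - k * M by rewrite subr_gt0.
pose bt (j : nat) := b \o clamp j.+1%:R.
have r0 (j : nat) : 0 <= j.+1%:R :> R by [].
have cbt j : bounded_continuous (bt j) by exact: bounded_continuous_trunc.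
have /choice[U HU] : forall j, exists u, weak_solution (bt j) k u.
  move=> j; have [L L0 HL] := lt (r0 j).
  exact: (weak_solution_lipschitz k0 kM (cbt j) (ot (r0 j)) L0 HL).
have UL j : L2 (U j) by have [] := HU j.
pose A := 2 * B * k / (lam N - k * M).
have A0 : 0 <= A by rewrite !mulr_ge0// invr_ge0 ltW.
(* The truncations [bt i] and [bt j] agree on [[-(m+1), m+1]], so at [U j] they differ by at most
   [2 * B / (m+1)] times [|U j|]; the comparison inequality does the rest. *)
have step (i j m : nat) : (m <= i)%N -> (m <= j)%N ->
    L2norm (U i \- U j) <= A * L2norm (U j) / m.+1%:R.
  move=> mi mj; have := weak_solution_compare k0 (cbt i) (cbt j) (ot (r0 i)) (HU i) (HU j).
  rewrite mulrC -ler_pdivlMr// => /le_trans; apply.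
  rewrite /A ler_pdivrMr//; apply: (@le_trans _ _ (L2norm ((k * (2 * B / m.+1%:R)) \*o U j))).
    apply: (L2norm_le mOm (L2B mOm (L2_reaction k (cbt i) (UL j)) (L2_reaction k (cbt j) (UL j)))
      (L2Z mOm _ (UL j))) => x _.
    rewrite /reaction /= (_ : _ - _ = k * (bt i (U j x) - bt j (U j x))); last by ring.
    have c0 : 0 <= 2 * B / m.+1%:R by rewrite mulr_ge0// mulr_ge0.
    rewrite -[k * _ * _]mulrA normrM [leRHS]normrM (ger0_norm k0); apply: ler_wpM2l => //.
    rewrite [leRHS]normrM (ger0_norm c0); apply: trunc_diff2 => //; by rewrite ler_nat.
  have c0 : 0 <= k * (2 * B / m.+1%:R) by rewrite !mulr_ge0.
  rewrite (L2normZ mOm _ (UL j)) (ger0_norm c0) le_eqVlt; apply/orP; left; apply/eqP.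
  rewrite [_ * (lam N - k * M)]mulrC !mulrA [(lam N - k * M) * 2]mulrC.
  have Dn : lam N - k * M != 0 by rewrite gt_eqF.
  by move: (m.+1%:R^-1) (lam N - k * M) Dn => y z z0; field.
(* Uniform bound on all [U j], from [step] with [m = 0] against [U 0]. *)
pose C0 := (1 + A) * L2norm (U 0).
have C00 : 0 <= C0 by rewrite mulr_ge0 ?L2norm_ge0// addr_ge0.
have UC j : L2norm (U j) <= C0.
  have := step j 0%N 0%N (leq0n _) (leqnn _); rewrite divr1 => H.
  have := le_trans (ler_norm _) (le_trans (L2norm_distB mOm (UL j) (UL 0)) H).
  by rewrite /C0 mulrDl mul1r lerBlDl.
have small (e c : R) : 0 < e -> 0 <= c -> exists m : nat, c / m.+1%:R <= e.
  move=> e0 c0; have [m _ Hm] := nbhs_infty_ger (c / e); exists m.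
  have := Hm m (leqnn m); rewrite ler_pdivrMr// => H; rewrite ler_pdivrMr//.
  by apply: le_trans H _; rewrite mulrC ler_wpM2l ?ler_nat// ltW.
have [u uL Hu] : exists2 u, L2 u & L2norm (U m \- u) @[m --> \oo] --> (0 : R).
  apply: (L2_complete mOm UL) => e e0.
  have [m Hm] := small e (A * C0) e0 (mulr_ge0 A0 C00); exists m => i j mi mj.
  apply: le_trans (step i j m mi mj) (le_trans _ Hm).
  by rewrite ler_pM2r ?invr_gt0//; apply: ler_wpM2l.
have cbb := bounded_continuous_id.
have RU j := L2_reaction k (cbt j) (UL j); have Ru := L2_reaction k cbb uL.
(* Both the function and the nonlinearity vary with [j]: the truncation error is taken at [U j],
   using the uniform bound, and the remaining difference is continuity of [b] on L^2 at [u]. *)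
have Rc : L2norm (reaction (bt j) k (U j) \- reaction b k u) @[j --> \oo] --> (0 : R).
  apply/cvgrPdist_le => e e0; have c1 : 0 < k * (`|gamma| + 2) + 1 by rewrite ltr_wpDl// mulr_ge0// addr_ge0.
  pose e1 := e / (k * (`|gamma| + 2) + 1); have e10 : 0 < e1 by rewrite divr_gt0.
  have [del del0 Hdel] := superposition_continuous uL e10.
  have [m Hm] := small e1 (2 * B * C0) e10 (mulr_ge0 (mulr_ge0 (ler0n _ _) B0) C00).
  have /cvgrPdist_le H := Hu; near=> j.
  have Uj r : 0 < r -> `|0 - L2norm (U j \- u)| <= r -> L2norm (U j \- u) <= r.
    by move=> r1; rewrite sub0r normrN ger0_norm// L2norm_ge0.
  have H1 : L2norm (U j \- u) <= e1 by apply: Uj => //; near: j; exact: H.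
  have H2 : L2norm (U j \- u) <= del by apply: Uj => //; near: j; exact: H.
  have mj : (m <= j)%N by near: j; exact: nbhs_infty_ge.
  have H3 := Hdel (U j) (UL j) H2.
  have H4 : L2norm ((fun x => bt j (U j x)) \- (fun x => b (U j x))) <= e1.
    apply: le_trans (L2norm_trunc_diff (ltr0Sn _ j) (UL j)) _; apply: le_trans Hm.
    rewrite mulrAC; apply: ler_pM; rewrite ?invr_ge0 ?mulr_ge0 ?L2norm_ge0//.
      by apply: ler_wpM2l => //; rewrite mulr_ge0.
    by rewrite lef_pV2 ?posrE// ler_nat.
  rewrite sub0r normrN ger0_norm ?L2norm_ge0//.
  apply: le_trans (L2norm_reaction_diff k0 (cbt j) cbb (UL j) uL) _.
  have [ct [C hC]] := cbt j.
  have H5 := L2norm_tri mOm (L2_comp ct hC (UL j)) (L2_comp cb hB (UL j)) (L2_comp cb hB uL).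
  apply: (@le_trans _ _ (k * ((`|gamma| + 2) * e1))).
    apply: ler_wpM2l => //; rewrite mulrDl; apply: lerD; first exact: ler_wpM2l.
    by apply: le_trans H5 _; rewrite mulrDl mul1r; exact: lerD.
  by rewrite mulrA /e1 mulrCA ger_pMr// ler_pdivrMr// mul1r lerDl.
exists u; split=> // m mN.
  have C1 := inner_cvgl mOm UL uL (phiL m) Hu.
  apply: (cvg_unique _ C1) => //; apply: cvg_near_cst; apply: nearW => j.
  by have [_ H _] := HU j; rewrite H.
have C1 := inner_cvgl mOm UL uL (phiL m) Hu.
have C2 := inner_cvgl mOm RU Ru (phiL m) Rc.
have C3 : lam m * inner (U j) (phi m) @[j --> \oo] --> lam m * inner u (phi m) by exact: cvgMl_tmp.
have C4 : inner (reaction (bt j) k (U j)) (phi m) - inner f (phi m) @[j --> \oo] -->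
    inner (reaction b k u) (phi m) - inner f (phi m) by apply: cvgB => //; exact: cvg_cst.
apply: (cvg_unique _ C3) => //.
rewrite (_ : (fun j => lam m * _) = (fun j => inner (reaction (bt j) k (U j)) (phi m) - inner f (phi m)))//.
by apply/funext => j; have [_ _ H] := HU j; exact: H.
Unshelve. all: by end_near. Qed.

Lemma weak_solution_unique k u v : 0 <= k -> k * M < lam N ->
  weak_solution b k u -> weak_solution b k v -> L2norm (u \- v) = 0.
Proof.
move=> k0 kM su sv; have D0 : 0 < lam N - k * M by rewrite subr_gt0.
have := weak_solution_compare k0 bounded_continuous_id bounded_continuous_id ob su sv.
rewrite [X in _ <= X](@L2norm_eq _ _ _ _ (fun=> 0)) ?(L2norm0 mOm); last by move=> x _ /=; rewrite subrr.
by rewrite pmulr_rle0// => H; apply/eqP; rewrite eq_le H L2norm_ge0.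
Qed.

(** Besides [v] itself the reaction term is shown to be close: it carries both the Laplacian of the
    difference and the multipliers, hence the H^2 norm and [mu]. *)
Lemma weak_solution_continuous (k0 : R) u0 : 0 <= k0 -> k0 * M < lam N -> weak_solution b k0 u0 ->
  forall e : R, 0 < e -> exists2 del, 0 < del & forall k v, 0 <= k -> `|k - k0| <= del ->
    weak_solution b k v ->
    L2norm (v \- u0) <= e /\ L2norm (reaction b k v \- reaction b k0 u0) <= e.
Proof.
move=> k00 kM s0 e e0; have [uL _ _] := s0; have cbb := bounded_continuous_id.
pose D := lam N - k0 * M; have D0 : 0 < D by rewrite subr_gt0.
have gL := L2_reaction 1 cbb uL; pose G := L2norm (reaction b 1 u0).
have G0 : 0 <= G by exact: L2norm_ge0.
pose c := (k0 + 1) * (`|gamma| + 1) + 1.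
have c0 : 0 < c by rewrite ltr_wpDl// mulr_ge0 ?addr_ge0.
pose e1 := e / 2 / c; have e10 : 0 < e1 by rewrite !divr_gt0.
have [eta eta0 Heta] := superposition_continuous uL e10.
pose r := Num.min e (Num.min e1 eta).
have r0 : 0 < r by rewrite !lt_min e0 e10 eta0.
(* The four bounds give in turn [k <= k0 + 1], a gap [lam N - k * M] of at least [D / 2], distance
   at most [r] from [u0], and at most [e / 2] for the explicit dependence of the reaction on [k]. *)
pose del := Num.min (Num.min 1 (D / (2 * M))) (Num.min (r * D / (2 * (G + 1))) (e / (2 * (G + 1)))).
have G1 : 0 < 2 * (G + 1) by rewrite mulr_gt0// ltr_wpDl.
have M20 : 0 < 2 * M by rewrite mulr_gt0.
exists del; first by rewrite !lt_min ltr01 !divr_gt0// mulr_gt0.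
move=> k v k0' ; rewrite !le_min => /andP[/andP[d1 d2] /andP[d3 d4]] sv; have [vL _ _] := sv.
have E : L2norm (reaction b k u0 \- reaction b k0 u0) = `|k - k0| * G.
  rewrite /G -(L2normZ mOm _ gL); apply: L2norm_eq => x _; rewrite /reaction /=; ring.
have kk : `|k - k0| * M <= D / 2.
  by move: d2; rewrite ler_pdivlMr// mulrCA ler_pdivlMr// mulrC.
have Dk : D / 2 <= lam N - k * M.
  have : (k - k0) * M <= `|k - k0| * M by rewrite ler_pM2r// ler_norm.
  by rewrite mulrBl; move: kk; rewrite /D; lra.
have W : L2norm (v \- u0) <= r.
  have := weak_solution_compare k0' cbb cbb ob sv s0; rewrite E => H.
  have W0 := L2norm_ge0 Om (v \- u0).
  have H1 : D / 2 * L2norm (v \- u0) <= `|k - k0| * G by apply: le_trans H; exact: ler_wpM2r.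
  have H2 : `|k - k0| * G <= r * D / 2.
    move: d3; rewrite ler_pdivlMr// => d3; have := normr_ge0 (k - k0); nra.
  have := le_trans H1 H2; rewrite mulrC -mulrA ler_pM2r// divr_gt0//.
move: W; rewrite !le_min => /and3P[W1 W2 W3]; split=> //.
have H3 := Heta v vL W3.
have RvL := L2_reaction k cbb vL; have RuL := L2_reaction k cbb uL; have R0L := L2_reaction k0 cbb uL.
apply: le_trans (L2norm_tri mOm RvL RuL R0L) _; rewrite E [e in _ <= e]splitr; apply: lerD.
  apply: le_trans (L2norm_reaction_diff k0' cbb cbb vL uL) _.
  have k1 : k <= k0 + 1 by have := le_trans (ler_norm _) d1; lra.
  apply: (@le_trans _ _ ((k0 + 1) * ((`|gamma| + 1) * e1))).
    apply: ler_pM => //; first by rewrite addr_ge0 ?mulr_ge0 ?L2norm_ge0.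
    by rewrite mulrDl mul1r; apply: lerD => //; exact: ler_wpM2l.
  rewrite mulrA /e1 mulrCA ger_pMr ?divr_gt0// ler_pdivrMr// mul1r; by rewrite /c lerDl.
move: d4; rewrite ler_pdivlMr// => d4; have := normr_ge0 (k - k0); nra.
Qed.

End semilinear.

(** * Solutions and multipliers *)

Section solution.
Context {R : realType} {d : nat}.
Local Notation n := d.+1.
Variables (Om : set 'rV[R]_n) (lam : nat -> R) (phi : nat -> 'rV[R]_n -> R).
Hypotheses (oOm : open Om) (bOm : bounded_set Om) (sbOm : smooth_boundary Om)
  (hphi : dirichlet_spectrum Om lam phi).
Variables (N : nat) (f : 'rV[R]_n -> R) (g b : R -> R) (gamma : R).
Hypotheses (fL : L2 Om f) (f0 : forall j, (j < N)%N -> inner Om f (phi j) = 0)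
  (hg : forall t, g t = gamma * t + b t) (cb : bounded_continuous b).
Implicit Types (u v : 'rV[R]_n -> R) (k : R) (m : nat) (xi mu : 'rV[R]_N).

Local Notation L2 := (L2 Om).
Local Notation inner := (inner Om).
Local Notation L2norm := (L2norm Om).
Local Notation react := (reaction gamma b).

Let mOm : measurable Om := open_measurable_rV oOm.
#[local] Hint Resolve mOm : core.
Let phiL m : L2 (phi m) := phi_L2 oOm bOm hphi m.
Let linL K a : L2 (lincomb phi K a) := lincomb_L2 oOm bOm hphi K a.

(** A vector read as a sequence, by default 0 from [N] on. *)
Definition extend0 xi m : R := oapp (xi ord0) 0 (insub m : option 'I_N).

Lemma extend0E xi (j : 'I_N) : extend0 xi j = xi ord0 j.
Proof. by rewrite /extend0 valK. Qed.

Lemma sum_extend0 mu : (fun x => \sum_(j < N) mu ord0 j * phi j x) = lincomb phi N (extend0 mu).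
Proof. by apply/funext => x; apply: eq_bigr => j _; rewrite extend0E. Qed.

(** The equation tested against [phi j] with [j < N], where [f] contributes nothing because it is
    orthogonal to these eigenfunctions. *)
Definition multipliers xi k u : 'rV[R]_N :=
  \row_j (inner (react k u) (phi j) - lam j * xi ord0 j).

Local Notation weak_sol xi := (weak_solution Om lam phi N f (extend0 xi) gamma b).

(** Reduces the theorem to L^2 functions and their coefficients. From right to left this is
    regularity: [H2_solve] applies because the chosen [mu] makes the coefficient equations hold
    below [N] as well. *)
Lemma solutionP xi mu k u :
  solution Om phi k g f mu u /\ signature Om phi N u = xi <->
  weak_sol xi k u /\ mu = multipliers xi k u.
Proof.
have coef0 m : inner (lincomb phi N (extend0 mu)) (phi m) = if (m < N)%N then extend0 mu m else 0.
  exact: (inner_lincomb_phi oOm bOm hphi).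
split=> [[[s2 s1 eq] su]|[[uL u0 ue] muE]].
- have D := sobolev_H2 oOm bOm s2 s1; have [[uL _ _] qL _] := D.
  have RL := L2_reaction oOm bOm gamma k cb uL.
  have lL : L2 (laplacian Om u) by exact: (L2_lap oOm qL).
  have E m : inner (react k u) (phi m) - lam m * inner u (phi m) =
      (if (m < N)%N then extend0 mu m else 0) + inner f (phi m).
    rewrite -coef0 -(innerDl mOm (linL N (extend0 mu)) fL (phiL m)).
    rewrite [LHS]addrC -(inner_lap_spectrum oOm bOm hphi m D) -(innerDl mOm lL RL (phiL m)).
    apply: (inner_ae_eq mOm (L2D mOm lL RL) (phiL m) (L2D mOm (linL _ _) fL) (phiL m)).
      apply: filterS eq => x H Ox; have := H Ox; rewrite -sum_extend0 /= /reaction -hg => <-.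
      by [].
    exact: ae_eq_refl.
  have us (j : 'I_N) : inner u (phi j) = xi ord0 j by rewrite -su mxE.
  split; first split=> // [m mN|m Nm].
  + exact: (etrans (us (Ordinal mN)) (esym (extend0E xi (Ordinal mN)))).
  + have := E m; rewrite ltnNge Nm /= add0r => <-; ring.
  + apply/rowP => j; rewrite mxE -us; have := E j; rewrite ltn_ord f0// addr0 extend0E => <-.
    by [].
- have RL := L2_reaction oOm bOm gamma k cb uL.
  have FL := L2B mOm (L2B mOm RL fL) (linL N (extend0 mu)).
  have [|p [q [D lE]]] := H2_solve oOm bOm hphi sbOm uL FL.
    move=> m; rewrite (innerBl mOm (L2B mOm RL fL) (linL N (extend0 mu)) (phiL m)).
    rewrite (innerBl mOm RL fL (phiL m)) coef0; case: ltnP => mN; last by rewrite ue// subr0.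
    rewrite u0// f0// muE (extend0E _ (Ordinal mN) : extend0 (multipliers xi k u) m = _) mxE /=.
    rewrite -(extend0E xi (Ordinal mN)) /=; ring.
  have [s2 s1] := H2_sobolev oOm bOm D; split; first split=> //.
    apply: filterS2 (H2_laplacian oOm bOm D) lE => x H1 H2 Ox.
    rewrite H1// H2// -sum_extend0 /= /reaction -hg; ring.
  by apply/rowP => j; rewrite mxE u0 ?extend0E.
Qed.

(** Upgrades L^2 continuity to H^2: the difference of two weak solutions of equal signature itself
    solves a linear problem. *)
Lemma weak_solution_stable xi : exists2 C, 0 <= C & forall (k1 k2 : R) u v,
  weak_sol xi k1 u -> weak_sol xi k2 v ->
  sobolev_norm Om 2 (u \- v) <= C * (L2norm (react k1 u \- react k2 v) + L2norm (u \- v)).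
Proof.
have [C C0 HC] := H2_estimate oOm bOm hphi sbOm; exists C => // k1 k2 u v [uL u0 ue] [vL v0 ve].
have R1 := L2_reaction oOm bOm gamma k1 cb uL; have R2 := L2_reaction oOm bOm gamma k2 cb vL.
set De := react k1 u \- react k2 v; have DL : L2 De by exact: (L2B mOm R1 R2).
(* Removing the first [N] modes from [De] reflects the equal signatures; it does not increase the
   norm. *)
pose c m := inner De (phi m); have FL := L2B mOm DL (linL N c).
have wL := L2B mOm uL vL.
have Fm m : inner (De \- lincomb phi N c) (phi m) = if (m < N)%N then 0 else inner De (phi m).
  rewrite (innerBl mOm DL (linL N c) (phiL m)) (inner_lincomb_phi oOm bOm hphi).
  by case: ifP => _; rewrite ?subr0 // subrr.
have [|p [q [D lE]]] := H2_solve oOm bOm hphi sbOm wL FL.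
  move=> m; rewrite Fm (innerBl mOm uL vL (phiL m)); case: ltnP => mN.
    by rewrite u0// v0// subrr mulr0.
  by rewrite mulrBr ue// ve// (innerBl mOm R1 R2 (phiL m)); ring.
have [_ _ H] := HC _ _ _ D; apply: le_trans H _; apply: ler_wpM2l => //; rewrite lerD2r.
have [_ qL _] := D; rewrite (L2norm_ae_eq mOm (L2_lap oOm qL) (L2N mOm FL) lE) (L2normN mOm FL).
rewrite -[leRHS]mul1r; apply: (coef_norm_le oOm bOm hphi FL DL ler01) => m.
by rewrite Fm mul1r; case: ifP; rewrite ?normr0.
Qed.

Lemma multipliers_dist xi (k1 k2 : R) u v (j : 'I_N) : L2 u -> L2 v ->
  `|multipliers xi k1 u ord0 j - multipliers xi k2 v ord0 j| <= L2norm (react k1 u \- react k2 v).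
Proof.
move=> uL vL; rewrite !mxE.
have R1 := L2_reaction oOm bOm gamma k1 cb uL; have R2 := L2_reaction oOm bOm gamma k2 cb vL.
rewrite (_ : _ - _ = inner (react k1 u) (phi j) - inner (react k2 v) (phi j)); last by ring.
rewrite -(innerBl mOm R1 R2 (phiL j)); apply: le_trans (inner_CS mOm (L2B mOm R1 R2) (phiL j)) _.
by rewrite (L2normE mOm (phiL j)) (inner_phi hphi) eqxx sqrtr1 mulr1.
Qed.

End solution.

Theorem theorem3p1 (R : realType) (d : nat) (Om : set 'rV[R]_d.+1)
    (lam : nat -> R) (phi : nat -> 'rV[R]_d.+1 -> R)
    (n : nat) (e : 'rV[R]_d.+1 -> R) (g b : R -> R) (gamma M : R)
    (hOm : smooth_bounded_domain Om)
    (hphi : dirichlet_spectrum Om lam phi)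
    (hn : (1 <= n)%N)
    (he : L2 Om e)
    (heorth : forall j, (j < n)%N -> inner Om e (phi j) = 0)
    (hgC1 : (forall t, derivable g t 1) /\ continuous (derive1 g))
    (hg : forall t, g t = gamma * t + b t)
    (hb : bounded_fun b)
    (hM : 0 < M)
    (hg' : forall t, derive1 g t <= M) :
  (forall k : R, 0 <= k -> k * M < lam n -> forall xi : 'rV[R]_n,
     (exists! mu : 'rV[R]_n, exists u,
        solution Om phi k g e mu u /\ signature Om phi n u = xi) /\
     (forall (mu : 'rV[R]_n) u v,
        solution Om phi k g e mu u -> signature Om phi n u = xi ->
        solution Om phi k g e mu v -> signature Om phi n v = xi ->
        u = v %[ae lebesgue_rV d.+1 in Om])) /\
  (forall xi : 'rV[R]_n,
     let K := [set k : R | 0 <= k <= 1 /\ k * M < lam n] in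
     exists (u : R -> 'rV[R]_d.+1 -> R) (mu : R -> 'rV[R]_n),
       [/\ forall k, K k -> solution Om phi k g e (mu k) (u k) /\
                            signature Om phi n (u k) = xi,
           forall k0, K k0 ->
             sobolev_norm Om 2 (u k \- u k0) @[k --> within K (nbhs k0)]
               --> (0 : R) &
           {within K, continuous mu}]).
Proof.
have [_ oOm _ bOm sbOm] := hOm; have [dg cg] := hgC1.
have [B hB] : exists B, forall t, `|b t| <= B.
  have [B [_ HB]] := hb; exists (B + 1) => t; apply: HB => //; by rewrite ltrDl.
have cb := continuous_nonlinearity dg hg.
have bc : bounded_continuous b by split=> //; exists B.
have ob := one_sided_id dg hg hg'; have lt r := @trunc_lipschitz _ _ _ _ dg cg hg r.
have ot r := @one_sided_trunc _ _ _ _ _ dg hg hg' _ hB r.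
have solP := @solutionP _ _ _ _ _ oOm bOm sbOm hphi n e g b gamma he heorth hg bc.
have ex xi := weak_solution_exists oOm bOm hphi (N := n) xi he hM cb hB ot lt.
pose W (xi : 'rV[R]_n) := weak_solution Om lam phi n e (extend0 xi) gamma b.
split=> [k k0 kM xi|xi K].
  have uniq u v : W xi k u -> W xi k v -> u = v %[ae lebesgue_rV d.+1 in Om].
    move=> su sv; have [uL _ _] := su; have [vL _ _] := sv.
    apply: (ae_L2normB0 (open_measurable_rV oOm) uL vL).
    exact: (weak_solution_unique oOm bOm hphi cb hB ob k0 kM su sv).
  have sig mu u : solution Om phi k g e mu u -> signature Om phi n u = xi ->
      W xi k u /\ mu = multipliers Om lam phi b gamma xi k u.
    by move=> s1 s2; exact: (solP _ _ _ _).1 (conj s1 s2).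
  split; last by move=> mu u v su xu sv xv; exact: uniq (sig _ _ su xu).1 (sig _ _ sv xv).1.
  have [u su] := ex (extend0 xi) k k0 kM.
  exists (multipliers Om lam phi b gamma xi k u); split.
    by exists u; exact: (solP xi _ k u).2 (conj su erefl).
  move=> mu [v [sv xv]]; have [wv ->] := sig _ _ sv xv; apply/rowP => j.
  have [uL _ _] := su; have [vL _ _] := wv.
  (* The multipliers depend on the solution only through integrals, which almost everywhere equal
     solutions share. *)
  rewrite !mxE; congr (_ - _).
  have pL := phi_L2 oOm bOm hphi j.
  have Ru := L2_reaction oOm bOm gamma k bc uL; have Rv := L2_reaction oOm bOm gamma k bc vL.
  apply: (inner_ae_eq (open_measurable_rV oOm) Ru pL Rv pL _ (ae_eq_refl _ _ _)).
  by apply: filterS (uniq _ _ su wv) => x H Ox; rewrite /reaction H.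
(* A representative is fixed for each parameter, the zero function being the default outside [K];
   continuity comes from uniqueness-type estimates and not from the choice. *)
have /choice[u Hu] : forall k, exists u, K k -> W xi k u.
  move=> k; have [[/andP[k0 _] kM]|nK] := pselect (K k); last by exists (fun=> 0).
  by have [u su] := ex (extend0 xi) k k0 kM; exists u.
exists u, (fun k => multipliers Om lam phi b gamma xi k (u k)).
(* Closeness of solutions and of reactions together: the first conclusion on the curve uses both,
   the continuity of [mu] only the second. *)
have cont k0 : K k0 -> forall eps, 0 < eps -> \forall k \near within K (nbhs k0), K k /\
    L2norm Om (u k \- u k0) <= eps /\
    L2norm Om (reaction gamma b k (u k) \- reaction gamma b k0 (u k0)) <= eps.
  move=> Kk0 eps eps0; have [/andP[k00 _] kM] := Kk0.
  have [del del0 H] := weak_solution_continuous oOm bOm hphi hM cb hB ob lt k00 kM (Hu _ Kk0) eps0.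
  apply/nbhs_ballP; exists del => //= k; rewrite /ball/= => kd Kk; split=> //.
  have [/andP[k1 _] _] := Kk; apply: (H _ _ k1 _ (Hu _ Kk)).
  by rewrite distrC ltW.
split=> [k Kk|k0 Kk0|].
- exact: (solP xi _ k (u k)).2 (conj (Hu _ Kk) erefl).
- have [C C0 HC] := weak_solution_stable oOm bOm sbOm hphi e gamma bc xi.
  apply/cvgrPdist_le => eps eps0; have c1 : 0 < 2 * C + 1 by rewrite ltr_wpDl// mulr_ge0.
  have := cont k0 Kk0 (eps / (2 * C + 1)); rewrite divr_gt0// => /(_ isT).
  apply: filterS => k [Kk [H1 H2]]; rewrite sub0r normrN ger0_norm ?sqrtr_ge0//.
  apply: le_trans (HC _ _ _ _ (Hu _ Kk) (Hu _ Kk0)) _.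
  apply: le_trans (ler_wpM2l C0 (lerD H2 H1)) _.
  have -> : C * (eps / (2 * C + 1) + eps / (2 * C + 1)) = eps * (2 * C / (2 * C + 1)) by ring.
  by rewrite ger_pMr// ler_pdivrMr// mul1r lerDl.
- apply/subspace_continuousP => k0 Kk0; apply/cvg_ballP => eps eps0.
  have := cont k0 Kk0 (eps / 2); rewrite divr_gt0// => /(_ isT).
  apply: filterS => k [Kk [H1 H2]]; apply/ball_rV; split=> // j.
  have [uL _ _] := Hu _ Kk; have [vL _ _] := Hu _ Kk0; rewrite distrC.
  have D := multipliers_dist oOm bOm hphi gamma bc xi k k0 j uL vL.
  by apply: (le_lt_trans (le_trans D H2)); rewrite ltr_pdivrMr// ltr_pMr// ltr1n.
Qed.
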